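(* Let $\mathbf{k}=(k_1,\ldots,k_n)$ be a (not necessarily admissible) index of depth $n\ge 1$ and let $k=k_1+\cdots+k_n$ be its weight. (1) If $k$ and $n$ have the same parity, then $\zeta^{\natural,\mathcal F}(\mathbf{k})\in Z_{k,+}$. (2) If $k$ and $n$ have different parities and $k\ne 2$, then the following congruence holds modulo $Z_{k,+}+Z_{k,\le n-2}$: $$\zeta^{\natural,\mathcal F}(\mathbf{k})\equiv -(-1)^{k_1}\sum_{\substack{\ell_2,\ldots,\ell_n\ge 0\\ \ell_2+\cdots+\ell_n=k_1}}\ \prod_{i=2}^n\binom{k_i+\ell_i-1}{\ell_i}\cdot\zeta(k_2+\ell_2,\ldots,k_n+\ell_n)$$ $$\qquad\qquad+(-1)^{k_n}\sum_{\substack{\ell_1,\ldots,\ell_{n-1}\ge 0\\ \ell_1+\cdots+\ell_{n-1}=k_n}}\ \prod_{i=1}^{n-1}\binom{k_i+\ell_i-1}{\ell_i}\cdot\zeta(k_1+\ell_1,\ldots,k_{n-1}+\ell_{n-1}).$$ Here values $\zeta(\cdot)$ at non-admissible indices on the right-hand side are understood as the constant terms of the regularizations either with respect to the series expressions or with respect to the iterated integral expressions (no index of the form $(1,\ldots,1)$ appears on the right-hand side, and the two kinds of constant terms are congruent modulo $Z_{k,+}$).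
   Context: An index is a finite (possibly empty) tuple $\mathbf{k}=(k_1,\ldots,k_n)$ of positive integers; $n$ is its depth and $|\mathbf{k}|=k_1+\cdots+k_n$ its weight. An index is admissible if it is empty or $k_n\ge 2$. For an admissible index, $\zeta(\mathbf{k})=\sum_{0<m_1<\cdots<m_n}\frac{1}{m_1^{k_1}\cdots m_n^{k_n}}$, with $\zeta(\emptyset)=1$. $Z_k\subset\mathbb{R}$ is the $\mathbb{Q}$-span of the $\zeta(\mathbf{k})$ with $\mathbf{k}$ admissible of weight $k$; $Z_{k,+}=\sum_{k',k''\ge1,\ k'+k''=k}Z_{k'}\cdot Z_{k''}$ is the $\mathbb{Q}$-span of products; for an integer $m$, $Z_{k,\le m}$ is the $\mathbb{Q}$-span of the $\zeta(\mathbf{k})$ with $\mathbf{k}$ admissible of weight $k$ and depth at most $m$ (zero if $m<0$). Empty sums are $0$ (for $n=1$ both sums in (2) are empty). Regularizations. For any index $\mathbf{k}=(k_1,\ldots,k_n)$ there are unique polynomials $P^*_{\mathbf{k}},P^{\mathrm{sh}}_{\mathbf{k}}\in\mathbb{R}[T]$ with $\sum_{0<m_1<\cdots<m_n<M}\frac1{m_1^{k_1}\cdots m_n^{k_n}}=P^*_{\mathbf{k}}(\log M+\gamma)+o(1)$ as $M\to\infty$ ($\gamma$ is Euler's constant) and $\sum_{0<m_1<\cdots<m_n}\frac{z^{m_n}}{m_1^{k_1}\cdots m_n^{k_n}}=P^{\mathrm{sh}}_{\mathbf{k}}(-\log(1-z))+o(1)$ as $z\to1^-$. The constant term of the regularization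 with respect to the series expression (resp. the iterated integral expression) is $P^*_{\mathbf{k}}(0)$ (resp. $P^{\mathrm{sh}}_{\mathbf{k}}(0)$); both equal $\zeta(\mathbf{k})$ if $\mathbf{k}$ is admissible. Definition of $\zeta^{\natural,\mathcal F}$. Let $\Delta_n=\{(t_1,\ldots,t_n)\in(\mathbb{R}^\times)^n : \frac1{t_1}>\cdots>\frac1{t_n}\}$, an open subset of $\mathbb{R}^n$. For $\mathbf{x}\in\mathbb{R}^n$ let $w(\mathbf{x})=\lim_{\varepsilon\to0}\frac{\mathrm{vol}(B(\mathbf{x},\varepsilon)\cap\Delta_n)}{\mathrm{vol}(B(\mathbf{x},\varepsilon))}$, where $B(\mathbf{x},\varepsilon)$ is the open ball of radius $\varepsilon$ centered at $\mathbf{x}$. For any index $\mathbf{k}=(k_1,\ldots,k_n)$, $$\zeta^{\natural,\mathcal F}(\mathbf{k})=\lim_{M\to\infty}\sum_{\substack{m_1,\ldots,m_n\in\mathbb{Z}\\0<|m_1|,\ldots,|m_n|<M}}\frac{w((m_1,\ldots,m_n))}{m_1^{k_1}\cdots m_n^{k_n}},$$ a limit which exists in $\mathbb{R}$. *)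

(* Defs.v *)
From HB Require Import structures.
From mathcomp Require Import all_boot all_order all_algebra.
From mathcomp Require Import all_classical all_reals all_analysis.
Import Order.TTheory GRing.Theory Num.Theory numFieldNormedType.Exports.

Set Implicit Arguments.
Unset Strict Implicit.
Unset Printing Implicit Defensive.

Local Open Scope classical_set_scope.
Local Open Scope ring_scope.

(** The index (k_1, ..., k_n) is the sequence [:: k_1; ...; k_n],
    so k_i is [nth 0 k (i - 1)] and the depth is [size k]. *)

Definition is_index (k : seq nat) : bool := all (fun a => 0 < a)%N k.

Definition weight (k : seq nat) : nat := sumn k.

Definition depth (k : seq nat) : nat := size k.

Definition admissible (k : seq nat) : bool :=
  is_index k && ((k == [::]) || (2 <= last 0 k)%N).

Definition increasing_pos (n M : nat) (m : n.-tuple 'I_M) : bool :=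
  path ltn 0%N (map val m).

Definition zeta_trunc (R : realType) (k : seq nat) (M : nat) : R :=
  \sum_(m : (size k).-tuple 'I_M | increasing_pos m)
    (\prod_(i < size k) (tnth m i)%:R ^+ nth 0%N k i)^-1.

Definition zeta (R : realType) (k : seq nat) : R :=
  limn (zeta_trunc R k).

Definition euler_gamma (R : realType) : R :=
  limn (fun N : nat => series (@harmonic R) N - ln N%:R).

(** For the empty index the exponent m_n of [z] is read as 0. *)
Definition polylog_trunc (R : realType) (k : seq nat) (z : R) (M : nat) : R :=
  \sum_(m : (size k).-tuple 'I_M | increasing_pos m)
    z ^+ last 0%N (map val m) /
    (\prod_(i < size k) (tnth m i)%:R ^+ nth 0%N k i).

Definition polylog (R : realType) (k : seq nat) (z : R) : R :=
  limn (polylog_trunc k z).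

Variant regularization := SeriesReg | IntegralReg.

Definition is_reg_poly (R : realType) (c : regularization) (k : seq nat)
    (P : {poly R}) : Prop :=
  match c with
  | SeriesReg =>
      (fun M : nat => zeta_trunc R k M - P.[ln M%:R + euler_gamma R]) @ \oo
        --> (0 : R)
  | IntegralReg =>
      polylog k z - P.[- ln (1 - z)] @[z --> (1 : R)^'-] --> (0 : R)
  end.

(** The polynomial satisfying [is_reg_poly] exists and is unique; [0] is only the
    default value of the choice operator. *)
Definition reg_poly (R : realType) (c : regularization) (k : seq nat) :
    {poly R} :=
  xget 0 [set P | is_reg_poly c k P].

Definition reg_const (R : realType) (c : regularization) (k : seq nat) : R :=
  (reg_poly R c k).[0].

Definition zeta_reg (R : realType) (c : regularization) (k : seq nat) : R :=
  if admissible k then zeta R k else reg_const R c k.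

Definition qspan (R : realType) (S : set R) : set R :=
  [set x | exists (d : nat) (q : 'I_d -> rat) (s : 'I_d -> R),
     (forall i, S (s i)) /\ x = \sum_(i < d) ratr (q i) * s i].

Definition Zspan (R : realType) (w : nat) : set R :=
  qspan (zeta R @` [set a | admissible a /\ weight a = w]).
Arguments Zspan R w _ : clear implicits.

Definition Zspan_depth_le (R : realType) (w : nat) (m : int) : set R :=
  qspan (zeta R @`
    [set a | [/\ admissible a, weight a = w & (depth a)%:Z <= m]]).
Arguments Zspan_depth_le R w m _ : clear implicits.

Definition Zspan_prod (R : realType) (w : nat) : set R :=
  qspan [set x | exists w1 w2 : nat,
    [/\ (1 <= w1)%N, (1 <= w2)%N, (w1 + w2)%N = w &
        exists2 y, Zspan R w1 y & exists2 z, Zspan R w2 z & x = y * z]].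
Arguments Zspan_prod R w _ : clear implicits.

(** Lebesgue measure on R^n, for Borel sets: the iterated product of
    one-dimensional Lebesgue measures, where [A] has measure the integral over
    [x] of the measure of its section at first coordinate [x] (as in the binary
    product of measures). *)
Fixpoint volume (R : realType) (n : nat) : set (n.-tuple R) -> \bar R :=
  match n with
  | 0 => fun A => \d_([tuple]) A
  | n'.+1 => fun A =>
      (\int[lebesgue_measure]_x
         volume [set y : n'.-tuple R | A (cons_tuple (x : R) y)])%E
  end.

Definition Delta (R : realType) (n : nat) : set (n.-tuple R) :=
  [set t | all (fun x => x != 0) t /\ sorted >%R [seq x^-1 | x <- t]].

(** Euclidean ball; the library's [ball] is that of the sup norm. *)
Definition eball (R : realType) (n : nat) (x : n.-tuple R) (e : R) :
    set (n.-tuple R) :=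
  [set y | Num.sqrt (\sum_(i < n) (tnth y i - tnth x i) ^+ 2) < e].

Definition local_density (R : realType) (n : nat) (x : n.-tuple R) : R :=
  lim (fine (volume (eball x e `&` @Delta R n)) / fine (volume (eball x e))
         @[e --> (0 : R)^'+]).

Definition zeta_natF_trunc (R : realType) (k : seq nat) (M : nat) : R :=
  \sum_(m \in [set m : (size k).-tuple int |
                 forall i, 0 < `|tnth m i| < M%:Z])
    local_density (map_tuple (fun j : int => j%:~R : R) m) /
    (\prod_(i < size k) (tnth m i)%:~R ^+ nth 0%N k i).

Definition zeta_natF (R : realType) (k : seq nat) : R :=
  limn (zeta_natF_trunc R k).

(** The bound l_i <= [a] built into the type follows from the sum being [a]. *)
Definition is_composition (a n : nat) (l : n.-tuple 'I_a.+1) : bool :=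
  (\sum_(i < n) tnth l i)%N == a.

Definition shift_index (h : seq nat) (a : nat) (l : (size h).-tuple 'I_a.+1) :
    seq nat :=
  [seq (nth 0 h i + tnth l i)%N | i : 'I_(size h) <- enum 'I_(size h)].

Definition shifted_sum (R : realType) (c : regularization) (h : seq nat)
    (a : nat) : R :=
  \sum_(l : (size h).-tuple 'I_a.+1 | is_composition l)
    (\prod_(i < size h) 'C(nth 0 h i + tnth l i - 1, tnth l i))%N%:R *
    zeta_reg R c (shift_index l).

Definition drop_first (k : seq nat) : seq nat := behead k.
Definition drop_last (k : seq nat) : seq nat := take (size k).-1 k.

Definition rhs (R : realType) (c : regularization) (k : seq nat) : R :=
  - (-1) ^+ head 0%N k * shifted_sum R c (drop_first k) (head 0%N k)
  + (-1) ^+ last 0%N k * shifted_sum R c (drop_last k) (last 0%N k).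

Definition shifted_index (h : seq nat) (a : nat) (b : seq nat) : Prop :=
  exists2 l : (size h).-tuple 'I_a.+1, is_composition l & b = shift_index l.

Definition rhs_index (k b : seq nat) : Prop :=
  shifted_index (drop_first k) (head 0%N k) b \/
  shifted_index (drop_last k) (last 0%N k) b.

(* Main.v *)
Require Import Defs.
From HB Require Import structures.
From mathcomp Require Import fingroup perm.
From mathcomp Require Import all_boot all_order all_algebra.
From mathcomp Require Import all_classical all_reals all_analysis.
From mathcomp Require Import measurable_realfun.
From mathcomp Require Import zify ring lra.
Import Order.TTheory GRing.Theory Num.Theory numFieldNormedType.Exports.
Set Implicit Arguments.
Unset Strict Implicit.
Unset Printing Implicit Defensive.
Local Open Scope classical_set_scope.
Local Open Scope ring_scope.

(** For a nonzero integer m let E_m(w) = (t / (t + m))^(k_1 + ... + k_n) / n! for the word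
    w = (k_1, ..., k_n), and multiply functions on words by deconcatenation.  Volumes are invariant
    under permutations of the coordinates, so the local density of Delta_n at an integer point is
    the inverse of the order of its stabilizer if the point is sorted for 1, 2, ..., -2, -1, and 0
    otherwise.  Hence the truncated sum is the coefficient of t^k in the ordered product of the E_m.
    The half product over 0 < m < M, multiplied by exp(- H_M t e_1), converges to a word series S,
    and the two exponential factors cancel: zeta^natF(w) = [t^k] (S S^-)(w), where S^- comes from S
    by reversing words and changing the sign of t.  Mod products this is s(w) + s^-(w), where the
    antipode S^-1(w) = (-1)^n S(rev w) relates s(rev w) to s(w); this gives (1).

    The product of the E_(m-z) over all m is a multitangent function of z; comparing its Taylor
    coefficient at z = 0 with its partial fraction expansion shows that the coefficient of t^k in
    S^- E_0 S is in Z_(k,+) if w is not (1, ..., 1).  (Applied to w = (1, k - 1), this is Euler's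
    theorem on zeta(k), k even.)  Expanding this product according to the number of letters
    taken by E_0 leaves zeta^natF(w), then [t^k] S(k_2, ..., k_n) and [t^k] S^-(k_1, ..., k_(n-1)),
    then terms of depth at most n - 2; and the expansion of t / (t + m) in powers of 1 / m turns the
    middle terms into the sums of (2).

    Truncated sums are polynomials in H_M up to o(1).  Written in the basis of the polynomials of
    the words (1, ..., 1), such a polynomial yields the one of the iterated integral regularization
    by Abel summation, because Li_(1, ..., 1)(z) = (- log (1 - z))^j / j!; this compares the two
    constant terms. *)

(** * Volumes and the local density *)

Section Volume.
Context {R : realType}.

(** The variable t is needed because (2) reads S at t^k on words whose weight is smaller than k. The
    multitangent function itself never occurs: it is replaced by finite windows |m| < M and by the
    germs of the truncated product at the integers p, for which the comparison of Taylor and partial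
    fraction expansions is an exact finite identity. The obstacle is the limit in M. The germ at p
    carries the factors exp(- H_(M+p) t e_1) on the left and exp(H_(M-p) t e_1) on the right, which
    do not converge, and its residue is summed against 1/p only. So the residue, the coefficient of
    t^(k-1), is first shown to tend to 0: the residues at the 2M - 1 integers of the window add up
    to 0 and are all close to one constant. A pole of order s >= 2 then contributes (1 + (-1)^s)
    zeta(s) times a lower coefficient of the same S^- E_0 S, which is a product unless s = k. All
    errors are measured by N^(-1/2) up to powers of log N, a crude rate in which these powers are
    harmless. *)

Definition box n (A : 'I_n -> set R) : set (n.-tuple R) :=
  [set y | forall i, A i (tnth y i)].

Lemma measurable_box n (A : 'I_n -> set R) :
  (forall i, measurable (A i)) -> measurable (box A).
Proof.
move=> mA; rewrite (_ : box A = \bigcap_(i in [set: 'I_n]) ((@tnth n R ^~ i) @^-1` A i)).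
  apply: fin_bigcap_measurable => // i _.
  by rewrite -[X in measurable X]setTI; exact: measurable_tnth.
by apply/seteqP; split=> y /= h i => [_|]; exact: h.
Qed.

(** The uniqueness theorem for measures asks for a generating family closed under intersection. The
    sigma-algebra on tuples is generated by preimages under single coordinates, and each of these is
    a box. *)
Lemma measurable_tuple_box n :
  @measurable _ (n.-tuple R) = <<s [set box A | A in [set A : 'I_n -> set R | forall i, measurable (A i)]] >>.
Proof.
apply/seteqP; split; last first.
  apply: smallest_sub; first exact: sigma_algebra_measurable.
  by move=> _ [A mA <-]; exact: measurable_box.
apply: smallest_sub; first exact: smallest_sigma_algebra.
move=> X.
rewrite -bigcup_seq => -[i _] [B mB <-]; rewrite setTI; apply: sub_sigma_algebra.
exists (fun j => if j == i then B else setT) => [j|]; first by case: ifP.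
apply/seteqP; split => y /= => [/(_ i)|h j]; first by rewrite eqxx.
by case: eqP => // ->.
Qed.

Lemma measurable_cons_tuple n :
  measurable_fun [set: R * n.-tuple R] (fun p => cons_tuple p.1 p.2).
Proof. exact: (measurable_cons measurable_fst measurable_snd). Qed.

Lemma box_cover n : \bigcup_k (@box n (fun=> `[- k%:R, k%:R]%classic)) = setT.
Proof.
apply/seteqP; split=> // y _.
have [k hk] : exists k, forall i, `|tnth y i| <= k%:R.
  exists (\max_(i < n) Num.bound `|tnth y i|)%N => i.
  apply: (le_trans (ltW (archi_boundP (normr_ge0 _)))).
  by rewrite ler_nat; exact: (leq_bigmax_cond (F := fun i => Num.bound `|tnth y i|)).
by exists k => // i /=; rewrite in_itv /= -ler_norml; exact: hk.
Qed.

Lemma box_sigma_finite n (mu : {measure set (n.-tuple R) -> \bar R}) :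
  (forall A, (forall i, measurable (A i)) ->
     mu (box A) = (\prod_(i < n) lebesgue_measure (A i))%E) ->
  sigma_finite setT mu.
Proof.
move=> muE; exists (fun k => @box n (fun=> `[- k%:R, k%:R]%classic)).
  by rewrite box_cover.
move=> k; split; first by apply: measurable_box => i.
rewrite muE// ltey_eq prode_fin_num// => i _.
by rewrite lebesgue_measure_itv /=; case: ifP.
Qed.

(** [volume] is only an iterated integral; additivity and monotonicity come from recognizing it as a
    product measure on measurable sets. Sigma-finiteness is carried through the induction because
    the product construction needs it, and the values on boxes are what makes the measure unique and
    visibly symmetric. *)
Lemma volume_measure n : exists mu : {sigma_finite_measure set (n.-tuple R) -> \bar R},
  (forall A, measurable A -> volume A = mu A) /\
  (forall A, (forall i, measurable (A i)) ->
     mu (box A) = (\prod_(i < n) lebesgue_measure (A i))%E).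
Proof.
elim: n => [|n [mu [volE boxE]]].
  exists (dirac [tuple] : {sigma_finite_measure set (0.-tuple R) -> \bar R}); split=> // A mA.
  rewrite big_ord0 /= diracE mem_set//.
  by case.
pose f := fun p : R * n.-tuple R => cons_tuple p.1 p.2.
have mf : measurable_fun [set: _] f := @measurable_cons_tuple n.
pose nu : {measure set (n.+1.-tuple R) -> \bar R} :=
  measure_function_pushforward__canonical__measure_function_Measure
    (lebesgue_measure \x mu)%E mf.
have nuE A : (forall i, measurable (A i)) ->
     nu (box A) = (\prod_(i < n.+1) lebesgue_measure (A i))%E.
  move=> mA; rewrite /nu /= /pushforward.
  rewrite (_ : _ @^-1` _ = A ord0 `*` box (A \o lift ord0)).
    have mbox : measurable (box (A \o lift ord0)).
      by apply: measurable_box => i; exact: mA.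
    by rewrite product_measure1E//; [rewrite boxE ?big_ord_recl // => i|]; exact: mA.
  apply/seteqP; split=> -[x y] /=.
    move=> h; split; first exact: (h ord0).
    by move=> i; have := h (lift ord0 i); rewrite tnthS.
  case=> h0 h i; case: (unliftP ord0 i) => [j|] ->; first by rewrite tnthS; exact: h.
  by rewrite tnth0.
have sf := box_sigma_finite nuE.
pose b := @Measure_isSigmaFinite.Build _ _ _ nu sf.
pose nu' : {sigma_finite_measure set (n.+1.-tuple R) -> \bar R} := HB.pack (Measure.sort nu) b.
exists nu'; split=> // A mA.
rewrite [RHS]/= /pushforward /= /product_measure1.
apply: eq_integral => x _ /=.
rewrite (volE [set y | A (cons_tuple x y)]); last first.
  rewrite -[X in measurable X]setTI.
  by apply: (measurable_cons (f := cst x)).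
by congr (mu _); apply/seteqP; split=> y /=; rewrite /xsection /= inE.
Qed.
End Volume.

Section Density.
Context {R : realType}.

Definition permt T n (s : 'S_n) (y : n.-tuple T) : n.-tuple T :=
  [tuple tnth y (s i) | i < n].

Lemma measurable_permt n (s : 'S_n) : measurable_fun [set: n.-tuple R] (permt s).
Proof.
apply/measurable_fun_tnthP => i.
rewrite (_ : _ \o _ = (@tnth n R ^~ (s i))); first exact: measurable_tnth.
by apply/funext => y /=; rewrite tnth_mktuple.
Qed.

Lemma permt_preimage_box n (s : 'S_n) (A : 'I_n -> set R) :
  permt s @^-1` box A = box (A \o (s^-1)%g).
Proof.
apply/seteqP; split=> y /= h i.
  by have := h ((s^-1)%g i); rewrite tnth_mktuple permKV.
by rewrite tnth_mktuple; have := h (s i); rewrite /= permK.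
Qed.

(** The definition of [volume] integrates the coordinates in a fixed order. The image measure under
    a permutation agrees with the original one on boxes, because a product of lengths is
    commutative, hence on all measurable sets. *)
Lemma volume_permt n (s : 'S_n) (A : set (n.-tuple R)) : measurable A ->
  volume (permt s @^-1` A) = volume A.
Proof.
move=> mA; have [mu [volE boxE]] := @volume_measure R n.
have mp := @measurable_permt n s.
rewrite (volE A)// volE; last by rewrite -[X in measurable X]setTI; exact: mp.
pose nu : {measure set (n.-tuple R) -> \bar R} :=
  measure_function_pushforward__canonical__measure_function_Measure mu mp.
rewrite -[LHS]/(nu A).
apply: (measure_unique [set box A | A in [set A : 'I_n -> set R | forall i, measurable (A i)]]
  (fun k => @box R n (fun=> `[- k%:R, k%:R]%classic))) => //.
- exact: measurable_tuple_box.
- move=> _ _ [B mB <-] [C mC <-]; exists (fun i => B i `&` C i).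
    by move=> i; apply: measurableI; [exact: mB|exact: mC].
  apply/seteqP; split=> y /=.
    by move=> h; split=> i; have [] := h i.
  by move=> [h h'] i; split; [exact: h|exact: h'].
- by move=> k; exists (fun=> `[- k%:R, k%:R]%classic).
- exact: box_cover.
- move=> _ [B mB <-]; rewrite /nu /= /pushforward permt_preimage_box !boxE//; last first.
    by move=> i; exact: mB.
  by rewrite [RHS](reindex_inj (@perm_inj _ (s^-1)%g)).
- move=> k; rewrite /nu /= /pushforward permt_preimage_box boxE; last by move=> i; exact: measurable_itv.
  rewrite ltey_eq prode_fin_num// => i _.
  by rewrite /= lebesgue_measure_itv /=; case: ifP.
Qed.

(** If the smaller index is the first coordinate, the section at x is a box with one side reduced to
    {x}; otherwise the condition passes to the sections and the induction applies. *)
Lemma volume_diag n (i j : 'I_n) : i != j ->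
  volume [set y : n.-tuple R | tnth y i = tnth y j] = 0%E.
Proof.
wlog ij : i j / (i < j)%N.
  move=> h ne; have := ne; rewrite neq_ltn => /orP[lt|lt]; first exact: h.
  rewrite -(h _ _ lt); last by rewrite eq_sym.
  by congr volume; apply/seteqP; split=> y /=; exact: esym.
move=> _; elim: n => [|n IH] in i j ij *; first by case: i ij.
rewrite /=; apply: integral0_eq => x _.
case: (unliftP ord0 j) ij => [j'|] -> // ij.
case: (unliftP ord0 i) ij => [i'|] -> ij.
  rewrite -[RHS](IH i' j'); last first.
    by move: ij; rewrite /= /bump.
  by congr volume; apply/seteqP; split=> y /=; rewrite !tnthS.
have [mu [volE boxE]] := @volume_measure R n.
pose A k : set R := if k == j' then [set x] else setT.
have mA k : measurable (A k) by rewrite /A; case: ifP.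
rewrite (_ : [set y | _] = box A).
  rewrite volE; last exact: measurable_box.
  rewrite boxE// (bigD1 j')//= {1}/A eqxx lebesgue_measure_set1.
  by rewrite mul0e.
apply/seteqP; split=> y /=; rewrite tnthS tnth0.
  by move=> e k; rewrite /A; case: eqP => // ->; rewrite -e.
by move=> /(_ j'); rewrite /A eqxx => ->.
Qed.

End Density.

Section Ball.
Context {R : realType}.

Lemma measurable_lt_set d (T : measurableType d) (f g : T -> R) :
  measurable_fun setT f -> measurable_fun setT g ->
  measurable [set y | f y < g y].
Proof.
move=> mf mg; have := measurable_fun_ltr mf mg => /(_ measurableT [set true]).
by rewrite setTI; apply.
Qed.

Lemma eballE n (x : n.-tuple R) (e : R) : 0 < e ->
  eball x e = [set y | \sum_(i < n) (tnth y i - tnth x i) ^+ 2 < e ^+ 2].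
Proof.
move=> e0; have E : Num.sqrt (e ^+ 2) = e by rewrite sqrtr_sqr gtr0_norm.
by apply/funext => y; rewrite /eball /= -[in LHS]E ltr_sqrt// exprn_gt0.
Qed.

Lemma measurable_eball n (x : n.-tuple R) (e : R) : 0 < e ->
  measurable (eball x e).
Proof.
move=> e0; rewrite eballE//; apply: measurable_lt_set => //.
apply: measurable_sum => i; apply: measurable_funX; apply: measurable_funB => //.
exact: measurable_tnth.
Qed.

Lemma eball_coord n (x y : n.-tuple R) (e : R) (i : 'I_n) : 0 < e ->
  eball x e y -> `|tnth y i - tnth x i| < e.
Proof.
move=> e0; rewrite eballE//= (bigD1 i)//= => h.
rewrite -(ltr_pXn2r (n := 2))// ?nnegrE ?(ltW e0)//.
rewrite real_normK ?num_real//; apply: le_lt_trans h.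
by rewrite lerDl; apply: sumr_ge0 => j _; exact: sqr_ge0.
Qed.

Lemma permt_eball n (s : 'S_n) (x y : n.-tuple R) (e : R) : 0 < e ->
  eball (permt s x) e (permt s y) <-> eball x e y.
Proof.
move=> e0; rewrite !eballE//=.
rewrite [in X in _ <-> X](reindex_inj (@perm_inj _ s))/=.
by under eq_bigr do rewrite !tnth_mktuple.
Qed.

Lemma volume_eball n (x : n.-tuple R) (e : R) : 0 < e ->
  (0 < volume (eball x e) < +oo)%E.
Proof.
move=> e0; have [mu [volE boxE]] := @volume_measure R n.
rewrite volE; last exact: measurable_eball.
(* The cube of half-side [d] lies in the ball because n < (n + 1)^2; the cube of half-side [e]
   contains it. *)
pose d := e / n.+1%:R.
have d0 : 0 < d by rewrite divr_gt0.
apply/andP; split.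
  apply: (@lt_le_trans _ _ (mu (box (fun i => `]tnth x i - d, tnth x i + d[%classic)))).
    rewrite boxE; last by move=> i; exact: measurable_itv.
    rewrite big_seq; apply: (big_ind (fun z : \bar R => (0 < z)%E)) => //.
    - by move=> a b a0 b0; rewrite mule_gt0.
    - move=> i _; rewrite /= lebesgue_measure_itv /= lte_fin ifT; last by lra.
      by rewrite -EFinD lte_fin; lra.
  apply: le_measure; rewrite ?inE.
  - by apply: measurable_box => i; exact: measurable_itv.
  - exact: measurable_eball.
  - move=> y /= h; rewrite eballE//=.
    apply: (@le_lt_trans _ _ (\sum_(i < n) d ^+ 2)).
      apply: ler_sum => i _.
      have := h i; rewrite /= in_itv /= => hi.
      rewrite -real_normK ?num_real//; rewrite lerXn2r ?nnegrE ?(ltW d0)//.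
      by rewrite ler_norml; lra.
    rewrite sumr_const card_ord /d expr_div_n -[_ *+ n]mulr_natl mulrA.
    rewrite ltr_pdivrMr ?exprn_gt0// mulrC ltr_pM2l ?exprn_gt0//.
    by rewrite -natrX ltr_nat expnS expn1 mulSn ltn_addr// .
apply: (@le_lt_trans _ _ (mu (box (fun i => `[tnth x i - e, tnth x i + e]%classic)))).
  apply: le_measure; rewrite ?inE.
  - exact: measurable_eball.
  - by apply: measurable_box => i; exact: measurable_itv.
  - move=> y hy i; have := eball_coord i e0 hy.
    by rewrite /= in_itv /= ltr_norml; lra.
rewrite boxE; last by move=> i; exact: measurable_itv.
rewrite ltey_eq prode_fin_num// => i _.
by rewrite /= lebesgue_measure_itv /=; case: ifP.
Qed.

End Ball.

(** * The set [Delta] near an integer point *)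

Section Density.
Context {R : realType}.

(* The order of the nonzero integers on the projective line,
   [1, 2, 3, ..., -3, -2, -1]. *)
Definition cycle_le (a b : int) : bool := (b%:~R^-1 <= a%:~R^-1 :> R).

Lemma cycle_le_trans : transitive cycle_le.
Proof. by move=> b a c ab bc; exact: le_trans bc ab. Qed.

Lemma cycle_le_anti : antisymmetric cycle_le.
Proof.
by move=> a b /andP[ab ba]; apply/(@intr_inj R)/invr_inj/le_anti; rewrite -/(cycle_le b a) ba.
Qed.

(** The radius 1/2 keeps a neighbourhood of a nonzero integer away from 0 and neighbourhoods of
    distinct integers disjoint; this is the bound on [e] in all that follows. *)
Lemma near_int_gt0 (a : int) (y : R) : a != 0 -> `|y - a%:~R| < 1 / 2 ->
  (0 < y) = (0 < a) /\ (y < 0) = (a < 0).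
Proof.
rewrite neq_lt ltr_norml => /orP[a0|a0] h.
  have a1 : (a%:~R : R) <= -1 by rewrite -[-1]/((-1)%:~R) ler_int; lia.
  have y0 : y < 0 by lra.
  by rewrite y0 a0 (lt_gtF y0) (lt_gtF a0).
have a1 : 1 <= (a%:~R : R) by rewrite -[1]/(1%:~R) ler_int.
have y0 : 0 < y by lra.
by rewrite y0 a0 (lt_gtF y0) (lt_gtF a0).
Qed.

Lemma near_int_lt (a b : int) (y z : R) :
  `|y - a%:~R| < 1 / 2 -> `|z - b%:~R| < 1 / 2 -> a < b -> y < z.
Proof.
rewrite !ltr_norml => h h' ab.
have : (a%:~R : R) + 1 <= b%:~R by rewrite -[1]/(1%:~R) -intrD ler_int; lia.
by lra.
Qed.

Lemma near_cycle_eq (a : int) (y z : R) : a != 0 ->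
  `|y - a%:~R| < 1 / 2 -> `|z - a%:~R| < 1 / 2 -> (z^-1 < y^-1) = (y < z).
Proof.
move=> a0 hy hz; have [py ny] := near_int_gt0 a0 hy; have [pz nz] := near_int_gt0 a0 hz.
move: a0; rewrite neq_lt => /orP[a0|a0].
  by rewrite ltf_nV2// negrE ?ny ?nz.
by rewrite ltf_pV2// posrE ?py ?pz.
Qed.

(** Inversion preserves signs and is decreasing on each half-line. For equal signs the order of [y]
    and [z] decides, which is that of [a] and [b]; for opposite signs the signs decide. *)
Lemma near_cycle_neq (a b : int) (y z : R) : a != 0 -> b != 0 -> a != b ->
  `|y - a%:~R| < 1 / 2 -> `|z - b%:~R| < 1 / 2 -> (z^-1 < y^-1) = cycle_le a b.
Proof.
move=> a0 b0 ab hy hz; have [py ny] := near_int_gt0 a0 hy; have [pz nz] := near_int_gt0 b0 hz.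
have abR : (a%:~R == b%:~R :> R) = false by rewrite eqr_int; apply/negbTE.
rewrite /cycle_le le_eqVlt (inj_eq invr_inj) eq_sym abR /=.
have key : y < z = (a < b).
  apply/idP/idP; last exact: near_int_lt.
  by move=> yz; rewrite ltNge le_eqVlt (eq_sym b a) (negbTE ab) /=; apply/negP => ba;
    have := near_int_lt hz hy ba; lra.
move: (a0) (b0); rewrite neq_lt => /orP[sa|sa]; rewrite neq_lt => /orP[sb|sb].
- by rewrite !ltf_nV2 ?negrE ?ny ?nz ?ltrz0 ?ltr_int.
- transitivity false; [apply: lt_gtF|apply/esym; apply: lt_gtF].
    by apply: (@lt_trans _ _ 0); rewrite ?invr_lt0 ?invr_gt0 ?ny ?pz.
  by apply: (@lt_trans _ _ 0); rewrite ?invr_lt0 ?invr_gt0 ?ltrz0 ?ltr0z.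
- transitivity true; first by apply: (@lt_trans _ _ 0); rewrite ?invr_lt0 ?invr_gt0 ?py ?nz.
  by apply/esym; apply: (@lt_trans _ _ 0); rewrite ?invr_lt0 ?invr_gt0 ?ltrz0 ?ltr0z.
- by rewrite !ltf_pV2 ?posrE ?py ?pz ?ltr0z ?ltr_int.
Qed.

Lemma DeltaP n (y : n.-tuple R) : @Delta R n y <->
  (forall i, tnth y i != 0) /\
  (forall i j : 'I_n, (i < j)%N -> (tnth y j)^-1 < (tnth y i)^-1).
Proof.
rewrite /Delta /=; split=> [[y0 sy]|[y0 sy]]; split.
- by move=> i; have /allP := y0; apply; exact: mem_tnth.
- move=> i j ij; move: sy; rewrite sorted_pairwise; last exact: (rev_trans lt_trans).
  move=> /(pairwiseP 0)/(_ i j); rewrite !inE !size_map !size_tuple !ltn_ord => /(_ isT isT ij).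
  by rewrite !(nth_map 0) ?size_tuple// !(tnth_nth 0).
- by apply/allP => _ /tnthP[i ->].
- rewrite sorted_pairwise; last exact: (rev_trans lt_trans).
  apply/(pairwiseP 0) => i j; rewrite !inE !size_map !size_tuple => hi hj ij.
  have := sy (Ordinal hi) (Ordinal hj) ij.
  by rewrite !(nth_map 0) ?size_tuple// !(tnth_nth 0).
Qed.

Lemma sorted_cycleP n (x : n.-tuple int) : sorted cycle_le x <->
  (forall i j : 'I_n, (i < j)%N -> cycle_le (tnth x i) (tnth x j)).
Proof.
rewrite sorted_pairwise; last exact: cycle_le_trans.
split=> [/(pairwiseP 0) h i j ij|h].
  by have := h i j; rewrite !inE !size_tuple !ltn_ord !(tnth_nth 0) => /(_ isT isT ij).
apply/(pairwiseP 0) => i j; rewrite !inE !size_tuple => hi hj ij.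
by have := h (Ordinal hi) (Ordinal hj) ij; rewrite !(tnth_nth 0).
Qed.

Section Point.
Variables (n : nat) (x : n.-tuple int) (e : R).
Hypothesis x0 : forall i, tnth x i != 0.
Hypothesis e0 : 0 < e.
Hypothesis e12 : e <= 1 / 2.

Let X : n.-tuple R := map_tuple (fun j : int => j%:~R : R) x.

Lemma ball_near (y : n.-tuple R) i : eball X e y ->
  `|tnth y i - (tnth x i)%:~R| < 1 / 2.
Proof.
move=> h; have := eball_coord i e0 h; rewrite /X tnth_map => h'.
exact: lt_le_trans h' e12.
Qed.

Lemma ball_neq0 (y : n.-tuple R) i : eball X e y -> tnth y i != 0.
Proof.
move=> /(ball_near i)/(near_int_gt0 (x0 i))[yp yn].
by move: (x0 i); rewrite !neq_lt yp yn.
Qed.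

Lemma ball_Delta_sorted (y : n.-tuple R) : eball X e y -> @Delta R n y ->
  sorted cycle_le x.
Proof.
move=> By /DeltaP[_ Dy]; apply/sorted_cycleP => i j ij.
have [->|ne] := eqVneq (tnth x i) (tnth x j); first exact: lexx.
rewrite -(near_cycle_neq (x0 i) (x0 j) ne (ball_near i By) (ball_near j By)).
exact: Dy.
Qed.

(** Distinct integer coordinates are already compared correctly by the centre, so near a sorted
    centre only its ties remain open, and there inversion just reverses the order. This finite
    system of inequalities also gives measurability. *)
Lemma ball_Delta : sorted cycle_le x -> eball X e `&` @Delta R n =
  eball X e `&` [set y | forall p : 'I_n * 'I_n, (p.1 < p.2)%N ->
     tnth x p.1 = tnth x p.2 -> tnth y p.1 < tnth y p.2].
Proof.
move=> sx; apply/seteqP; split=> y /= -[By] Dy; split=> //.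
  move=> -[i j]/= ij xij; move/DeltaP: Dy => [_ /(_ i j ij)].
  by rewrite (near_cycle_eq (x0 i) (ball_near i By))// xij; exact: ball_near.
apply/DeltaP; split=> [i|i j ij]; first exact: ball_neq0.
have [xij|ne] := eqVneq (tnth x i) (tnth x j).
  rewrite (near_cycle_eq (x0 i) (ball_near i By)); first exact: (Dy (i, j)).
  by rewrite xij; exact: ball_near.
rewrite (near_cycle_neq (x0 i) (x0 j) ne (ball_near i By) (ball_near j By)).
by move/sorted_cycleP : sx; exact.
Qed.

Lemma measurable_ball_Delta : sorted cycle_le x ->
  measurable (eball X e `&` @Delta R n).
Proof.
move=> sx; rewrite ball_Delta//; apply: measurableI; first exact: measurable_eball.
pose P := [set p : 'I_n * 'I_n | (p.1 < p.2)%N /\ tnth x p.1 = tnth x p.2].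
rewrite (_ : [set y | _] =
    \bigcap_(p in P) [set y : n.-tuple R | tnth y p.1 < tnth y p.2]).
  apply: fin_bigcap_measurable; first exact: finite_finset.
  by move=> p _; apply: measurable_lt_set; exact: measurable_tnth.
by apply/seteqP; split=> y /= h p; [case=> p1 p2; exact: h|move=> p1 p2; exact: h].
Qed.

End Point.
End Density.

(** * The ball as a union of translates of its part in [Delta] *)

Section Stab.
Context {R : realType}.

Definition stab n (x : n.-tuple int) : {set 'S_n} := [set s | permt s x == x].

(** The inverses of the entries can be put in strictly decreasing order in only one way. Together
    with [sort_Delta], this makes [Delta] a fundamental domain for the permutations of tuples with
    distinct nonzero entries. *)
Lemma permt_Delta_inj n (y : n.-tuple R) (s s' : 'S_n) :
  @Delta R n (permt s y) -> @Delta R n (permt s' y) -> s = s'.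
Proof.
move=> D D'.
have inj : {in y &, injective (fun z : R => z)} by [].
have e : permt s y = permt s' y :> seq R.
  have [_ sD] := D; have [_ sD'] := D'.
  apply: (inj_map (@invr_inj R)); apply: irr_sorted_eq sD sD' _.
  - exact: (rev_trans lt_trans).
  - by move=> z; exact: ltxx.
  - apply: perm_mem; apply: perm_map.
    have py (t : 'S_n) : perm_eq (permt t y) y by apply/tuple_permP; exists t.
    by rewrite (perm_trans (py s))// perm_sym.
have yinj i j : tnth (permt s y) i = tnth (permt s y) j -> i = j.
  move/DeltaP : D => [_ D] yij.
  by case: (ltngtP i j) => [/D|/D|/val_inj//]; rewrite yij ltxx.
apply/perm.permP => i.
have : tnth (permt s y) i = tnth (permt s' y) i by congr tnth; exact: val_inj.
rewrite !tnth_mktuple => h.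
have := yinj i ((s^-1)%g (s' i)); rewrite !tnth_mktuple permKV => /(_ h).
by move=> si; rewrite [in LHS]si permKV.
Qed.

Lemma sort_Delta n (y : n.-tuple R) : (forall i, tnth y i != 0) ->
  (forall i j : 'I_n, i != j -> tnth y i != tnth y j) ->
  exists s, @Delta R n (permt s y).
Proof.
move=> y0 yinj.
pose r (a b : R) := b^-1 <= a^-1.
have : perm_eq (sort r y) y by rewrite perm_sort.
move=> /tuple_permP[s sE]; exists s; apply/DeltaP; split.
  by move=> i; rewrite tnth_mktuple.
move=> i j ij; rewrite lt_neqAle; apply/andP; split.
  by rewrite (inj_eq invr_inj) !tnth_mktuple yinj// (inj_eq perm_inj) neq_ltn ij orbT.
have : sorted r (permt s y).
  by rewrite -[X in sorted r X]sE; apply: sort_sorted => a b; exact: le_total.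
rewrite sorted_pairwise; last by move=> b a c ab bc; exact: le_trans bc ab.
move=> /(pairwiseP 0)/(_ i j); rewrite !inE !size_tuple !ltn_ord => /(_ isT isT ij).
by rewrite !(tnth_nth 0).
Qed.

(** Off the diagonals, a point of the ball is moved into [Delta] by a single permutation. The
    permuted centre is then sorted too, hence equal to the sorted centre [x], so this permutation
    lies in the stabilizer. Up to a null set the ball is thus the disjoint union of the preimages of
    [A] under the stabilizer, all of the same volume. *)
Lemma eball_stab_Delta n (x : n.-tuple int) (e : R) :
  (forall i, tnth x i != 0) -> 0 < e -> e <= 1 / 2 -> sorted (@cycle_le R) x ->
  volume (eball (map_tuple (fun j : int => j%:~R : R) x) e) =
  ((#|stab x|%:R)%:E *
   volume (eball (map_tuple (fun j : int => j%:~R : R) x) e `&` @Delta R n))%E.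
Proof.
move=> x0 e0 e12 sx.
set X := map_tuple _ x; set B := eball X e; set A := B `&` _.
have mB : measurable B := measurable_eball X e0.
have mA : measurable A := measurable_ball_Delta x0 e0 e12 sx.
have permX (s : 'S_n) : permt s X = map_tuple (fun j : int => j%:~R : R) (permt s x).
  by apply: eq_from_tnth => i; rewrite !(tnth_map, tnth_mktuple).
have [mu [volE boxE]] := @volume_measure R n.
pose F (s : 'S_n) := permt s @^-1` A.
have mF s : measurable (F s).
  by rewrite -[X in measurable X]setTI; exact: measurable_permt.
pose T := \big[setU/set0]_(p : 'I_n * 'I_n | p.1 != p.2)
  [set y : n.-tuple R | tnth y p.1 = tnth y p.2].
have [mT T0] : measurable T /\ mu T = 0%E.
  apply: (big_ind (fun S => measurable S /\ mu S = 0%E)).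
  - by split; [exact: measurable0|rewrite measure0].
  - by move=> S S' [mS S0] [mS' S'0]; split; [exact: measurableU|rewrite measureU0].
  - move=> p p12.
    have md : measurable [set y : n.-tuple R | tnth y p.1 = tnth y p.2].
      rewrite (_ : [set y | _] = ~` ([set y : n.-tuple R | tnth y p.1 < tnth y p.2] `|`
        [set y : n.-tuple R | tnth y p.2 < tnth y p.1])).
        by apply: measurableC; apply: measurableU; apply: measurable_lt_set; exact: measurable_tnth.
      apply/seteqP; split=> y /=; first by move=> ->; rewrite ltxx; case.
      by case: (ltgtP (tnth y p.1) (tnth y p.2)) => // _ h; exfalso; apply: h; [left|right].
    by rewrite -volE// volume_diag.
have cover : B `|` T = (\bigcup_(s in [set` enum (stab x)]) F s) `|` T.
  apply/seteqP; split=> y [|Ty]; [|by right| |by right]; last first.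
    move=> [s]; rewrite /= mem_enum inE => /eqP sx' [By _]; left.
    by apply/(permt_eball s X y e0); rewrite permX sx'.
  move=> By; have [Ty|nT] := pselect (T y); [by right|left].
  have yinj (i j : 'I_n) : i != j -> tnth y i != tnth y j.
    move=> ij; apply/eqP => yij; apply: nT; rewrite /T -bigcup_seq_cond.
    by exists (i, j) => //=; rewrite mem_index_enum.
  have [s Ds] := sort_Delta (fun i => ball_neq0 x0 e0 e12 i By) yinj.
  have Bs : eball (permt s X) e (permt s y) by apply/permt_eball.
  have sx' : permt s x = x.
    move: Bs; rewrite permX => Bs.
    have x0s i : tnth (permt s x) i != 0 by rewrite tnth_mktuple.
    have sxs := ball_Delta_sorted x0s e0 e12 Bs Ds.
    apply/val_inj/(sorted_eq (@cycle_le_trans R) (@cycle_le_anti R) sxs sx).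
    by apply/tuple_permP; exists s.
  exists s => /=; first by rewrite mem_enum inE sx'.
  by split=> //; move: Bs; rewrite permX sx'.
rewrite (volE B)// (volE A)//.
have mU : measurable (\bigcup_(s in [set` enum (stab x)]) F s).
  by apply: fin_bigcup_measurable => //; exact: finite_seq.
rewrite -(measureU0 (mu := mu) mB mT T0) cover measureU0// measure_fin_bigcup//; last first.
  move=> s s' _ _ [y [[_ Ds] [_ Ds']]]; exact: permt_Delta_inj Ds Ds'.
rewrite -fsbig_seq ?enum_uniq//= big_enum/=.
rewrite (eq_bigr (fun=> mu A)); last first.
  by move=> s _; rewrite -!volE//; apply: volume_permt.
have fA : mu A \is a fin_num.
  have /andP[_ Boo] := volume_eball X e0.
  rewrite ge0_fin_numE//; apply: le_lt_trans Boo; rewrite volE//.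
  by apply: le_measure; rewrite ?inE//; exact: subIsetl.
rewrite -(fineK fA) sumEFin sumr_const -EFinM; congr (_%:E).
by rewrite mulr_natl.
Qed.

(** The quotient of volumes is constant as soon as the radius is at most 1/2, so no limit has to be
    estimated. *)
Lemma local_density_int n (x : n.-tuple int) : (forall i, tnth x i != 0) ->
  local_density (map_tuple (fun j : int => j%:~R : R) x) =
  if sorted (@cycle_le R) x then (#|stab x|%:R)^-1 else 0.
Proof.
move=> x0; rewrite /local_density; apply: cvg_lim => //.
apply: (@cvg_near_cst _ _ _ _ (0 : R)^'+).
near=> e.
have e0 : 0 < e by [].
have e12 : e <= 1 / 2 by near: e; apply: nbhs_right_le; lra.
have /andP[B0 Boo] := volume_eball (map_tuple (fun j : int => j%:~R : R) x) e0.
case: ifPn => [sx|nsx].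
  have := eball_stab_Delta x0 e0 e12 sx.
  set VB := volume _ in B0 Boo *; set VA := volume _ => VE.
  have fB : fine VB != 0 by rewrite gt_eqF// fine_gt0// B0.
  have [mu [volE boxE]] := @volume_measure R n.
  have fA : VA \is a fin_num.
    rewrite /VA volE; last exact: measurable_ball_Delta.
    rewrite ge0_fin_numE//; apply: le_lt_trans Boo; rewrite /VB volE; last exact: measurable_eball.
    apply: le_measure; rewrite ?inE; [exact: measurable_ball_Delta|exact: measurable_eball|].
    exact: subIsetl.
  move: fB; rewrite VE fineM//= => fB.
  move: fB; rewrite mulf_eq0 negb_or => /andP[g0 a0].
  by rewrite invfM mulrC mulrVK ?unitfE.
rewrite (_ : _ `&` _ = set0); last first.
  apply/seteqP; split=> // y [By Dy]; case/negP: nsx.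
  exact: ball_Delta_sorted By Dy.
have [mu [volE boxE]] := @volume_measure R n.
by rewrite volE// measure0 mul0r.
Unshelve. all: by end_near.
Qed.

End Stab.

Lemma lift_perm_surj n (s : 'S_n.+1) i : exists t, s = lift_perm i (s i) t.
Proof.
pose ulsf i (s : 'S_n.+1) k := odflt k (unlift (s i) (s (lift i k))).
have ulsfK j (u : 'S_n.+1) k : lift (u j) (ulsf j u k) = u (lift j k).
  rewrite /ulsf; have := neq_lift j k.
  by rewrite -(can_eq (permK u)) => /unlift_some[] ? ? ->.
have inj_ulsf : injective (ulsf i s).
  by move=> k k' /(congr1 (lift (s i))); rewrite !ulsfK => /perm_inj/lift_inj.
exists (perm inj_ulsf); apply/perm.permP => k.
case: (unliftP i k) => [k'|] ->; first by rewrite lift_perm_lift permE ulsfK.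
by rewrite lift_perm_id.
Qed.

(** The stabilizer is partitioned by the image of the first position, which is any position carrying
    [c]; composition with a transposition identifies each part with the stabilizer of [x]. Iterating
    yields the product of the factorials of the multiplicities. *)
Lemma card_stab_cons n (c : int) (x : n.-tuple int) :
  #|stab (cons_tuple c x)| = (count_mem c (c :: x) * #|stab x|)%N.
Proof.
set x' := cons_tuple c x.
rewrite -sum1_card (partition_big (fun s : 'S_n.+1 => s ord0)
  (fun j => tnth x' j == c))/=; last first.
  move=> s; rewrite inE => /eqP/(congr1 (fun y => tnth y ord0)).
  by rewrite tnth_mktuple tnth0 => ->.
rewrite (eq_bigr (fun=> #|stab x|)).
  rewrite sum_nat_const; congr (_ * _)%N.
  transitivity (count_mem c x'); last by [].
  by rewrite -sum1_count big_tuple sum1_card.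
move=> j /eqP xj; rewrite sum1_card.
pose f (t : 'S_n) := (lift_perm ord0 ord0 t * tperm ord0 j)%g.
have f0 t : f t ord0 = j by rewrite permM lift_perm_id tpermL.
have finj : injective f.
  move=> t t' /(can_inj (mulgK _)) tt'; apply/perm.permP => k.
  apply: (@lift_inj _ ord0); rewrite -!(lift_perm_lift ord0 ord0).
  by rewrite tt'.
have xtp i : tnth x' (tperm ord0 j i) = tnth x' i.
  by case: tpermP => [->|->|//]; rewrite xj tnth0.
rewrite -(card_imset _ finj); apply: eq_card => s.
rewrite [LHS]inE /= !inE; apply/andP/imsetP => [[/eqP sx /eqP s0]|[t]].
  have [t tE] := lift_perm_surj (s * tperm ord0 j)%g ord0.
  have s00 : (s * tperm ord0 j)%g ord0 = ord0 by rewrite permM s0 tpermR.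
  exists t; last first.
    by rewrite /f -[X in lift_perm _ X]s00 -tE -mulgA tperm2 mulg1.
  rewrite inE; apply/eqP/eq_from_tnth => k; rewrite tnth_mktuple.
  rewrite -(tnthS c) -(lift_perm_lift ord0 ord0) -[X in lift_perm _ X]s00 -tE permM xtp.
  by move/(congr1 (fun y => tnth y (lift ord0 k))) : sx; rewrite tnth_mktuple tnthS.
rewrite inE => /eqP tx ->; rewrite f0; split=> //.
apply/eqP/eq_from_tnth => k; rewrite tnth_mktuple permM xtp.
case: (unliftP ord0 k) => [k'|] ->; last by rewrite lift_perm_id.
rewrite lift_perm_lift !tnthS.
by move/(congr1 (fun y => tnth y k')) : tx; rewrite tnth_mktuple.
Qed.

(** * Power series and word series *)

Section PowerSeries.
Variable R : comNzRingType.

Record power_series := PS { coefs :> nat -> R }.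

Lemma psP (f g : power_series) : (forall n, f n = g n) -> f = g.
Proof. by case: f g => [f] [g] /= h; congr PS; apply/funext. Qed.

HB.instance Definition _ := gen_eqMixin power_series.
HB.instance Definition _ := gen_choiceMixin power_series.

Definition ps_add (f g : power_series) := PS (fun n => f n + g n).
Definition ps_opp (f : power_series) := PS (fun n => - f n).
Fact ps_mul_key : unit. Proof. by []. Qed.
Definition ps_mul (f g : power_series) :=
  locked_with ps_mul_key (PS (fun n => \sum_(i < n.+1) f i * g (n - i)%N)).
Lemma ps_mulEn (f g : power_series) n : ps_mul f g n = \sum_(i < n.+1) f i * g (n - i)%N.
Proof. by rewrite [ps_mul _ _]unlock. Qed.
Definition ps_cst (c : R) := PS (fun n => if n == 0%N then c else 0).

Lemma ps_addA : associative ps_add.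
Proof. by move=> f g h; apply: psP => n /=; rewrite addrA. Qed.
Lemma ps_addC : commutative ps_add.
Proof. by move=> f g; apply: psP => n /=; rewrite addrC. Qed.
Lemma ps_add0 : left_id (ps_cst 0) ps_add.
Proof. by move=> f; apply: psP => n /=; rewrite if_same add0r. Qed.
Lemma ps_addN : left_inverse (ps_cst 0) ps_opp ps_add.
Proof. by move=> f; apply: psP => n /=; rewrite if_same addNr. Qed.

HB.instance Definition _ := GRing.isZmodule.Build power_series ps_addA ps_addC ps_add0 ps_addN.

Let trunc n (f : power_series) : {poly R} := \poly_(i < n.+1) f i.

(** A coefficient of a product depends only on truncations of the factors, so the ring laws are
    inherited from polynomials. *)
Let ps_mulE (f g : power_series) m n : (m <= n)%N -> ps_mul f g m = (trunc n f * trunc n g)`_m.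
Proof.
move=> mn; rewrite ps_mulEn coefM; apply: eq_bigr => -[i /= im] _.
by rewrite !coef_poly !ltnS (leq_trans (leq_subr _ _) mn) (leq_trans _ mn).
Qed.

Lemma ps_mulC : commutative ps_mul.
Proof. by move=> f g; apply: psP => n; rewrite !(ps_mulE _ _ (leqnn n)) mulrC. Qed.

Lemma ps_mulA : associative ps_mul.
Proof.
move=> f g h; apply: psP => n.
transitivity (trunc n f * (trunc n g * trunc n h))`_n.
  rewrite ps_mulEn coefM; apply: eq_bigr => -[i /= im] _.
  by rewrite -ps_mulE ?leq_subr// coef_poly im.
rewrite mulrA ps_mulEn coefM; apply: eq_bigr => -[i /= im] _.
by rewrite -ps_mulE// coef_poly ltnS leq_subr.
Qed.

Lemma ps_mul1 : left_id (ps_cst 1) ps_mul.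
Proof.
move=> f; apply: psP => n; rewrite ps_mulEn big_ord_recl /= mul1r subn0.
by rewrite big1 ?addr0// => i _; rewrite mul0r.
Qed.

Lemma ps_mulDl : left_distributive ps_mul ps_add.
Proof.
move=> f g h; apply: psP => n; rewrite /= !ps_mulEn -big_split /=.
by apply: eq_bigr => i _; rewrite mulrDl.
Qed.

Lemma ps_1neq0 : ps_cst 1 != ps_cst 0.
Proof.
apply/eqP => /(congr1 (fun f : power_series => f 0%N)) /= /eqP.
by rewrite (negbTE (oner_neq0 _)).
Qed.

HB.instance Definition _ := GRing.Zmodule_isComNzRing.Build power_series
  ps_mulA ps_mulC ps_mul1 ps_mulDl ps_1neq0.

Lemma ps_coefD (f g : power_series) n : (f + g) n = f n + g n. Proof. by []. Qed.
Lemma ps_coefN (f : power_series) n : (- f) n = - f n. Proof. by []. Qed.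
Lemma ps_coefM (f g : power_series) n : (f * g) n = \sum_(i < n.+1) f i * g (n - i)%N.
Proof. exact: ps_mulEn. Qed.
Lemma ps_coef0 n : (0 : power_series) n = 0. Proof. by rewrite /= if_same. Qed.
Lemma ps_coef1 n : (1 : power_series) n = (n == 0%N)%:R.
Proof. by rewrite /=; case: eqP. Qed.
Lemma ps_coef_sum I (r : seq I) (P : pred I) (F : I -> power_series) n :
  (\sum_(i <- r | P i) F i) n = \sum_(i <- r | P i) F i n.
Proof. by apply: (big_morph (fun f : power_series => f n)) => //; rewrite ps_coef0. Qed.

Lemma ps_cst_is_monoid_morphism : monoid_morphism ps_cst.
Proof.
split=> // a b; apply: psP => n; rewrite ps_coefM big_ord_recl /= subn0.
rewrite big1 ?addr0; last by move=> i _; rewrite mul0r.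
by case: eqP; rewrite ?mulr0.
Qed.

Lemma ps_cst_is_zmod_morphism : zmod_morphism ps_cst.
Proof. by move=> a b; apply: psP => n /=; case: eqP; rewrite ?subr0. Qed.

HB.instance Definition _ := GRing.isZmodMorphism.Build R power_series ps_cst ps_cst_is_zmod_morphism.
HB.instance Definition _ := GRing.isMonoidMorphism.Build R power_series ps_cst ps_cst_is_monoid_morphism.

Lemma ps_cstM c (f : power_series) n : (ps_cst c * f) n = c * f n.
Proof.
rewrite ps_coefM big_ord_recl /= subn0 big1 ?addr0// => i _.
by rewrite mul0r.
Qed.

Definition psX : power_series := PS (fun n => if n == 1%N then 1 else 0).

Lemma psXM (f : power_series) n : (psX * f) n = if n is n'.+1 then f n' else 0.
Proof.
rewrite ps_coefM; case: n => [|n]; first by rewrite big_ord1 /= mul0r.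
rewrite !big_ord_recl /= mul0r add0r mul1r subSS subn0.
by rewrite big1 ?addr0// => i _; rewrite mul0r.
Qed.

Lemma psXnM (f : power_series) m n : (psX ^+ m * f) n = if (m <= n)%N then f (n - m)%N else 0.
Proof.
elim: m n => [|m IH] n; first by rewrite expr0 mul1r subn0.
by rewrite exprS -mulrA psXM; case: n => [|n] //; rewrite IH ltnS subSS.
Qed.

(** The substitution of x t for t. With x = 1/m it carries t / (t + 1) to t / (t + m); with x = -1
    it exchanges positive and negative integers. *)
Definition ps_dil (x : R) (f : power_series) := PS (fun n => x ^+ n * f n).

Lemma ps_dil_is_monoid_morphism x : monoid_morphism (ps_dil x).
Proof.
split=> [|f g]; apply: psP => n.
  by rewrite ps_coef1 /= -/(ps_coef1 n); case: n => [|n]; rewrite /= ?mulr0 ?mulr1.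
rewrite /= !ps_coefM mulr_sumr; apply: eq_bigr => -[i /= im] _.
by rewrite mulrACA -exprD subnKC.
Qed.

Lemma ps_dil_is_zmod_morphism x : zmod_morphism (ps_dil x).
Proof. by move=> f g; apply: psP => n /=; rewrite mulrBr. Qed.

HB.instance Definition _ x := GRing.isZmodMorphism.Build power_series power_series (ps_dil x) (@ps_dil_is_zmod_morphism x).
HB.instance Definition _ x := GRing.isMonoidMorphism.Build power_series power_series (ps_dil x) (@ps_dil_is_monoid_morphism x).

End PowerSeries.
Arguments psX {R}.

(** * Word series, their exponentials and substitutions of letters *)

Section WordSeries.
Variables (T : Type) (A : pzRingType).

(* Functions on words, multiplied by deconcatenation. *)
Record word_series := WS { wcoef :> seq T -> A }.

Lemma wsP (F G : word_series) : (forall w, F w = G w) -> F = G.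
Proof. by case: F G => [f] [g] /= h; congr WS; apply/funext. Qed.

HB.instance Definition _ := gen_eqMixin word_series.
HB.instance Definition _ := gen_choiceMixin word_series.

(** The recursion moves the first letter of [w] into the first factor, a form suited to proving
    associativity by induction; [convE] is the usual sum over the cuts of [w]. *)
Fixpoint conv (w : seq T) (F G : seq T -> A) : A :=
  F [::] * G w + if w is a :: w' then conv w' (fun v => F (a :: v)) G else 0.

Definition ws_add (F G : word_series) := WS (fun n => F n + G n).
Definition ws_opp (F : word_series) := WS (fun n => - F n).
Fact ws_mul_key : unit. Proof. by []. Qed.
Definition ws_mul (F G : word_series) := locked_with ws_mul_key (WS (fun w => conv w F G)).
Lemma ws_mulEn (F G : word_series) w : ws_mul F G w = conv w F G.
Proof. by rewrite [ws_mul _ _]unlock. Qed.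
Definition ws_zero := WS (fun=> 0).
Definition ws_one := WS (fun w => if w is [::] then 1 else 0).

Lemma ws_addA : associative ws_add.
Proof. by move=> f g h; apply: wsP => n /=; rewrite addrA. Qed.
Lemma ws_addC : commutative ws_add.
Proof. by move=> f g; apply: wsP => n /=; rewrite addrC. Qed.
Lemma ws_add0 : left_id ws_zero ws_add.
Proof. by move=> f; apply: wsP => n /=; rewrite add0r. Qed.
Lemma ws_addN : left_inverse ws_zero ws_opp ws_add.
Proof. by move=> f; apply: wsP => n /=; rewrite addNr. Qed.

HB.instance Definition _ := GRing.isZmodule.Build word_series ws_addA ws_addC ws_add0 ws_addN.

Lemma convE w (F G : seq T -> A) :
  conv w F G = \sum_(i < (size w).+1) F (take i w) * G (drop i w).
Proof.
elim: w F => [|a w IH] F /=; first by rewrite big_ord1 addr0.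
by rewrite IH [RHS]big_ord_recl.
Qed.

Lemma convDl w (F F' G : seq T -> A) :
  conv w (fun v => F v + F' v) G = conv w F G + conv w F' G.
Proof. by rewrite !convE -big_split /=; apply: eq_bigr => i _; rewrite mulrDl. Qed.

Lemma convZl w c (F G : seq T -> A) :
  conv w (fun v => c * F v) G = c * conv w F G.
Proof. by rewrite !convE mulr_sumr; apply: eq_bigr => i _; rewrite mulrA. Qed.

Lemma conv0l w (G : seq T -> A) : conv w (fun=> 0) G = 0.
Proof. by rewrite convE big1// => i _; rewrite mul0r. Qed.

Lemma convA w (F G H : seq T -> A) :
  conv w (fun v => conv v F G) H = conv w F (fun v => conv v G H).
Proof.
elim: w F => [|a w IH] F /=; first by rewrite !addr0 mulrA.
by rewrite convDl convZl IH /= mulrDr addr0 !addrA mulrA.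
Qed.

Lemma ws_mulA : associative ws_mul.
Proof.
move=> F G H; apply: wsP => w; rewrite !ws_mulEn.
transitivity (conv w F (fun v => conv v G H)).
  by rewrite !convE; apply: eq_bigr => i _; rewrite ws_mulEn.
by rewrite -convA !convE; apply: eq_bigr => i _; rewrite ws_mulEn.
Qed.
Lemma ws_mul1l : left_id ws_one ws_mul.
Proof. by move=> F; apply: wsP => -[|a w]; rewrite ws_mulEn /= mul1r ?conv0l addr0. Qed.
Lemma conv1r w (F : seq T -> A) : conv w F ws_one = F w.
Proof.
elim: w F => [|a w IH] F /=; first by rewrite addr0 mulr1.
by rewrite IH mulr0 add0r.
Qed.
Lemma ws_mul1r : right_id ws_one ws_mul.
Proof. by move=> F; apply: wsP => w; rewrite ws_mulEn conv1r. Qed.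
Lemma ws_mulDl : left_distributive ws_mul ws_add.
Proof. by move=> F G H; apply: wsP => w; rewrite /= !ws_mulEn -convDl. Qed.
Lemma ws_mulDr : right_distributive ws_mul ws_add.
Proof.
move=> F G H; apply: wsP => w; rewrite /= !ws_mulEn !convE -big_split /=.
by apply: eq_bigr => i _; rewrite mulrDr.
Qed.

HB.instance Definition _ := GRing.Zmodule_isPzRing.Build word_series
  ws_mulA ws_mul1l ws_mul1r ws_mulDl ws_mulDr.

Lemma ws_coefM (F G : word_series) w :
  (F * G) w = \sum_(i < (size w).+1) F (take i w) * G (drop i w).
Proof. by rewrite -convE; exact: ws_mulEn. Qed.
Lemma ws_coefB (F G : word_series) w : (F - G) w = F w - G w. Proof. by []. Qed.
Lemma ws_coefD (F G : word_series) w : (F + G) w = F w + G w. Proof. by []. Qed.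
Lemma ws_coef1 (w : seq T) : (1 : word_series) w = (size w == 0%N)%:R.
Proof. by case: w. Qed.
Lemma ws_coef_nil (F G : word_series) : (F * G) [::] = F [::] * G [::].
Proof. by rewrite ws_coefM big_ord1. Qed.
End WordSeries.
Arguments ws_coef_nil {T A}.

Definition wmap T (A B : pzRingType) (phi : A -> B) (F : word_series T A) : word_series T B :=
  WS (fun w => phi (F w)).

Section WordMorphisms.
Variables (T : Type).

Lemma wmapM (A B : pzRingType) (phi : {rmorphism A -> B}) (F G : word_series T A) :
  wmap phi (F * G) = wmap phi F * wmap phi G.
Proof.
apply: wsP => w; rewrite ws_coefM /= ws_coefM rmorph_sum.
by apply: eq_bigr => i _; rewrite rmorphM.
Qed.

Lemma wmap1 (A B : pzRingType) (phi : {rmorphism A -> B}) :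
  wmap phi (1 : word_series T A) = 1.
Proof. by apply: wsP => w; rewrite /= -!/(ws_one _ _ _); case: w => [|a w]; rewrite /= ?rmorph1 ?rmorph0. Qed.

Lemma wmap_prod (A B : pzRingType) (phi : {rmorphism A -> B}) I (r : seq I) (F : I -> word_series T A) :
  wmap phi (\prod_(i <- r) F i) = \prod_(i <- r) wmap phi (F i).
Proof. exact: (big_morph _ (wmapM phi) (wmap1 phi)). Qed.

Variable A : comPzRingType.

Definition wrev (F : word_series T A) : word_series T A := WS (fun w => F (rev w)).

Lemma wrevM F G : wrev (F * G) = wrev G * wrev F.
Proof.
apply: wsP => w; rewrite [LHS]ws_coefM ws_coefM /= size_rev.
rewrite (reindex_inj rev_ord_inj) /=; apply: eq_bigr => -[i /= im] _.
by rewrite subSS drop_rev take_rev subKn// mulrC.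
Qed.

Lemma wrev1 : wrev 1 = 1.
Proof. by apply: wsP => w; rewrite ws_coef1 /= -[in RHS]size_rev -ws_coef1. Qed.

Lemma wrevK : involutive wrev.
Proof. by move=> F; apply: wsP => w /=; rewrite revK. Qed.

Lemma wrev_prod I (r : seq I) (F : I -> word_series T A) :
  wrev (\prod_(i <- r) F i) = \prod_(i <- rev r) wrev (F i).
Proof.
elim: r => [|i r IH]; first by rewrite !big_nil wrev1.
by rewrite big_cons wrevM IH rev_cons -cats1 big_cat big_seq1.
Qed.

Definition wsgn (F : word_series T A) : word_series T A := WS (fun w => (-1) ^+ size w * F w).

Lemma wsgnM F G : wsgn (F * G) = wsgn F * wsgn G.
Proof.
apply: wsP => w; rewrite ws_coefM /= ws_coefM mulr_sumr.
apply: eq_bigr => -[i /= im] _.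
by rewrite mulrACA -exprD -size_cat cat_take_drop.
Qed.

Lemma wsgn1 : wsgn 1 = 1.
Proof. by apply: wsP => -[|a w] /=; rewrite ?mulr1 ?mulr0. Qed.

End WordMorphisms.

Section WordExp.
Variables (T : Type) (A : comPzRingType) (fi : nat -> A).
Hypothesis fiE : forall n, fi n * (n`!)%:R = 1.

(** The exponential of the series supported on one-letter words with values [g]; [fi] supplies the
    inverse factorials in [A]. *)
Definition wexp (g : T -> A) : word_series T A :=
  WS (fun w => fi (size w) * \prod_(a <- w) g a).

Lemma fi0 : fi 0 = 1. Proof. by rewrite -(fiE 0) fact0 mulr1. Qed.

Lemma fi_bin n i : (i <= n)%N -> fi n * 'C(n, i)%:R = fi i * fi (n - i).
Proof.
move=> im.
transitivity (fi n * 'C(n, i)%:R * (fi i * i`!%:R) * (fi (n - i) * (n - i)`!%:R)).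
  by rewrite !fiE !mulr1.
transitivity (fi n * ('C(n, i) * (i`! * (n - i)`!))%:R * (fi i * fi (n - i))).
  by rewrite !natrM; ring.
by rewrite bin_fact// fiE mul1r.
Qed.

(** Each cut of a word contributes one term of the binomial expansion of (a + b)^n, since [g] takes
    the same product over both pieces together. *)
Lemma wexpM (g : T -> A) (a b : A) :
  wexp (fun t => a * g t) * wexp (fun t => b * g t) = wexp (fun t => (a + b) * g t).
Proof.
apply: wsP => w; rewrite ws_coefM /=.
have prodZ c v : \prod_(t <- v) (c * g t) = c ^+ size v * \prod_(t <- v) g t.
  by rewrite big_split /= big_const_seq count_predT iter_mulr_1.
rewrite prodZ exprDn mulr_suml mulr_sumr.
rewrite (reindex_inj rev_ord_inj) /=; apply: eq_bigr => -[i /= im] _.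
rewrite subSS !prodZ size_takel ?leq_subr// size_drop subKn//.
rewrite -[in RHS](cat_take_drop (size w - i) w) big_cat /=.
rewrite -[_ *+ 'C(_, _)]mulr_natl.
have im' : (i <= size w)%N by [].
set P1 := \prod_(t <- take _ _) _; set P2 := \prod_(t <- drop _ _) _.
transitivity (fi (size w) * 'C(size w, i)%:R * (a ^+ (size w - i) * b ^+ i * (P1 * P2))).
  by rewrite (fi_bin im'); ring.
by rewrite cat_take_drop; ring.
Qed.

Lemma wexp0 : wexp (fun=> 0) = 1.
Proof. by apply: wsP => -[|a w]; rewrite /= ?big_nil ?fi0 ?mulr1// big_cons mul0r mulr0. Qed.

Lemma eq_wexp (g h : T -> A) : g =1 h -> wexp g = wexp h.
Proof. by move=> gh; apply: wsP => w /=; congr (_ * _); apply: eq_bigr => i _. Qed.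

Lemma wexpV (g : T -> A) (a : A) :
  wexp (fun t => a * g t) * wexp (fun t => - a * g t) = 1.
Proof. by rewrite wexpM -wexp0; apply: eq_wexp => t; rewrite subrr mul0r. Qed.

Lemma wrev_wexp g : wrev (wexp g) = wexp g.
Proof.
apply: wsP => w /=; rewrite size_rev; congr (_ * _).
elim: w => [|a w IH] //.
by rewrite rev_cons -cats1 big_cat big_seq1 IH big_cons mulrC.
Qed.

Lemma wsgn_wexp g : wsgn (wexp g) = wexp (fun t => - 1 * g t).
Proof.
apply: wsP => w /=; rewrite big_split /= big_const_seq count_predT iter_mulr_1.
by ring.
Qed.

End WordExp.

Lemma sum_tuple_cons (V : nmodType) (T : finType) n (F : n.+1.-tuple T -> V) :
  \sum_t F t = \sum_x \sum_t F (cons_tuple x t).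
Proof.
rewrite pair_big /= (reindex (fun p : T * n.-tuple T => cons_tuple p.1 p.2)) //=.
exists (fun t => (thead t, behead_tuple t)) => [[x t] _|t _] /=.
  by rewrite theadE; congr pair; exact: val_inj.
by apply/val_inj; rewrite [in RHS](tuple_eta t).
Qed.

Section Push.
Variables (A : comPzRingType) (S T : eqType) (cs : seq S) (g : S -> T -> A).

(** Substitution of alphabets: the letter [x] becomes the sum of the letters [a] with coefficients
    [g x a]. By [wpushM] this is a ring morphism. It serves twice: to turn integers into powers of
    their inverses, and later to recover all powers of t from the leading coefficients. *)
Fixpoint push (w : seq T) (F : seq S -> A) : A :=
  if w is a :: w' then \sum_(x <- cs) g x a * push w' (fun v => F (x :: v)) else F [::].

Lemma pushD w F G : push w (fun v => F v + G v) = push w F + push w G.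
Proof.
elim: w F G => [|a w IH] F G //=; rewrite -big_split /=; apply: eq_bigr => x _.
by rewrite IH mulrDr.
Qed.

Lemma pushZ w c F : push w (fun v => c * F v) = c * push w F.
Proof.
elim: w F => [|a w IH] F //=; rewrite mulr_sumr; apply: eq_bigr => x _.
by rewrite IH mulrCA.
Qed.

Lemma eq_push w F G : F =1 G -> push w F = push w G.
Proof.
elim: w F G => [|a w IH] F G FG //=; apply: eq_bigr => x _.
by congr (_ * _); apply: IH => v.
Qed.

Lemma push_conv w F G : push w (fun v => conv v F G) = conv w (push^~ F) (push^~ G).
Proof.
elim: w F => [|a w IH] F /=; first by rewrite !addr0.
under eq_bigr do rewrite pushD pushZ IH mulrDr.
rewrite big_split /=; congr (_ + _).
  by rewrite mulr_sumr; apply: eq_bigr => x _; rewrite mulrCA.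
rewrite convE.
under eq_bigr do rewrite convE mulr_sumr.
rewrite exchange_big /=; apply: eq_bigr => i _; rewrite mulr_suml.
by apply: eq_bigr => x _; rewrite mulrA.
Qed.

Definition wpush (F : word_series S A) : word_series T A := WS (push^~ F).

Lemma wpushM F G : wpush (F * G) = wpush F * wpush G.
Proof.
apply: wsP => w; rewrite ws_coefM -convE /= -push_conv.
by apply: eq_push => v; rewrite ws_coefM convE.
Qed.

Lemma wpush1 : wpush 1 = 1.
Proof.
apply: wsP => w /=; case: w => [|a w] //=; rewrite big1// => x _.
rewrite (_ : push w _ = 0) ?mulr0//; elim: w => [|b w IH] //=.
by rewrite big1// => y _; rewrite IH mulr0.
Qed.

Lemma wpush_prod I (r : seq I) (F : I -> word_series S A) :
  wpush (\prod_(i <- r) F i) = \prod_(i <- r) wpush (F i).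
Proof. exact: (big_morph _ wpushM wpush1). Qed.

Lemma wpush_wexp (fi : nat -> A) (f : S -> A) :
  wpush (wexp fi f) = wexp fi (fun a => \sum_(x <- cs) g x a * f x).
Proof.
apply: wsP => w /=.
suff H h : push w (fun v => h (size v) * \prod_(x <- v) f x) =
    h (size w) * \prod_(a <- w) \sum_(x <- cs) g x a * f x by exact: H.
elim: w h => [|a w IH] h /=; first by rewrite !big_nil.
rewrite big_cons mulrCA mulr_suml; apply: eq_bigr => x _.
rewrite (eq_push _ (G := fun v => f x * ((fun n => h n.+1) (size v) * \prod_(y <- v) f y))).
  by rewrite pushZ (IH (fun n => h n.+1)) mulrA.
by move=> v; rewrite big_cons mulrCA.
Qed.

Lemma wpush_wexp_delta (fi : nat -> A) c : uniq cs -> c \in cs ->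
  wpush (wexp fi (fun x => (x == c)%:R)) = wexp fi (g c).
Proof.
move=> ucs ccs; rewrite wpush_wexp; apply: eq_wexp => a.
rewrite (bigD1_seq c)//= eqxx mulr1 big1 ?addr0// => x /negbTE ->.
by rewrite mulr0.
Qed.

End Push.

(** * The truncated sum as an ordered product of exponentials *)

Section DensityWord.
Variable R : realType.

Definition ifact (n : nat) : R := (n`!%:R)^-1.

Lemma ifactE n : ifact n * n`!%:R = 1.
Proof. by rewrite mulVf// pnatr_eq0 -lt0n fact_gt0. Qed.

Definition stabs (x : seq int) := #|stab (in_tuple x)|.

Lemma stabsE n (x : n.-tuple int) : #|stab x| = stabs x.
Proof.
case: x => x xn; have en := eqP xn; subst n.
by rewrite (_ : Tuple xn = in_tuple x) //; exact: val_inj.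
Qed.

Lemma stabs_cons c (x : seq int) : stabs (c :: x) = (count_mem c (c :: x) * stabs x)%N.
Proof. by rewrite -(stabsE (cons_tuple c (in_tuple x))) card_stab_cons. Qed.

Lemma stabs_nil : stabs [::] = 1%N.
Proof.
rewrite /stabs (eq_card (B := predT)); first by rewrite card_Sn.
by move=> s; rewrite !inE; apply/eqP/val_inj/size0nil; rewrite size_tuple.
Qed.

Lemma stabs_nseq j c (x : seq int) : c \notin x ->
  stabs (nseq j c ++ x) = (j`! * stabs x)%N.
Proof.
move=> cx; elim: j => [|j IH]; first by rewrite mul1n.
rewrite /= stabs_cons IH factS mulnA; congr (_ * _ * _)%N.
by rewrite /= eqxx count_cat count_nseq /= eqxx mul1n (count_memPn cx) addn0.
Qed.

Definition dword (cs : seq int) : word_series int R :=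
  \prod_(c <- cs) wexp ifact (fun x : int => (x == c)%:R).

Lemma wexp_delta (c : int) v :
  wexp ifact (fun x : int => (x == c)%:R) v = if all (pred1 c) v then ifact (size v) else 0.
Proof.
rewrite /=; case: ifPn => [/allP h|].
  by rewrite big_seq big1 ?mulr1// => x /h /= ->.
move=> /allPn[x xv /= /negbTE xc].
by rewrite (perm_big (x :: rem x v)) ?perm_to_rem// big_cons xc /= mul0r mulr0.
Qed.

Lemma dword_supp cs x : ~~ all (mem cs) x -> dword cs x = 0.
Proof.
elim: cs x => [|c cs IH] x; rewrite /dword; first by rewrite big_nil ws_coef1; case: x.
rewrite big_cons ws_coefM => nx; apply: big1 => i _.
rewrite wexp_delta; case: ifPn => [ac|]; last by rewrite mul0r.
rewrite IH ?mulr0//; apply: contra nx => ad.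
rewrite -(cat_take_drop i x) all_cat; apply/andP; split.
  by apply: sub_all ac => y /= /eqP ->; rewrite inE eqxx.
by apply: sub_all ad => y /= ycs; rewrite inE ycs orbT.
Qed.

Lemma split_lead (c : int) (x : seq int) : exists j x', x = nseq j c ++ x' /\
  (x' = [::] \/ exists a x'', x' = a :: x'' /\ a != c).
Proof.
elim: x => [|a x [j [x' [-> H]]]]; first by exists 0%N, [::]; split=> //; left.
have [->|ac] := eqVneq a c; first by exists j.+1, x'.
by exists 0%N, (a :: nseq j c ++ x'); split=> //; right; exists a, (nseq j c ++ x').
Qed.

(** A word is sorted exactly when it is a concatenation of constant blocks in the order of [cs]. A
    block of length j contributes 1 / j!, and the order of the stabilizer is the product of these
    factorials. *)
Lemma dwordE cs x : pairwise (fun a b => cycle_le (R := R) a b && (a != b)) cs ->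
  all (mem cs) x ->
  dword cs x = if sorted (cycle_le (R := R)) x then ((stabs x)%:R)^-1 else 0.
Proof.
elim: cs x => [|c cs IH] x.
  by case: x => [|a x] //= _ _; rewrite /dword big_nil ws_coef1 stabs_nil invr1.
rewrite /= => /andP[/allP cc pcs] xcs.
have ccs : c \notin cs by apply/negP => /cc; rewrite eqxx andbF.
have [j [x' [xE x'E]]] := split_lead c x.
rewrite /dword big_cons ws_coefM -/(dword cs).
under eq_bigr do rewrite wexp_delta.
(* Only the cut after the maximal run of leading [c] survives: an earlier cut leaves a [c] to the
   remaining letters of [cs], a later one puts a foreign letter into the exponential of [c]. *)
have jx : (j < (size x).+1)%N by rewrite ltnS xE size_cat size_nseq leq_addr.
rewrite (bigD1 (Ordinal jx)) //= [X in _ + X]big1 ?addr0; last first.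
  move=> [i /= ix] ij.
  have {}ij : i != j by [].
  case: ifPn => [ai|]; last by rewrite mul0r.
  rewrite dword_supp ?mulr0//; apply/negP => /allP ad.
  move: ij; rewrite neq_ltn => /orP[ij|ji].
    case/negP: ccs; apply: (ad c); rewrite xE drop_cat size_nseq ij mem_cat drop_nseq.
    by rewrite mem_nseq subn_gt0 ij eqxx.
  move: ai; rewrite xE take_cat size_nseq ltnNge (ltnW ji) /= all_cat => /andP[_].
  case: x'E xE => [->|[a [x'' [-> ac]]]] xE.
    by move: ix; rewrite xE cats0 size_nseq ltnS leqNgt ji.
  by rewrite -(subnSK ji) /= (negbTE ac).
rewrite xE take_size_cat ?size_nseq// drop_size_cat ?size_nseq//.
rewrite all_pred1_nseq ?size_nseq.
have [ax'|nax'] := boolP (all (mem cs) x').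
  have cx' : c \notin x' by apply: contra ccs => /(allP ax').
  rewrite IH// stabs_nseq// natrM invfM.
  have -> : sorted (@cycle_le R) (nseq j c ++ x') = sorted (@cycle_le R) x'.
    elim: j {jx xE} => [|j IHj] //=.
    rewrite -IHj path_sortedE; last exact: cycle_le_trans.
    rewrite all_cat (_ : all _ _ && _ = true)//; apply/andP; split.
      by apply/allP => y /nseqP[-> _]; exact: lexx.
    by apply/allP => y /(allP ax')/cc/andP[].
  by case: ifP; rewrite ?mulr0.
rewrite dword_supp// mulr0; case: ifPn => // sx; case/negP: nax'.
case: x'E xE => [->//|[a [x'' [x'E ac]]]] xE.
move: sx; rewrite sorted_pairwise; last exact: cycle_le_trans.
rewrite pairwise_cat => /and3P[_ _]; rewrite x'E /= => /andP[/allP ax'' _].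
move: xcs; rewrite xE all_cat => /andP[_ ]; rewrite x'E /= inE (negbTE ac) /= => /andP[acs x''cs].
rewrite acs /=; apply/allP => y yx''; have := allP x''cs y yx''; rewrite /= inE => /orP[/eqP yc|//].
have := ax'' y yx''; rewrite yc => ya; have /cc/andP[ca _] := acs.
by case/negP: ac; apply/eqP; apply: (@cycle_le_anti R); rewrite ca ya.
Qed.

End DensityWord.

Lemma push_tuple (A : comPzRingType) (S : eqType) (s0 : S) (cs : seq S)
    (g : S -> nat -> A) (w : seq nat) (F : seq S -> A) :
  push cs g w F = \sum_(t : (size w).-tuple 'I_(size cs))
     F (map (fun i : 'I_(size cs) => nth s0 cs i) t) *
     \prod_(i < size w) g (nth s0 cs (tnth t i)) (nth 0%N w i).
Proof.
elim: w F => [|a w IH] F.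
  rewrite /= (big_pred1 [tuple]) ?big_ord0 ?mulr1// => t.
  by apply/esym/eqP; exact: tuple0.
rewrite [LHS]/= sum_tuple_cons (big_nth s0) big_mkord; apply: eq_bigr => x _.
rewrite IH mulr_sumr; apply: eq_bigr => t _.
rewrite big_ord_recl /= tnth0 mulrCA; congr (_ * (_ * _)).
by apply: eq_bigr => i _; rewrite tnthS.
Qed.

(** The range of summation, listed in the order of [cycle_le]. *)
Definition cyc (M : nat) : seq int :=
  [seq m%:Z | m <- iota 1 M.-1] ++ [seq - m%:Z | m <- rev (iota 1 M.-1)].

Lemma mem_cyc M (x : int) : (x \in cyc M) = (0 < `|x| < M%:Z).
Proof.
rewrite mem_cat; apply/orP/idP => [[/mapP[m]|/mapP[m]]|].
- by rewrite mem_iota => mM ->; lia.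
- by rewrite mem_rev mem_iota => mM ->; lia.
- case: (ltP 0 x) => x0 xM; [left|right]; apply/mapP; exists `|x|%N; lia || idtac.
  + by rewrite mem_iota; lia.
  + by rewrite mem_rev mem_iota; lia.
Qed.

Section Cyc.
Variable R : realType.

Lemma cyc_pairwise M : pairwise (fun a b => cycle_le (R := R) a b && (a != b)) (cyc M).
Proof.
have pos a b : (0 < a)%N -> (a < b)%N -> (b%:Z%:~R^-1 : R) < a%:Z%:~R^-1.
  move=> a0 ab; have b0 := ltn_trans a0 ab.
  by rewrite ltf_pV2 ?posrE ?ltr0z// ltr_int.
have st (a b : int) : (b%:~R^-1 : R) < a%:~R^-1 -> cycle_le (R := R) a b && (a != b).
  by move=> ab; rewrite /cycle_le (ltW ab) /=; apply: contraTneq ab => ->; rewrite ltxx.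
rewrite pairwise_cat; apply/and3P; split.
- apply/allrelP => a b /mapP[m]; rewrite mem_iota => hm -> /mapP[n].
  rewrite mem_rev mem_iota => hn ->; apply: st.
  by apply: (@lt_trans _ _ 0); rewrite ?invr_lt0 ?invr_gt0 ?ltrz0 ?ltr0z; lia.
- rewrite pairwise_map; apply: (sub_in_pairwise (P := [pred m | (0 < m)%N]) (r := ltn)).
  + by move=> a b; rewrite !inE => ha hb /= ab; apply: st; exact: pos.
  + by apply/allP => x; rewrite mem_iota => /andP[].
  + by rewrite -sorted_pairwise ?iota_ltn_sorted//; exact: ltn_trans.
- rewrite pairwise_map; apply: (sub_in_pairwise (P := [pred m | (0 < m)%N]) (r := gtn)).
  + move=> a b; rewrite !inE => ha hb /= ab; apply: st.
    by rewrite !mulrNz !invrN ltrN2; exact: pos.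
  + by apply/allP => x; rewrite mem_rev mem_iota => /andP[].
  + rewrite -sorted_pairwise; last by move=> a b c; rewrite /= => h1 h2; exact: ltn_trans h2 h1.
    by rewrite rev_sorted; exact: iota_ltn_sorted.
Qed.

Lemma cyc_uniq M : uniq (cyc M).
Proof.
rewrite uniq_pairwise; apply: sub_pairwise (cyc_pairwise M) => a b.
by move=> /andP[].
Qed.

(** The densities are the values of [dword] at words in [cyc M], so the weighted sum over integer
    points is the substitution with coefficients x^-a applied to [dword]; being multiplicative, it
    acts on each exponential factor. *)
Lemma zeta_natF_truncE k M : zeta_natF_trunc R k M =
  (\prod_(c <- cyc M) wexp (@ifact R) (fun a : nat => (c%:~R : R)^-1 ^+ a)) k.
Proof.
set cs := cyc M; pose g (x : int) (a : nat) : R := x%:~R^-1 ^+ a.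
transitivity (push cs g k (dword R cs)); last first.
  rewrite -[LHS]/(wpush cs g (dword R cs) k) /dword wpush_prod; congr (wcoef _ _).
  by apply: eq_big_seq => c ccs; rewrite wpush_wexp_delta// cyc_uniq.
rewrite (push_tuple 0) /zeta_natF_trunc.
set n := size k; set N := size cs.
pose h (t : n.-tuple 'I_N) : n.-tuple int := map_tuple (fun i : 'I_N => nth 0 cs i) t.
pose r := [seq h t | t <- enum {: n.-tuple 'I_N}].
have hinj : injective h.
  move=> t t' htt'; apply: eq_from_tnth => i.
  have /(congr1 (fun u => tnth u i)) := htt'; rewrite !tnth_map => /eqP.
  by rewrite nth_uniq ?cyc_uniq ?ltn_ord// => /eqP/val_inj.
have -> : [set m : n.-tuple int | forall i, 0 < `|tnth m i| < M%:Z] = [set` r].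
  apply/seteqP; split=> m /=.
    move=> hm; have hi i : tnth m i \in cs by rewrite mem_cyc.
    apply/mapP; exists [tuple (Ordinal (etrans (index_mem (tnth m i) cs) (hi i))) | i < n].
      by rewrite mem_enum.
    by apply: eq_from_tnth => i; rewrite tnth_map tnth_mktuple /= nth_index.
  move=> /mapP[t _ ->] i; rewrite tnth_map -mem_cyc; exact: mem_nth.
rewrite -fsbig_seq; last by rewrite map_inj_uniq// enum_uniq.
rewrite /r big_map big_enum /=; apply: eq_bigr => t _.
have ht i : tnth (h t) i \in cs by rewrite tnth_map mem_nth.
have ht0 i : tnth (h t) i != 0 by have := ht i; rewrite mem_cyc; case: eqP => // ->.
rewrite local_density_int// -prodfV; congr (_ * _); last first.
  by apply: eq_bigr => i _; rewrite /g tnth_map exprVn.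
rewrite dwordE ?cyc_pairwise//; last by apply/allP => x /mapP[i _ ->]; exact: mem_nth.
by rewrite stabsE.
Qed.

End Cyc.

(** * The germs t / (t + m) *)

Section Tau.
Variable R : realType.
Notation ps := (power_series R).

(* The expansion at [t = 0] of [t / (t + m)]; for [m = 0] this is [1]. *)
Definition tau (m : int) : ps :=
  if m == 0 then 1
  else PS (fun n => if n is n'.+1 then (-1) ^+ n' * (m%:~R)^-1 ^+ n else 0).

Lemma tauE m : (psX + ps_cst m%:~R) * tau m = psX.
Proof.
rewrite /tau; have [->|m0] := eqVneq m 0; first by rewrite mulr1 rmorph0 addr0.
have m0R : (m%:~R : R) != 0 by rewrite intr_eq0.
apply: psP => n; rewrite mulrDl ps_coefD psXM ps_cstM.
case: n => [|[|n]] /=; first by rewrite mulr0 addr0.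
  by rewrite add0r expr0 mul1r expr1 mulfV.
by rewrite !exprS; field.
Qed.

(** The partial fraction identity (b - a) / ((t + a) (t + b)) = 1 / (t + a) - 1 / (t + b),
    multiplied by t^2. *)
Lemma tau_mul a b :
  ps_cst (b - a)%:~R * (tau a * tau b) = psX * (tau a - tau b).
Proof.
transitivity (((psX + ps_cst b%:~R) * tau b) * tau a - ((psX + ps_cst a%:~R) * tau a) * tau b).
  by rewrite intrD mulrNz rmorphB /=; ring.
by rewrite !tauE; ring.
Qed.

Lemma tau_low m k n : m != 0 -> (n < k)%N -> (tau m ^+ k) n = 0.
Proof.
move=> m0 nk.
have -> : tau m = psX * PS (fun n => (-1) ^+ n * (m%:~R)^-1 ^+ n.+1).
  by apply: psP => j; rewrite psXM /tau (negbTE m0); case: j.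
by rewrite exprMn psXnM leqNgt nk.
Qed.

Lemma tau_dil m : m != 0 -> tau m = ps_dil (m%:~R)^-1 (tau 1).
Proof.
move=> m0; apply: psP => -[|n]; rewrite /tau (negbTE m0) /= ?mulr0//.
by rewrite invr1 expr1n mulr1 mulrC.
Qed.

Lemma tauN m : m != 0 -> tau (- m) = ps_dil (-1) (tau m).
Proof.
move=> m0; apply: psP => -[|n]; rewrite /tau oppr_eq0 (negbTE m0) /= ?mulr0//.
by rewrite mulrNz invrN (exprNn (m%:~R)^-1) mulrCA.
Qed.

Section Functionals.
Variable M : nat.

(* Both functionals kill all products of at least [k] germs [p |-> tau (m - p)], for [lam] with [0 < k]
   and for [rho] with [1 < k]: [lam] compares the Taylor coefficient at [0] with the partial fraction
   expansion, and [rho] is the sum of the residues. *)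
Definition lam (k : nat) (G : int -> ps) : R :=
  G 0 k - \sum_(p <- cyc M) \sum_(j < k) G p (k - j.+1)%N * (p%:~R)^-1 ^+ j.+1.

Definition rho (k : nat) (G : int -> ps) : R :=
  G 0 k.-1 + \sum_(p <- cyc M) G p k.-1.

Lemma eq_lam k G G' : G =1 G' -> lam k G = lam k G'.
Proof.
move=> GG; rewrite /lam GG; congr (_ - _); apply: eq_bigr => p _.
by apply: eq_bigr => j _; rewrite GG.
Qed.

Lemma lamD k G G' : lam k (fun p => G p + G' p) = lam k G + lam k G'.
Proof.
rewrite /lam [X in _ - X](_ : _ = \sum_(p <- cyc M) \sum_(j < k) G p (k - j.+1)%N * p%:~R^-1 ^+ j.+1 +
  \sum_(p <- cyc M) \sum_(j < k) G' p (k - j.+1)%N * p%:~R^-1 ^+ j.+1).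
  by rewrite ps_coefD; ring.
rewrite -big_split; apply: eq_bigr => p _ /=.
by rewrite -big_split; apply: eq_bigr => j _; rewrite /= mulrDl.
Qed.

Lemma lamZ k c G : lam k (fun p => ps_cst c * G p) = c * lam k G.
Proof.
rewrite /lam ps_cstM mulrBr; congr (_ - _).
rewrite mulr_sumr; apply: eq_bigr => p _; rewrite mulr_sumr.
by apply: eq_bigr => j _; rewrite ps_cstM mulrA.
Qed.

Lemma lamX k G : lam k.+1 (fun p => psX * G p) = lam k G.
Proof.
rewrite /lam psXM; congr (_ - _); apply: eq_bigr => p _.
rewrite big_ord_recr /=. rewrite subnn psXM mul0r addr0.
apply: eq_bigr => -[j /= jk] _; rewrite psXM.
by rewrite subSS -(subnSK jk).
Qed.

Lemma eq_rho k G G' : G =1 G' -> rho k G = rho k G'.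
Proof. by move=> GG; rewrite /rho GG; congr (_ + _); apply: eq_bigr => p _; rewrite GG. Qed.

Lemma rhoD k G G' : rho k (fun p => G p + G' p) = rho k G + rho k G'.
Proof. by rewrite /rho ps_coefD addrACA -big_split. Qed.

Lemma rhoZ k c G : rho k (fun p => ps_cst c * G p) = c * rho k G.
Proof.
rewrite /rho ps_cstM mulrDr; congr (_ + _).
by rewrite mulr_sumr; apply: eq_bigr => p _; rewrite ps_cstM.
Qed.

Lemma rhoX k G : rho k.+2 (fun p => psX * G p) = rho k.+1 G.
Proof. by rewrite /rho psXM; congr (_ + _); apply: eq_bigr => p _; rewrite psXM. Qed.

Definition in_window (m : int) : bool := `|m| < M%:Z.

Lemma in_window_cyc m : in_window m -> m != 0 -> m \in cyc M.
Proof. by rewrite /in_window mem_cyc => -> m0; rewrite normr_gt0 m0. Qed.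

(** For m = 0 all terms vanish. Otherwise the only surviving pole is p = m, and its term m^-k is the
    Taylor coefficient. *)
Lemma lam_pow k m : in_window m -> (0 < k)%N -> lam k (fun p => tau (m - p) ^+ k) = 0.
Proof.
move=> im k0; rewrite /lam subr0.
have hj (j : 'I_k) : (k - j.+1 < k)%N by rewrite ltn_subrL k0.
have [->|m0] := eqVneq m 0.
  rewrite [tau 0]/tau eqxx expr1n ps_coef1 gtn_eqF// sub0r big_seq big1 ?oppr0// => p.
  rewrite mem_cyc => /andP[p0 _]; apply: big1 => j _.
  by rewrite tau_low ?mul0r// sub0r oppr_eq0 -normr_gt0.
rewrite (bigD1_seq m) ?cyc_uniq ?in_window_cyc//= [X in _ - (_ + X)]big1 ?addr0; last first.
  move=> p pm; apply: big1 => j _.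
  by rewrite tau_low ?mul0r// subr_eq0 eq_sym.
rewrite subrr [tau 0]/tau eqxx expr1n.
case: k k0 hj => // k _ hj.
rewrite big_ord_recr [X in _ - (X + _)]big1 ?add0r; last first.
  move=> j _; rewrite ps_coef1 (_ : (_ == 0%N) = false) ?mul0r//.
  by apply/negbTE; have := ltn_ord j; rewrite /=; lia.
rewrite subnn ps_coef1 mul1r.
rewrite tau_dil// -rmorphXn /= (_ : (tau 1 ^+ k.+1) k.+1 = 1) ?mulr1 ?subrr//.
have -> : tau 1 = psX * PS (fun n => (-1) ^+ n).
  by apply: psP => j; rewrite psXM /tau /=; case: j => // j; rewrite invr1 expr1n mulr1.
rewrite exprMn psXnM leqnn subnn.
elim: (k.+1) => [|j IH]; first by rewrite expr0.
by rewrite exprS ps_coefM big_ord1 IH /= mulr1.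
Qed.

(** A simple pole has residue 1, so [rho] does not kill a single germ. This is why [rho_prod] asks
    for two factors: for two simple poles at distinct integers the residues cancel. *)
Lemma rho_pow k m : in_window m -> rho k.+1 (fun p => tau (m - p) ^+ k.+1) = (k == 0%N)%:R.
Proof.
move=> im; rewrite /rho /= subr0.
have [->|m0] := eqVneq m 0.
  rewrite [tau 0]/tau eqxx expr1n ps_coef1 big_seq big1 ?addr0// => p.
  rewrite mem_cyc => /andP[p0 _].
  by rewrite tau_low// sub0r oppr_eq0 -normr_gt0.
rewrite tau_low// add0r (bigD1_seq m) ?cyc_uniq ?in_window_cyc//= [X in (_ + X)]big1 ?addr0; last first.
  by move=> p pm; rewrite tau_low// subr_eq0 eq_sym.
by rewrite subrr [tau 0]/tau eqxx expr1n ps_coef1.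
Qed.

Let pr (ms : seq int) (p : int) : ps := \prod_(m <- ms) tau (m - p).

(** Either all germs have the same pole, or [tau_mul] separates two distinct poles and trades one
    germ for a factor t, which [lamX] and [rhoX] absorb. Induction on the number of germs then
    reaches pure powers. *)
Lemma tau_prod_cases (ms : seq int) : (0 < size ms)%N ->
  (exists m, m \in ms /\ forall p, pr ms p = tau (m - p) ^+ size ms) \/
  (exists m m' r, [/\ perm_eq ms [:: m, m' & r], m != m' &
    forall p, ps_cst (m' - m)%:~R * pr ms p = psX * (pr (m :: r) p - pr (m' :: r) p)]).
Proof.
case: ms => // m r _.
have [/allP h|/allPn[m' m'r mm']] := boolP (all (pred1 m) r).
  left; exists m; split; first by rewrite inE eqxx.
  move=> p; rewrite /pr big_cons exprS; congr (_ * _).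
  rewrite (eq_big_seq (fun=> tau (m - p))).
    by rewrite big_const_seq count_predT iter_mulr_1.
  by move=> x /h /= /eqP ->.
right; exists m, m', (rem m' r); have pe : perm_eq (m :: r) [:: m, m' & rem m' r].
  by rewrite perm_cons perm_to_rem.
split=> //; first by rewrite eq_sym.
move=> p; rewrite /pr (perm_big _ pe) !big_cons; set Q := \prod_(_ <- _) _.
have -> : m' - m = (m' - p) - (m - p) by lia.
rewrite [X in _ * X]mulrA mulrA tau_mul -mulrA; congr (_ * _).
by rewrite mulrBl.
Qed.

Lemma lam_prod ms : (0 < size ms)%N -> all in_window ms -> lam (size ms) (pr ms) = 0.
Proof.
move: {2}(size ms) (erefl (size ms)) => n.
elim: n ms => [|n IH] ms sn s0 ims; first by rewrite sn in s0.
have [[m [mms prE]]|[m [m' [r [pe mm' prE]]]]] := tau_prod_cases s0.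
  by rewrite (eq_lam _ prE) lam_pow// (allP ims).
have d0 : ((m' - m)%:~R : R) != 0 by rewrite intr_eq0 subr_eq0 eq_sym.
apply: (mulfI d0); rewrite mulr0 -lamZ (eq_lam _ prE) (perm_size pe) /= lamX.
rewrite (eq_lam _ (G' := fun p => pr (m :: r) p + ps_cst (-1) * pr (m' :: r) p)); last first.
  by move=> p; rewrite rmorphN1 mulN1r.
move: ims; rewrite (perm_all _ pe) /= => /and3P[im im' ir].
have sr : (size r).+1 = n by move: sn; rewrite (perm_size pe) /= => -[].
rewrite lamD lamZ (IH (m :: r))//= ?im// (IH (m' :: r))//= ?im'//.
by rewrite mulr0 addr0.
Qed.

Lemma rho_prod ms : (1 < size ms)%N -> all in_window ms -> rho (size ms) (pr ms) = 0.
Proof.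
move: {2}(size ms) (erefl (size ms)) => n.
elim: n ms => [|n IH] ms sn s1 ims; first by rewrite sn in s1.
have [[m [mms prE]]|[m [m' [r [pe mm' prE]]]]] := tau_prod_cases (ltnW s1).
  rewrite (eq_rho _ prE); case: (size ms) s1 => [|[|k]] // _.
  by rewrite rho_pow// (allP ims).
have d0 : ((m' - m)%:~R : R) != 0 by rewrite intr_eq0 subr_eq0 eq_sym.
apply: (mulfI d0); rewrite mulr0 -rhoZ (eq_rho _ prE) (perm_size pe) /= rhoX.
rewrite (eq_rho _ (G' := fun p => pr (m :: r) p + ps_cst (-1) * pr (m' :: r) p)); last first.
  by move=> p; rewrite rmorphN1 mulN1r.
move: ims; rewrite (perm_all _ pe) /= => /and3P[im im' ir].
have sr : (size r).+1 = n by move: sn; rewrite (perm_size pe) /= => -[].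
rewrite rhoD rhoZ; case: r pe prE sr ir => [|m'' r] pe prE sr ir.
  rewrite (eq_rho _ (G' := fun p => tau (m - p) ^+ 1)); last by move=> p; rewrite /pr big_seq1.
  rewrite (eq_rho _ (G := pr _) (G' := fun p => tau (m' - p) ^+ 1)); last by move=> p; rewrite /pr big_seq1.
  by rewrite !rho_pow// mulN1r subrr.
rewrite (IH [:: m, m'' & r])//= ?im// (IH [:: m', m'' & r])//= ?im'//.
by rewrite mulr0 addr0.
Qed.

(* Homogeneous combinations of degree [k] of the germs of [1 / (z + m)], scaled by [t]. *)
Definition tau_form (k : nat) (G : int -> ps) : Prop :=
  exists s : seq (R * seq int),
    (forall x, x \in s -> size x.2 = k /\ all in_window x.2) /\
    forall p, G p = \sum_(x <- s) ps_cst x.1 * pr x.2 p.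

Lemma tau_form_lam k G : (0 < k)%N -> tau_form k G -> lam k G = 0.
Proof.
move=> k0 [s [hs Gs]]; rewrite (eq_lam _ Gs) => {G Gs}.
elim: s hs => [|x s IH] hs.
  rewrite (eq_lam _ (G' := fun p => ps_cst 0 * 0)); first by rewrite lamZ mul0r.
  by move=> p; rewrite big_nil mulr0.
rewrite (eq_lam _ (G' := fun p => ps_cst x.1 * pr x.2 p + \sum_(x <- s) ps_cst x.1 * pr x.2 p)).
  have [sx ix] := hs x (mem_head _ _).
  rewrite lamD lamZ -{1}sx lam_prod ?sx// mulr0 add0r IH// => y ys.
  by apply: hs; rewrite inE ys orbT.
by move=> p; rewrite big_cons.
Qed.

Lemma tau_form_rho k G : (1 < k)%N -> tau_form k G -> rho k G = 0.
Proof.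
move=> k0 [s [hs Gs]]; rewrite (eq_rho _ Gs) => {G Gs}.
elim: s hs => [|x s IH] hs.
  rewrite (eq_rho _ (G' := fun p => ps_cst 0 * 0)); first by rewrite rhoZ mul0r.
  by move=> p; rewrite big_nil mulr0.
rewrite (eq_rho _ (G' := fun p => ps_cst x.1 * pr x.2 p + \sum_(x <- s) ps_cst x.1 * pr x.2 p)).
  have [sx ix] := hs x (mem_head _ _).
  rewrite rhoD rhoZ -{1}sx rho_prod ?sx// mulr0 add0r IH// => y ys.
  by apply: hs; rewrite inE ys orbT.
by move=> p; rewrite big_cons.
Qed.

Lemma eq_tau_form k G G' : G =1 G' -> tau_form k G -> tau_form k G'.
Proof. by move=> GG [s [hs Gs]]; exists s; split=> // p; rewrite -GG. Qed.

Lemma tau_form0 k : tau_form k (fun=> 0).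
Proof. by exists [::]; split=> // p; rewrite big_nil. Qed.

Lemma tau_formD k G G' : tau_form k G -> tau_form k G' -> tau_form k (fun p => G p + G' p).
Proof.
move=> [s [hs Gs]] [s' [hs' Gs']]; exists (s ++ s'); split.
  by move=> x; rewrite mem_cat => /orP[/hs|/hs'].
by move=> p; rewrite big_cat Gs Gs'.
Qed.

Lemma tau_form_sum k I (r : seq I) (G : I -> int -> ps) :
  (forall i, tau_form k (G i)) -> tau_form k (fun p => \sum_(i <- r) G i p).
Proof.
move=> hG; elim: r => [|i r IH].
  by apply: eq_tau_form (tau_form0 k) => p; rewrite big_nil.
by apply: eq_tau_form (tau_formD (hG i) IH) => p; rewrite big_cons.
Qed.

Lemma tau_formM k l G G' : tau_form k G -> tau_form l G' ->
  tau_form (k + l) (fun p => G p * G' p).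
Proof.
move=> [s [hs Gs]] [s' [hs' Gs']].
exists [seq (x.1 * y.1, x.2 ++ y.2) | x <- s, y <- s']; split.
  move=> _ /allpairsP[[x y] /= [/hs[<- ix] /hs'[<- iy] ->]] /=.
  by rewrite size_cat all_cat ix iy.
move=> p; rewrite Gs Gs' big_allpairs_dep /= mulr_suml; apply: eq_bigr => x _.
rewrite mulr_sumr; apply: eq_bigr => y _; rewrite /pr big_cat /= rmorphM /=.
by ring.
Qed.

End Functionals.
End Tau.

(** * The half products of the E_m and their renormalization *)

Section Renorm.
Variable R : realType.
Notation ps := (power_series R).
Notation ws := (word_series nat ps).

Definition fps (n : nat) : ps := ps_cst (ifact R n).

Lemma fpsE n : fps n * n`!%:R = 1.
Proof. by rewrite /fps -(rmorph_nat (@ps_cst R)) -rmorphM ifactE rmorph1. Qed.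

Definition expo (m : int) : ws := wexp fps (fun k => tau R m ^+ k).

Lemma expoE m w : expo m w = fps (size w) * tau R m ^+ sumn w.
Proof.
rewrite /expo /=; congr (_ * _); elim: w => [|a w IH]; first by rewrite big_nil.
by rewrite big_cons IH -exprD.
Qed.

Definition harm (n : nat) : R := \sum_(1 <= m < n) m%:R^-1.

(* The exponential of [h t e_1], where [e_1] is the letter [1]. *)
Definition xe (h : R) : ws :=
  wexp fps (fun k => ps_cst h * (if k == 1%N then psX else 0)).

Lemma xeM a b : xe a * xe b = xe (a + b).
Proof. by rewrite /xe wexpM ?rmorphD//; exact: fpsE. Qed.

Lemma xe0 : xe 0 = 1.
Proof.
rewrite /xe -(wexp0 _ fpsE); apply: eq_wexp => k.
by rewrite rmorph0 mul0r.
Qed.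

Lemma xeE h w : xe h w = if all (pred1 1%N) w then ps_cst (ifact R (size w) * h ^+ size w) * psX ^+ size w else 0.
Proof.
rewrite -[LHS]/(fps _ * \prod_(a <- w) (ps_cst h * (if a == 1%N then psX else 0))).
case: ifPn => [/allP h1|].
  rewrite big_split /= big_const_seq count_predT iter_mulr_1 rmorphM rmorphXn /=.
  rewrite (eq_big_seq (fun=> psX)); last by move=> x /h1 /= ->.
  by rewrite big_const_seq count_predT iter_mulr_1 mulrA.
move=> /allPn[x xw /negbTE]; rewrite inE => x1.
by rewrite (perm_big (x :: rem x w)) ?perm_to_rem// big_cons x1 mulr0 /= mul0r mulr0.
Qed.

Lemma wrev_xe h : wrev (xe h) = xe h. Proof. exact: wrev_wexp. Qed.

Lemma wrev_expo m : wrev (expo m) = expo m. Proof. exact: wrev_wexp. Qed.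

Lemma wmap_wexp (phi : {rmorphism ps -> ps}) (g : nat -> ps) :
  (forall c, phi (ps_cst c) = ps_cst c) ->
  wmap phi (wexp fps g) = wexp fps (phi \o g).
Proof. by move=> phic; apply: wsP => w /=; rewrite rmorphM rmorph_prod phic. Qed.

Lemma dil_cst (x c : R) : ps_dil x (ps_cst c) = ps_cst c.
Proof. by apply: psP => -[|n]; rewrite /= ?mul1r ?mulr0. Qed.

Lemma dil_X (x : R) : ps_dil x psX = ps_cst x * psX.
Proof. by apply: psP => n; rewrite ps_cstM /=; case: n => [|[|n]] /=; rewrite ?mulr0. Qed.

Lemma dil_xe x h : wmap (ps_dil x) (xe h) = xe (x * h).
Proof.
rewrite /xe wmap_wexp; last exact: dil_cst.
apply: eq_wexp => k /=; rewrite rmorphM /= dil_cst; case: ifP => _.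
  by rewrite dil_X rmorphM /=; ring.
by rewrite rmorph0 !mulr0.
Qed.

Lemma dil_expo m : m != 0 -> expo m = wmap (ps_dil (m%:~R)^-1) (expo 1).
Proof.
move=> m0; rewrite /expo wmap_wexp; last exact: dil_cst.
by apply: eq_wexp => k /=; rewrite rmorphXn /= -tau_dil.
Qed.

Lemma expoN m : m != 0 -> expo (- m) = wmap (ps_dil (-1)) (expo m).
Proof.
move=> m0; rewrite /expo wmap_wexp; last exact: dil_cst.
by apply: eq_wexp => k /=; rewrite rmorphXn /= -tauN.
Qed.

Definition posp (N : nat) : ws := \prod_(m <- iota 1 N.-1) expo m%:Z.
Definition negp (N : nat) : ws := \prod_(m <- rev (iota 1 N.-1)) expo (- m%:Z).

Lemma pospS N : (0 < N)%N -> posp N.+1 = posp N * expo N%:Z.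
Proof.
case: N => // N _; rewrite /posp (_ : iota 1 N.+2.-1 = iota 1 N ++ [:: N.+1]).
  by rewrite big_cat big_seq1.
by have := iotaD 1 N 1; rewrite addn1 add1n.
Qed.

Lemma negpE N : negp N = wmap (ps_dil (-1)) (wrev (posp N)).
Proof.
rewrite /posp wrev_prod wmap_prod /negp; apply: eq_big_seq => m.
by rewrite mem_rev mem_iota => /andP[m0 _]; rewrite wrev_expo -expoN //; lia.
Qed.

Lemma wsgn_expo m : expo m * wsgn (expo m) = 1.
Proof.
rewrite /expo wsgn_wexp -(wexpV fpsE (fun k => tau R m ^+ k) 1).
by congr (_ * _); apply: eq_wexp => k; rewrite mul1r.
Qed.

(** Each E_m is an exponential, so changing the sign on words of odd length inverts it; reversal
    puts the inverse factors in the right order. *)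
Lemma posp_antipode N : posp N * wsgn (wrev (posp N)) = 1.
Proof.
case: N => [|N]; first by rewrite /posp big_nil wrev1 wsgn1 mulr1.
elim: N => [|N IH]; first by rewrite /posp big_nil wrev1 wsgn1 mulr1.
rewrite pospS// wrevM wsgnM wrev_expo mulrA -(mulrA (posp _)) wsgn_expo mulr1.
exact: IH.
Qed.

Definition ren (N : nat) : ws := posp N * xe (- harm N).
Definition renneg (N : nat) : ws := xe (harm N) * negp N.

Lemma rennegE N : renneg N = wmap (ps_dil (-1)) (wrev (ren N)).
Proof. by rewrite /ren wrevM wmapM wrev_xe dil_xe mulN1r opprK -negpE. Qed.

Lemma posp_ren N : posp N = ren N * xe (harm N).
Proof. by rewrite /ren -mulrA xeM addNr xe0 mulr1. Qed.

Lemma negp_ren N : negp N = xe (- harm N) * renneg N.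
Proof. by rewrite /renneg mulrA xeM addNr xe0 mul1r. Qed.

Lemma ren_antipode N : ren N * wsgn (wrev (ren N)) = 1.
Proof.
rewrite /ren wrevM wsgnM wrev_xe.
have -> : wsgn (xe (- harm N)) = xe (harm N).
  apply: wsP => w; rewrite -[LHS]/((-1) ^+ size w * xe (- harm N) w) !xeE; case: ifP => _; last by rewrite mulr0.
  rewrite -(rmorph1 (@ps_cst R)) -rmorphN -rmorphXn mulrA -rmorphM /=.
  by congr (ps_cst _ * _); rewrite mulrCA -exprMn mulN1r opprK.
by rewrite mulrA -(mulrA (posp _)) xeM addNr xe0 mulr1 posp_antipode.
Qed.

Lemma posp_negp N : posp N * negp N = ren N * renneg N.
Proof. by rewrite posp_ren negp_ren mulrA -(mulrA (ren N)) xeM addrN xe0 mulr1. Qed.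

(** What remains of E_1 after division by exp(t e_1). It starts at t^2, so its dilation by 1/N,
    which governs the step from N to N + 1, is O(1/N^2) and the renormalized products converge. *)
Definition ddef : ws := expo 1 * xe (-1) - 1.

Lemma harmS N : (0 < N)%N -> harm N.+1 = harm N + N%:R^-1.
Proof. by move=> N0; rewrite /harm big_nat_recr. Qed.

Lemma ren_incr N : (0 < N)%N ->
  ren N.+1 - ren N = posp N * wmap (ps_dil N%:R^-1) ddef * xe (- harm N).
Proof.
move=> N0; rewrite /ren pospS// harmS//.
have -> : wmap (ps_dil N%:R^-1) ddef = expo N%:Z * xe (- N%:R^-1) - 1.
  rewrite /ddef -[in RHS](wmap1 nat (ps_dil N%:R^-1)).
  have -> (F G : ws) : wmap (ps_dil N%:R^-1) (F - G) = wmap (ps_dil N%:R^-1) F - wmap (ps_dil N%:R^-1) G.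
    by apply: wsP => w; rewrite /= rmorphB.
  congr (_ - _); rewrite wmapM dil_xe mulrN1 [in RHS](@dil_expo N%:Z)//; lia.
rewrite mulrBr mulr1 mulrBl -!mulrA xeM; congr (_ - _).
by congr (_ * (_ * xe _)); ring.
Qed.

(* The germ at [p] of the truncated multitangent functions. *)
Definition uword (M : nat) (p : int) : ws :=
  \prod_(m <- [seq i%:Z - M.-1%:Z | i <- iota 0 M.-1.*2.+1]) expo (m - p).

(** The window |m| < M seen from p consists of M + p - 1 negative shifts, the shift 0 and M - p - 1
    positive shifts. The arguments are one larger because [negp n] and [posp n] have n - 1
    factors. *)
Lemma uword_decomp M p : `|p| < M%:Z ->
  uword M p = negp (absz (M%:Z + p)%R) * expo 0 * posp (absz (M%:Z - p)%R).
Proof.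
move=> pM; rewrite /uword.
set a := (absz (M%:Z + p)%R); set b := (absz (M%:Z - p)%R).
rewrite /negp /posp -(big_map (fun m : nat => - m%:Z) predT expo) -(big_map Posz predT expo).
rewrite -(big_map (fun m => m - p) predT expo) -map_comp.
have e0 : expo 0 = \prod_(j <- [:: 0]) expo j by rewrite big_seq1.
rewrite -mulrA e0 -!big_cat; congr (\prod_(j <- _) expo j).
have hs : (a.-1 + (b.-1).+1 = M.-1.*2.+1)%N by rewrite /a /b; lia.
apply: (@eq_from_nth _ 0).
  by rewrite !size_cat !size_map size_rev !size_iota add1n hs.
move=> i; rewrite size_map size_iota => hi.
rewrite (nth_map 0%N) ?size_iota// nth_iota// nth_cat size_map size_rev size_iota /=.
case: ltnP => ia.
  rewrite (nth_map 0%N) ?size_rev ?size_iota// nth_rev ?size_iota// nth_iota; last by lia.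
  by move: ia hi; rewrite /a; lia.
case ij: (i - a.-1)%N => [|j] /=.
  by move: ij ia; rewrite /a; lia.
rewrite (nth_map 0%N) ?size_iota; last by lia.
rewrite nth_iota; last by lia.
by move: ij ia; rewrite /a; lia.
Qed.

Lemma uword_form M w : (0 < M)%N -> tau_form M (sumn w) (fun p => uword M p w).
Proof.
move=> M0; rewrite /uword; set r := [seq _ | i <- _].
have hr : all (in_window M) r.
  apply/allP => x /mapP[i]; rewrite mem_iota /in_window => hi ->; lia.
elim: r w hr => [|m r IH] w hr.
  case: w => [|a w].
    exists [:: (1, [::])]; split; first by move=> x; rewrite inE => /eqP ->.
    by move=> p; rewrite !big_nil big_seq1 /= ?big_nil ?rmorph1 ?mulr1.
  apply: eq_tau_form (tau_form0 _ _ _) => p.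
  by rewrite big_nil ws_coef1.
move: hr => /= /andP[im ir].
apply: (eq_tau_form (G := fun p => \sum_(i <- enum 'I_(size w).+1)
    (expo (m - p) (take i w) * (\prod_(j <- r) expo (j - p)) (drop i w)))).
  by move=> p; rewrite big_cons ws_coefM big_enum.
apply: tau_form_sum => i.
rewrite -[in sumn w](cat_take_drop i w) sumn_cat.
apply: tau_formM; last exact: IH.
exists [:: (ifact R (size (take i w)), nseq (sumn (take i w)) m)]; split.
  by move=> x; rewrite inE => /eqP -> /=; rewrite size_nseq all_nseq im orbT.
by move=> p; rewrite big_seq1 expoE /= big_nseq iter_mulr_1.
Qed.

End Renorm.

(** * Logarithmic asymptotics *)

Section Asymptotics.
Variable R : realType.

(** A substitute for log N; the summand 1 makes it at least 1, so that its powers increase with the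
    exponent. *)
Definition Lg (N : nat) : R := 1 + harm R N.

Lemma harm_ge0 N : 0 <= harm R N.
Proof. by rewrite /harm; apply: sumr_ge0 => i _; rewrite invr_ge0. Qed.

Lemma Lg_ge1 N : 1 <= Lg N.
Proof. by rewrite /Lg lerDl harm_ge0. Qed.

Lemma Lg_gt0 N : 0 < Lg N. Proof. exact: lt_le_trans ltr01 (Lg_ge1 N). Qed.
Hint Resolve Lg_gt0 Lg_ge1 : core.

Lemma harm_le m n : (m <= n)%N -> harm R m <= harm R n.
Proof.
elim: n => [|n IH]; first by rewrite leqn0 => /eqP ->.
rewrite leq_eqVlt => /orP[/eqP -> //|]; rewrite ltnS => /IH h; apply: le_trans h _.
by case: n {IH} => [|n]; [rewrite /harm !big_geq|rewrite [leRHS]harmS// lerDl invr_ge0].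
Qed.

Lemma Lg_le m n : (m <= n)%N -> Lg m <= Lg n.
Proof. by move=> mn; rewrite lerD2l harm_le. Qed.

Lemma Lg_exp_le d d' N : (d <= d')%N -> Lg N ^+ d <= Lg N ^+ d'.
Proof. by move=> dd; rewrite ler_weXn2l// Lg_ge1. Qed.

Lemma Lg_exp_ge0 d N : 0 <= Lg N ^+ d. Proof. by rewrite exprn_ge0// ltW. Qed.
Hint Resolve Lg_exp_ge0 : core.

Lemma Lg_exp_mono d m n : (m <= n)%N -> Lg m ^+ d <= Lg n ^+ d.
Proof. by move=> mn; rewrite lerXn2r ?nnegrE ?(ltW (Lg_gt0 _))// Lg_le. Qed.

Lemma lnS_bounds N : (0 < N)%N ->
  (N.+1%:R : R)^-1 <= ln (N.+1%:R : R) - ln (N%:R : R) <= (N%:R : R)^-1.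
Proof.
move=> N0; have N0' : (0 : R) < N%:R by rewrite ltr0n.
rewrite -ln_div ?posrE//; apply/andP; split.
  rewrite -[X in _ <= X]opprK -lnV ?posrE ?divr_gt0// invf_div lerNr.
  have -> : N%:R / N.+1%:R = 1 + - N.+1%:R^-1 :> R by rewrite -natr1; field.
  by apply: le_ln1Dx; rewrite ltrN2 invf_lt1// ltr1n.
have -> : N.+1%:R / N%:R = 1 + N%:R^-1 :> R.
  by rewrite -natr1; field; rewrite gt_eqF.
by apply: le_ln1Dx; apply: (@lt_trans _ _ 0); rewrite ?invr_gt0 ?ltrN10.
Qed.

Lemma harm_le_ln N : (0 < N)%N -> harm R N <= 1 + ln N%:R.
Proof.
move=> N0; apply: (@le_trans _ _ (harm R N.+1)); first exact: harm_le.
elim: N N0 => // -[|N] IH _; first by rewrite /harm big_nat1 invr1 ln1 addr0.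
rewrite harmS//; have h0 := IH isT; have /andP[h _] := @lnS_bounds N.+1 isT.
by apply: (le_trans (lerD h0 h)); rewrite -addrA (addrCA (ln _)) subrr addr0.
Qed.

Lemma ln_le_harm N : ln N%:R <= harm R N.
Proof.
elim: N => [|[|N] IH]; [by rewrite ln0// harm_ge0|by rewrite ln1 harm_ge0|].
rewrite harmS//; have /andP[_ h] := @lnS_bounds N.+1 isT.
by apply: le_trans (lerD IH h); rewrite addrC subrK.
Qed.

(** Powers of the logarithm are traded for a square root through y^n / n! <= exp y at y = 1 + ln N /
    2. *)
Lemma Lg_le_sqrt d : exists2 C : R, 0 <= C &
  forall N, (0 < N)%N -> Lg N ^+ d <= C * Num.sqrt N%:R.
Proof.
exists (2 ^+ d.+1 * d.+1`!%:R * expR 1).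
  by rewrite !mulr_ge0 ?exprn_ge0 ?expR_ge0.
move=> N N0; have N0' : (0 : R) < N%:R by rewrite ltr0n.
pose y : R := (2 + ln N%:R) / 2.
have l0 : (0 : R) <= ln N%:R by rewrite ln_ge0// ler1n.
have y0 : 0 <= y by rewrite /y; lra.
have ey : expR y = expR 1 * Num.sqrt N%:R.
  rewrite (_ : y = 1 + ln N%:R / 2); last by rewrite /y; field.
  rewrite expRD; congr (_ * _).
  rewrite -[LHS]ger0_norm ?expR_ge0// -sqrtr_sqr; congr Num.sqrt.
  by rewrite -expRM_natr (_ : _ / 2 * 2%:R = ln N%:R) ?lnK ?posrE//; field.
apply: (le_trans (Lg_exp_le N (leqnSn d))).
apply: (@le_trans _ _ ((2 * y) ^+ d.+1)).
  rewrite lerXn2r ?nnegrE ?(ltW (Lg_gt0 _))//; first by lra.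
  by have := harm_le_ln N0; rewrite /Lg /y; lra.
rewrite exprMn -!mulrA ler_pM2l ?exprn_gt0// mulrC -ey.
have := expR_ge1Dxn d y0; rewrite -ler_pdivrMr ?ltr0n ?fact_gt0//.
by lra.
Qed.

Section Big.
Variables (T : Type) (P : T -> Prop) (l : T -> R).

(* [f] is [O(e)] on [P] up to powers of the logarithmic weight [l]. *)
Definition gbig (e f : T -> R) : Prop := exists C d, 0 <= C /\
  forall x, P x -> `|f x| <= C * l x ^+ d * e x.

Lemma eq_big_asy e f g : (forall x, P x -> f x = g x) -> gbig e f -> gbig e g.
Proof. by move=> fg [C [d [C0 h]]]; exists C, d; split=> // N N0; rewrite -fg//; exact: h. Qed.

Lemma big0 e : (forall x, 0 <= e x) -> gbig e (fun=> 0).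
Proof. by move=> e0; exists 0, 0%N; split=> // N _; rewrite normr0 !mul0r. Qed.

Lemma bigN e f : gbig e f -> gbig e (fun x => - f x).
Proof. by move=> [C [d [C0 h]]]; exists C, d; split=> // N N0; rewrite normrN; exact: h. Qed.

Lemma bigM e e' f g : gbig e f -> gbig e' g ->
  gbig (fun x => e x * e' x) (fun x => f x * g x).
Proof.
move=> [C [d [C0 h]]] [C' [d' [C0' h']]]; exists (C * C'), (d + d')%N.
split; first exact: mulr_ge0.
move=> N N0; rewrite normrM exprD.
apply: (@le_trans _ _ ((C * l N ^+ d * e N) * (C' * l N ^+ d' * e' N))).
  by rewrite ler_pM// ?h ?h'.
by rewrite le_eqVlt; apply/orP; left; apply/eqP; ring.
Qed.

Lemma plog_cst c : gbig (fun=> 1) (fun=> c).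
Proof. by exists `|c|, 0%N; split=> // N _; rewrite expr0 !mulr1. Qed.

Hypothesis l1 : forall x, 1 <= l x.

Let l_exp_ge0 d x : 0 <= l x ^+ d.
Proof. by rewrite exprn_ge0// (le_trans ler01 (l1 x)). Qed.
Hint Resolve l_exp_ge0 : core.

Let l_exp_le d d' x : (d <= d')%N -> l x ^+ d <= l x ^+ d'.
Proof. by move=> dd; rewrite ler_weXn2l. Qed.

Lemma big_le e e' f : (forall x, P x -> e x <= e' x) -> gbig e f -> gbig e' f.
Proof.
move=> ee [C [d [C0 h]]]; exists C, d; split=> // N N0.
by apply: (le_trans (h N N0)); rewrite ler_wpM2l ?mulr_ge0// ee.
Qed.

Lemma bigD e f g : (forall x, 0 <= e x) -> gbig e f -> gbig e g ->
  gbig e (fun x => f x + g x).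
Proof.
move=> e0 [C [d [C0 h]]] [C' [d' [C0' h']]]; exists (C + C'), (maxn d d').
split; first exact: addr_ge0.
move=> N N0; apply: (le_trans (ler_normD _ _)); rewrite mulrDl mulrDl lerD//.
  apply: (le_trans (h N N0)); rewrite ler_wpM2r// ler_wpM2l//.
  by rewrite l_exp_le// leq_maxl.
apply: (le_trans (h' N N0)); rewrite ler_wpM2r// ler_wpM2l//.
by rewrite l_exp_le// leq_maxr.
Qed.

Lemma bigB e f g : (forall x, 0 <= e x) -> gbig e f -> gbig e g ->
  gbig e (fun x => f x - g x).
Proof. by move=> e0 hf hg; apply: bigD => //; exact: bigN. Qed.

Lemma plogM e f g : gbig (fun=> 1) f -> gbig e g -> gbig e (fun x => f x * g x).
Proof.
move=> hf hg; apply: big_le (bigM hf hg) => N _.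
by rewrite mul1r.
Qed.

Lemma bigZ e c f : gbig e f -> gbig e (fun x => c * f x).
Proof. by move=> hf; apply: plogM hf; exact: plog_cst. Qed.

Lemma big_sumf e I (r : seq I) (Q : pred I) (f : I -> T -> R) :
  (forall x, 0 <= e x) ->
  (forall i, Q i -> gbig e (f i)) -> gbig e (fun x => \sum_(i <- r | Q i) f i x).
Proof.
move=> e0 hf; elim: r => [|i r IH].
  by apply: eq_big_asy (big0 e0) => N _; rewrite big_nil.
case Qi : (Q i); last by apply: eq_big_asy IH => N _; rewrite big_cons Qi.
by apply: eq_big_asy (bigD e0 (hf i Qi) IH) => N _; rewrite big_cons Qi.
Qed.

Lemma plogX f d : gbig (fun=> 1) f -> gbig (fun=> 1) (fun x => f x ^+ d).
Proof.
move=> hf; elim: d => [|d IH]; first exact: plog_cst.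
by apply: (eq_big_asy (f := fun x => f x * f x ^+ d)) => [N _|]; [rewrite exprS|exact: plogM].
Qed.

End Big.

Definition big := gbig (fun N => 0 < N)%N Lg.
Definition plog := big (fun=> 1).
Definition sml := big (fun N => (Num.sqrt N%:R)^-1).

Lemma plog_Lg : plog Lg.
Proof. by exists 1, 1%N; split=> // N _; rewrite expr1 mul1r mulr1 ger0_norm// ltW. Qed.

Lemma plog_harm : plog (harm R).
Proof.
apply: (eq_big_asy (f := fun N => Lg N - 1)); first by move=> N _; rewrite /Lg addrAC subrr add0r.
by apply: bigB => //; [exact: plog_Lg|exact: plog_cst].
Qed.

Lemma isqrt_ge0 N : 0 <= (Num.sqrt N%:R)^-1 :> R.
Proof. by rewrite invr_ge0 sqrtr_ge0. Qed.

Lemma isqrt_telescope N : (0 < N)%N ->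
  (N%:R * Num.sqrt N%:R)^-1 <=
  4 * ((Num.sqrt N%:R)^-1 - (Num.sqrt N.+1%:R)^-1) :> R.
Proof.
move=> N0; have N1 : (1 : R) <= N%:R by rewrite ler1n.
set a := Num.sqrt N%:R; set b := Num.sqrt N.+1%:R.
have a2 : a ^+ 2 = N%:R by rewrite sqr_sqrtr// ler0n.
have b2 : b ^+ 2 = N%:R + 1 by rewrite sqr_sqrtr ?ler0n// natr1.
have a1 : 1 <= a by rewrite -sqrtr1 ler_sqrt// ltr0n.
have ab : a <= b by rewrite ler_sqrt ?ltr0n// ler_nat.
have b2a : b <= 3 / 2 * a.
  rewrite -(ler_pXn2r (n := 2))// ?nnegrE; [|by lra|by lra].
  by rewrite exprMn a2 b2; lra.
have -> : a^-1 - b^-1 = (b ^+ 2 - a ^+ 2) / (a * b * (a + b)).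
  by field; rewrite !gt_eqF//; lra.
rewrite a2 b2 [_ - _](_ : _ = 1); last by ring.
rewrite -a2 mul1r -[X in X <= _]mul1r ler_pdivrMr; last by rewrite !mulr_gt0//; lra.
rewrite mulrAC ler_pdivlMr ?mul1r; last by rewrite !mulr_gt0//; lra.
have : b * (a + b) <= (3 / 2 * a) * (a + 3 / 2 * a).
  by rewrite ler_pM//; lra.
move=> h; have h2 : a * (b * (a + b)) <= a * ((3 / 2 * a) * (a + 3 / 2 * a)).
  by rewrite ler_pM2l//; lra.
have a3 : 0 <= a * (a * a) by rewrite !mulr_ge0//; lra.
by lra.
Qed.

(** The increments are dominated by the differences of [c N], a multiple of N^(-1/2). Hence f + c
    decreases and f - c increases, and the limit is the supremum of the latter. The rate is far from
    optimal, but every power of the logarithm is swallowed by it. *)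
Lemma cvg_of_increments (f : nat -> R) :
  big (fun N => (N%:R ^+ 2)^-1) (fun N => f N.+1 - f N) ->
  exists l C, 0 <= C /\ forall N, (0 < N)%N -> `|f N - l| <= C / Num.sqrt N%:R.
Proof.
move=> [C [d [C0 h]]]; have [K K0 hK] := Lg_le_sqrt d.
pose c N : R := 4 * (C * K) * (Num.sqrt N%:R)^-1.
have hc N : (0 < N)%N -> `|f N.+1 - f N| <= c N - c N.+1.
  move=> N0; apply: (le_trans (h N N0)).
  have N1 : (1 : R) <= N%:R by rewrite ler1n.
  have s0 : 0 < Num.sqrt N%:R :> R by rewrite sqrtr_gt0; lra.
  have -> : c N - c N.+1 = (C * K) * (4 * ((Num.sqrt N%:R)^-1 - (Num.sqrt N.+1%:R)^-1)).
    by rewrite /c; ring.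
  apply: (@le_trans _ _ (C * K * (N%:R * Num.sqrt N%:R)^-1)); last first.
    by rewrite ler_wpM2l ?mulr_ge0// isqrt_telescope.
  rewrite -!mulrA ler_wpM2l//.
  apply: (@le_trans _ _ (K * Num.sqrt N%:R * (N%:R ^+ 2)^-1)).
    by rewrite ler_wpM2r ?hK// invr_ge0 exprn_ge0.
  rewrite -mulrA ler_wpM2l// le_eqVlt; apply/orP; left; apply/eqP.
  have sN : Num.sqrt N%:R ^+ 2 = N%:R :> R by rewrite sqr_sqrtr.
  move: s0 sN; move: (Num.sqrt _) => s s0 sN; rewrite -sN.
  by field; rewrite gt_eqF.
have mono m n : (0 < m)%N -> (m <= n)%N -> f n + c n <= f m + c m /\ f m - c m <= f n - c n.
  move=> m0; elim: n => [|n IH]; first by rewrite leqn0 => /eqP mE; rewrite mE in m0.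
  rewrite leq_eqVlt => /orP[/eqP <- //|]; rewrite ltnS => mn.
  have [h1 h2] := IH mn; have := hc n (leq_trans m0 mn); rewrite ler_norml; lra.
have c0 N : 0 <= c N by rewrite /c !mulr_ge0 ?isqrt_ge0.
pose A := [set f N.+1 - c N.+1 | N in [set: nat]].
have ubA N : (0 < N)%N -> ubound A (f N + c N).
  move=> N0 _ [m _ <-].
  have [h1 h2] := mono N (maxn N m.+1) N0 (leq_maxl _ _).
  have [h3 h4] := mono m.+1 (maxn N m.+1) isT (leq_maxr _ _).
  by have := c0 (maxn N m.+1); lra.
have supA : has_sup A.
  by split; [exists (f 1%N - c 1%N), 0%N|exists (f 1%N + c 1%N); exact: ubA].
exists (sup A), (4 * (C * K)); split; first by rewrite !mulr_ge0.
move=> N N0; rewrite -/(c N) ler_norml.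
have h1 : sup A <= f N + c N by apply: ge_sup; [case: supA|exact: ubA].
have h2 : f N - c N <= sup A.
  by apply: ub_le_sup; [case: supA|exists N.-1; rewrite ?prednK].
by lra.
Qed.

Lemma plog_of_increments (f : nat -> R) :
  big (fun N => N%:R^-1) (fun N => f N.+1 - f N) -> plog f.
Proof.
move=> [C [d [C0 h]]]; exists (`|f 1%N| + C), d.+1; split; first exact: addr_ge0.
case=> // N _; rewrite mulr1.
have : `|f N.+1| <= `|f 1%N| + C * Lg N.+1 ^+ d * harm R N.+1.
  elim: N => [|N IH]; first by rewrite /harm big_geq// mulr0 addr0.
  rewrite -[f N.+2](subrK (f N.+1)); apply: (le_trans (ler_normD _ _)).
  apply: (le_trans (lerD (h N.+1 isT) IH)); rewrite addrCA lerD2l [in leRHS]harmS//.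
  rewrite [leRHS]mulrDr [leRHS]addrC lerD//.
    by rewrite ler_wpM2r ?invr_ge0// ler_wpM2l// Lg_exp_mono.
  by rewrite ler_wpM2r ?harm_ge0// ler_wpM2l// Lg_exp_mono.
move=> /le_trans; apply; rewrite mulrDl lerD//.
  by rewrite ler_peMr// exprn_ege1// Lg_ge1.
rewrite exprSr mulrA ler_wpM2l ?mulr_ge0//; by rewrite /Lg lerDr.
Qed.

Lemma Lg_cvg : (fun N => (Lg N)^-1) @ \oo --> (0 : R).
Proof.
apply/cvgr0Pnorm_lt => e e0; near=> N.
rewrite ger0_norm ?invr_ge0 ?ltW// invf_plt ?posrE//.
apply: (@le_lt_trans _ _ (ln (expR e^-1))); first by rewrite expRK.
apply: (@le_lt_trans _ _ (ln N%:R)).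
  rewrite ler_ln ?posrE ?expR_gt0//; last first.
    by apply: (@lt_le_trans _ _ (expR e^-1)); [exact: expR_gt0|near: N; exact: nbhs_infty_ger].
  by near: N; exact: nbhs_infty_ger.
by apply: (le_lt_trans (ln_le_harm N)); rewrite /Lg ltrDr.
Unshelve. all: by end_near.
Qed.

Lemma sml_le f : sml f -> exists2 C, 0 <= C & forall N, (0 < N)%N -> `|f N| <= C * (Lg N)^-1.
Proof.
move=> [C [d [C0 h]]]; have [K K0 hK] := Lg_le_sqrt d.+1.
exists (C * K) => [|N N0]; first exact: mulr_ge0.
apply: (le_trans (h N N0)); rewrite -!mulrA ler_wpM2l// ler_pdivrMr; last first.
  by rewrite sqrtr_gt0 ltr0n.
rewrite mulrAC ler_pdivlMr//; rewrite -exprSr; exact: hK.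
Qed.

Lemma sml_cvg0 f : sml f -> f @ \oo --> (0 : R).
Proof.
move=> /sml_le[C C0 hC]; apply/norm_cvg0P.
apply: (@squeeze_cvgr _ _ _ _ (fun=> 0) (fun N => C * (Lg N)^-1)).
- by near=> N; rewrite normr_ge0 hC//; near: N; exact: nbhs_infty_gt.
- exact: cvg_cst.
- by rewrite -[X in _ --> X](mulr0 C); apply: cvgMr; exact: Lg_cvg.
Unshelve. all: by end_near.
Qed.

Lemma sml_cst c : sml (fun=> c) -> c = 0.
Proof.
move=> /sml_cvg0 h; apply/esym.
by rewrite -(cvg_lim _ h)// (cvg_lim _ (cvg_cst c)).
Qed.

Lemma sml_rate (f : nat -> R) l C : 0 <= C ->
  (forall N, (0 < N)%N -> `|f N - l| <= C / Num.sqrt N%:R) -> sml (fun N => f N - l).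
Proof. by move=> C0 h; exists C, 0%N; split=> // N N0; rewrite expr0 mulr1 h. Qed.

Lemma sml_plog f : sml f -> plog f.
Proof.
apply: big_le => // N N0; rewrite invf_le1 ?sqrtr_gt0 ?ltr0n//.
by rewrite -[leLHS]sqrtr1 ler_sqrt ?ltr0n// ler1n.
Qed.

End Asymptotics.
#[global] Hint Resolve Lg_ge1 : core.

Lemma ws_coefM_recr (T : Type) (A : pzRingType) (F G : word_series T A) w :
  (F * G) w = \sum_(i < size w) F (take i w) * G (drop i w) + F w * G [::].
Proof. by rewrite ws_coefM big_ord_recr /= take_size drop_size. Qed.

Lemma ws_coef_letter (T : Type) (A : pzRingType) (F G : word_series T A) a :
  (F * G) [:: a] = F [::] * G [:: a] + F [:: a] * G [::].
Proof. by rewrite ws_coefM -convE /= addr0. Qed.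

Lemma sml_cvg (R : realType) (f : nat -> R) l : sml (fun N => f N - l) -> f @ \oo --> l.
Proof.
move=> /sml_cvg0 h; rewrite (_ : f = fun N => (f N - l) + l); last first.
  by apply/funext => N; rewrite subrK.
by rewrite -[X in _ --> X]add0r; apply: cvgD => //; exact: cvg_cst.
Qed.

(** * Growth and limits of the coefficients of word series *)

Section WordAsymptotics.
Variable R : realType.
Notation ps := (power_series R).
Notation ws := (word_series nat ps).

Lemma is_index_take i w : is_index w -> is_index (take i w).
Proof. by rewrite -{1}(cat_take_drop i w) /is_index all_cat => /andP[]. Qed.

Lemma is_index_drop i w : is_index w -> is_index (drop i w).
Proof. by rewrite -{1}(cat_take_drop i w) /is_index all_cat => /andP[]. Qed.

Lemma is_index_rev w : is_index (rev w) = is_index w.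
Proof. exact: all_rev. Qed.

Lemma size_le_sumn w : is_index w -> (size w <= sumn w)%N.
Proof.
elim: w => [|a w IH] //= /andP[a0 /IH]; move: a0; rewrite /is_index /=; lia.
Qed.

(** Divisibility of the value at [w] by t to the weight of [w]. It holds for E_m with m nonzero and
    fails for E_0. *)
Definition vanish (F : ws) := forall w b, (b < sumn w)%N -> F w b = 0.

Lemma vanishM F G : vanish F -> vanish G -> vanish (F * G).
Proof.
move=> vF vG w b bw; rewrite ws_coefM ps_coef_sum big1// => i _.
rewrite ps_coefM big1// => j _.
have := sumn_cat (take i w) (drop i w); rewrite cat_take_drop => sE.
have [jt|tj] := ltnP j (sumn (take i w)); first by rewrite vF// mul0r.
by rewrite vG ?mulr0//; have := ltn_ord j; lia.
Qed.

Lemma vanish1 : vanish 1.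
Proof. by move=> [|a w] b //; rewrite ws_coef1 ps_coef0. Qed.

Lemma vanish_expo m : m != 0 -> vanish (expo R m).
Proof. by move=> m0 w b bw; rewrite expoE ps_cstM tau_low// mulr0. Qed.

Lemma vanish_xe h : vanish (xe h).
Proof.
move=> w b; rewrite xeE; case: ifPn => [/all_pred1P wE|_ _]; last by rewrite ps_coef0.
rewrite [in sumn w]wE sumn_nseq mul1n => bw.
by rewrite ps_cstM -[psX ^+ _]mulr1 psXnM leqNgt bw mulr0.
Qed.

Lemma vanish_posp N : vanish (posp R N).
Proof.
rewrite /posp big_seq; apply: (big_ind vanish); [exact: vanish1|exact: vanishM|].
by move=> m; rewrite mem_iota => /andP[m0 _]; apply: vanish_expo; lia.
Qed.

Lemma vanish_ren N : vanish (ren R N).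
Proof. by apply: vanishM; [exact: vanish_posp|exact: vanish_xe]. Qed.

(** The leading coefficients, multiplicative on series satisfying [vanish]. For E_m with m nonzero
    they are m to the minus weight over n!, so they give back the sums without t. *)
Definition topw (F : ws) : word_series nat R := WS (fun w => F w (sumn w)).

Lemma topwM F G : vanish F -> vanish G -> topw (F * G) = topw F * topw G.
Proof.
move=> vF vG; apply: wsP => w; rewrite ws_coefM /= ws_coefM ps_coef_sum.
apply: eq_bigr => i _; have := sumn_cat (take i w) (drop i w); rewrite cat_take_drop => sE.
have tw : (sumn (take i w) < (sumn w).+1)%N by lia.
rewrite ps_coefM (bigD1 (Ordinal tw)) //= [X in _ + X]big1 ?addr0; last first.
  move=> j /eqP jt; have [lt|] := ltnP j (sumn (take i w)); first by rewrite vF// mul0r.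
  rewrite leq_eqVlt => /orP[/eqP e|gt]; first by case: jt; exact/val_inj.
  by rewrite vG ?mulr0//; have := ltn_ord j; lia.
by congr (_ * G _ _); lia.
Qed.

Lemma topw_expo m : m != 0 -> topw (expo R m) = wexp (@ifact R) (fun a : nat => (m%:~R : R)^-1 ^+ a).
Proof.
move=> m0; apply: wsP => w; rewrite /= ps_cstM; congr (_ * _).
rewrite tau_dil//; under eq_bigr do rewrite -rmorphXn /=.
rewrite -rmorph_prod /=.
have -> : (\prod_(i <- w) tau R 1 ^+ i) = tau R 1 ^+ sumn w.
  by elim: w => [|a w IH]; rewrite ?big_nil// big_cons IH -exprD.
have -> : (tau R 1 ^+ sumn w) (sumn w) = 1.
  have -> : tau R 1 = psX * PS (fun n => (-1) ^+ n).
    by apply: psP => j; rewrite psXM /tau /=; case: j => // j; rewrite invr1 expr1n mulr1.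
  rewrite exprMn psXnM leqnn subnn.
  elim: (sumn w) => [|j IH]; first by rewrite expr0.
  by rewrite exprS ps_coefM big_ord1 IH /= mulr1.
rewrite mulr1; elim: w => [|a w IH]; rewrite ?big_nil// big_cons -IH -exprD //.
Qed.

Lemma natF_trunc_posp k M : zeta_natF_trunc R k M = (posp R M * negp R M) k (sumn k).
Proof.
rewrite zeta_natF_truncE -[RHS]/(topw (posp R M * negp R M) k); congr (wcoef _ k).
have -> : posp R M * negp R M = \prod_(c <- cyc M) expo R c.
  by rewrite /posp /negp /cyc big_cat !big_map.
have : all (fun c => c != 0) (cyc M).
  by apply/allP => c; rewrite mem_cyc => /andP[c0 _]; rewrite -normr_gt0.
elim: (cyc M) => [|c r IH] /=.
  by move=> _; rewrite !big_nil; apply: wsP => -[|a w] //=; rewrite ?if_same.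
move=> /andP[c0 hr]; rewrite !big_cons IH// topwM ?topw_expo//; first exact: vanish_expo.
elim: r hr {IH} => [|c' r IH]; first by rewrite big_nil => _; exact: vanish1.
by move=> /= /andP[c0' hr]; rewrite big_cons; apply: vanishM; [exact: vanish_expo|exact: IH].
Qed.

Section Wbig.
Variables (T : Type) (P : T -> Prop) (l : T -> R).
Hypothesis l1 : forall x, 1 <= l x.

Definition gwbig (e : T -> R) (F : T -> ws) :=
  forall w b, is_index w -> gbig P l e (fun x => F x w b).

Lemma wbigM e e' F G : (forall x, 0 <= e x) -> (forall x, 0 <= e' x) ->
  gwbig e F -> gwbig e' G -> gwbig (fun x => e x * e' x) (fun x => F x * G x).
Proof.
move=> e0 e0' hF hG w b iw.
apply: (eq_big_asy (f := fun x => \sum_(i < (size w).+1) \sum_(j < b.+1)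
    F x (take i w) j * G x (drop i w) (b - j)%N)).
  by move=> N _; rewrite ws_coefM ps_coef_sum; apply: eq_bigr => i _; rewrite ps_coefM.
have ee N : 0 <= e N * e' N by rewrite mulr_ge0.
apply: big_sumf => // i _; apply: big_sumf => // j _.
by apply: bigM; [apply: hF; exact: is_index_take|apply: hG; exact: is_index_drop].
Qed.

Lemma wbig_eq e e' F : (forall x, e x = e' x) -> gwbig e F -> gwbig e' F.
Proof. by move=> ee hF w b iw; apply: big_le (hF w b iw) => // N _; rewrite ee. Qed.

Lemma wplogM e F G : (forall x, 0 <= e x) -> gwbig (fun=> 1) F -> gwbig e G ->
  gwbig e (fun x => F x * G x).
Proof. by move=> e0 hF hG; apply: wbig_eq (wbigM _ e0 hF hG) => // N; rewrite mul1r. Qed.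

Lemma wplogMr e F G : (forall x, 0 <= e x) -> gwbig e F -> gwbig (fun=> 1) G ->
  gwbig e (fun x => F x * G x).
Proof. by move=> e0 hF hG; apply: wbig_eq (wbigM e0 _ hF hG) => // N; rewrite mulr1. Qed.

Lemma wplog_cst (L : ws) : gwbig (fun=> 1) (fun=> L).
Proof. by move=> w b _; exact: plog_cst. Qed.

Lemma gwplog_xe (h : T -> R) : gbig P l (fun=> 1) h -> gwbig (fun=> 1) (fun x => xe (h x)).
Proof.
move=> ph w b _.
apply: (eq_big_asy (f := fun x => (if all (pred1 1%N) w then ifact R (size w) * (psX ^+ size w : ps) b else 0) * h x ^+ size w)).
  move=> N _; rewrite xeE; case: ifP => _; last by rewrite mul0r ps_coef0.
  by rewrite ps_cstM; ring.
by apply: bigZ => //; exact: plogX.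
Qed.

End Wbig.

Definition wbig := gwbig (fun N => 0 < N)%N (Lg R).
Notation wplog := (wbig (fun=> 1)).

Lemma wplog_xe (h : nat -> R) : plog h -> wplog (fun N => xe (h N)).
Proof. exact: gwplog_xe. Qed.

Lemma expo_coef N w b : (0 < N)%N -> expo R N%:Z w b = N%:R^-1 ^+ b * expo R 1 w b.
Proof. by move=> N0; rewrite (@dil_expo R N%:Z)//; lia. Qed.

Lemma expo_nil m : expo R m [::] = 1.
Proof. by rewrite expoE /= expr0 mulr1 /fps /ifact fact0 invr1 rmorph1. Qed.

Lemma posp_nil N : posp R N [::] = 1.
Proof.
rewrite /posp; elim: (iota _ _) => [|m r IH]; first by rewrite big_nil.
by rewrite big_cons ws_coef_nil expo_nil IH mulr1.
Qed.

Lemma xe_nil (h : R) : xe h [::] = 1.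
Proof. by rewrite xeE /= !expr0 mulr1 /ifact fact0 invr1 mulr1 rmorph1. Qed.

(** Induction on the length: the increment from N to N + 1 pairs shorter prefixes with E_N on a
    nonempty suffix. As its letters are positive, that suffix has no constant term in t and
    contributes O(1/N). *)
Lemma wplog_posp : wplog (posp R).
Proof.
move=> w; move: {2}(size w) (leqnn (size w)) => n.
elim: n w => [|n IH] w sw b iw.
  case: w sw iw => // _ _; apply: (eq_big_asy (f := fun=> (1 : ps) b)); last exact: plog_cst.
  by move=> N _; rewrite posp_nil.
apply: plog_of_increments.
apply: (eq_big_asy (f := fun N => \sum_(i < size w) \sum_(j < b.+1)
    posp R N (take i w) j * expo R N%:Z (drop i w) (b - j)%N)).
  move=> N N0; rewrite pospS// ws_coefM_recr.
  rewrite expo_nil mulr1 ps_coefD addrK.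
  by rewrite ps_coef_sum; apply: eq_bigr => i _; rewrite ps_coefM.
have e0 N : 0 <= N%:R^-1 :> R by rewrite invr_ge0.
apply: big_sumf => // i _; apply: big_sumf => // j _; apply: plogM => //.
  apply: IH; last exact: is_index_take.
  by rewrite size_takel; have := ltn_ord i; lia.
apply: (eq_big_asy (f := fun N => expo R 1 (drop i w) (b - j)%N * N%:R^-1 ^+ (b - j))).
  by move=> N N0; rewrite expo_coef// mulrC.
have [bj0|] := eqVneq (b - j)%N 0%N.
  apply: (eq_big_asy (f := fun=> 0)); last exact: big0.
  move=> N _; rewrite vanish_expo ?mul0r// bj0.
  apply: leq_trans (size_le_sumn (is_index_drop i iw)).
  by rewrite size_drop subn_gt0.
rewrite -lt0n; case: (b - j)%N => // c _.
apply: bigZ => //; exists 1, 0%N; split=> // N N0; rewrite expr0 !mul1r.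
rewrite ger0_norm ?exprn_ge0// exprS ler_piMr// exprn_ile1// invf_le1 ?ltr0n//.
by rewrite ler1n.
Qed.

(** Up to degree 1 only the empty word and the word (1) matter: on the first all factors are 1, on
    the second t from E_1 cancels - t from the exponential. *)
Lemma ddef_low w b : is_index w -> (b <= 1)%N -> ddef R w b = 0.
Proof.
move=> iw b1; rewrite /ddef; case: w iw => [|a w] iw.
  rewrite ws_coefB ws_coef_nil expo_nil xe_nil mulr1.
  by rewrite ps_coefD ps_coefN subrr.
rewrite ws_coefB ws_coef1 subr0.
have [bw|wb] := ltnP b (sumn (a :: w)).
  by apply: vanishM => //; [exact: vanish_expo|exact: vanish_xe].
have sz := size_le_sumn iw; have := iw; rewrite /= => /andP[a0 iw'].
have w0 : w = [::].
  by case: w iw iw' wb sz => // a' w _ /andP[a'0 _] /=; lia.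
subst w; have a1 : a = 1%N by move: wb; rewrite /=; lia.
have bE : b = 1%N by move: wb; rewrite /=; lia.
rewrite a1 bE ws_coef_letter expo_nil xe_nil mul1r mulr1 expoE xeE.
rewrite ps_coefD !ps_cstM /ifact !factS fact0 !muln1 !invr1 !mul1r.
by rewrite [sumn _]/= [size _]/= !expr1 /tau /= expr0 invr1 !mul1r mulr1 addrC subrr.
Qed.

Lemma wbig_ddef : wbig (fun N => (N%:R ^+ 2)^-1) (fun N => wmap (ps_dil N%:R^-1) (ddef R)).
Proof.
move=> w b iw.
have cE N j : wmap (ps_dil N%:R^-1) (ddef R) w j = N%:R^-1 ^+ j * ddef R w j by [].
have e0 N : 0 <= (N%:R ^+ 2)^-1 :> R by rewrite invr_ge0 exprn_ge0.
case: b => [|[|b]].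
- by apply: (eq_big_asy (f := fun=> 0)); [move=> N _; rewrite cE ddef_low ?mulr0|exact: big0].
- by apply: (eq_big_asy (f := fun=> 0)); [move=> N _; rewrite cE ddef_low ?mulr0|exact: big0].
apply: (eq_big_asy (f := fun N => ddef R w b.+2 * N%:R^-1 ^+ b.+2)).
  by move=> N _; rewrite cE mulrC.
apply: bigZ => //; exists 1, 0%N; split=> // N N0; rewrite expr0 !mul1r.
rewrite ger0_norm ?exprn_ge0 ?invr_ge0// !exprS expr0 mulr1 invfM mulrA.
rewrite ler_piMr ?mulr_ge0 ?invr_ge0// exprn_ile1 ?invr_ge0// invf_le1 ?ltr0n//.
by rewrite ler1n.
Qed.

Lemma ren_cvg w b : is_index w ->
  exists l C, 0 <= C /\ forall N, (0 < N)%N -> `|ren R N w b - l| <= C / Num.sqrt N%:R.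
Proof.
move=> iw; apply: cvg_of_increments.
have e0 N : 0 <= (N%:R ^+ 2)^-1 :> R by rewrite invr_ge0 exprn_ge0.
apply: (eq_big_asy (f := fun N =>
  (posp R N * wmap (ps_dil N%:R^-1) (ddef R) * xe (- harm R N)) w b)).
  by move=> N N0; rewrite -ren_incr.
move: w b iw; apply: wplogMr => //; last first.
  by apply: wplog_xe; apply: bigN; exact: plog_harm.
by apply: wplogM => //; [exact: wplog_posp|exact: wbig_ddef].
Qed.

Definition Sreg : ws := WS (fun w => PS (fun b => limn (fun N => ren R N w b))).

Lemma ren_rate w b : is_index w ->
  exists2 C, 0 <= C & forall N, (0 < N)%N -> `|ren R N w b - Sreg w b| <= C / Num.sqrt N%:R.
Proof.
move=> /(ren_cvg b)[l [C [C0 h]]]; exists C => //.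
suff -> : Sreg w b = l by [].
apply: cvg_lim => //.
by apply: sml_cvg; exact: sml_rate h.
Qed.

Definition wlim (F : nat -> ws) (L : ws) :=
  wbig (fun N => (Num.sqrt N%:R)^-1) (fun N => F N - L).

Lemma wlim_ren : wlim (ren R) Sreg.
Proof.
move=> w b /(ren_rate b)[C C0 h]; exists C, 0%N; split=> // N N0.
by rewrite expr0 mulr1 ws_coefB ps_coefD ps_coefN h.
Qed.

Lemma wlim_plog F L : wlim F L -> wplog F.
Proof.
move=> h w b iw; apply: (eq_big_asy (f := fun N => (F N - L) w b + L w b)).
  by move=> N _; rewrite ws_coefB ps_coefD ps_coefN subrK.
by apply: bigD => //; [apply: sml_plog; exact: h|exact: plog_cst].
Qed.

Lemma wlim_cst L : wlim (fun=> L) L.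
Proof.
move=> w b _; apply: (eq_big_asy (f := fun=> 0)); last by apply: big0 => N; exact: isqrt_ge0.
by move=> N _; rewrite subrr ps_coef0.
Qed.

Lemma wlimM F G L L' : wlim F L -> wlim G L' -> wlim (fun N => F N * G N) (L * L').
Proof.
move=> hF hG w b iw.
apply: (eq_big_asy (f := fun N => ((F N - L) * G N) w b + (L * (G N - L')) w b)).
  move=> N _; rewrite -ps_coefD -ws_coefD; congr (coefs (wcoef _ _) _).
  by rewrite mulrBl mulrBr addrA subrK.
have e0 := @isqrt_ge0 R.
apply: bigD => //.
  by move: w b iw; apply: wplogMr => //; exact: wlim_plog hG.
move: w b iw; apply: wplogM => //.
by move=> w b _; exact: plog_cst.
Qed.

Lemma wlim_theta_rev F L : wlim F L ->
  wlim (fun N => wmap (ps_dil (-1)) (wrev (F N))) (wmap (ps_dil (-1)) (wrev L)).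
Proof.
move=> h w b iw; apply: (eq_big_asy (f := fun N => (-1) ^+ b * (F N - L) (rev w) b)).
  by move=> N _; rewrite !ws_coefB !ps_coefD !ps_coefN mulrBr.
by apply: bigZ => //; apply: h; rewrite is_index_rev.
Qed.

Lemma wlim_sgn_rev F L : wlim F L -> wlim (fun N => wsgn (wrev (F N))) (wsgn (wrev L)).
Proof.
move=> h w b iw; apply: (eq_big_asy (f := fun N => (-1) ^+ size w * (F N - L) (rev w) b)).
  move=> N _; rewrite !ws_coefB !ps_coefD !ps_coefN mulrBr.
  by rewrite /= -(rmorph1 (@ps_cst R)) -rmorphN -rmorphXn !ps_cstM.
by apply: bigZ => //; apply: h; rewrite is_index_rev.
Qed.

Lemma wlim_cvg F L w b : is_index w -> wlim F L -> (fun N => F N w b) @ \oo --> L w b.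
Proof.
by move=> iw h; apply: sml_cvg; apply: eq_big_asy (h w b iw) => N _; rewrite ws_coefB.
Qed.

Lemma wlim_uniq F L L' w b : is_index w -> wlim F L -> wlim F L' -> L w b = L' w b.
Proof.
move=> iw h h'; rewrite -(cvg_lim _ (wlim_cvg (b := b) iw h))//.
by rewrite -(cvg_lim _ (wlim_cvg (b := b) iw h')).
Qed.

Definition Sneg : ws := wmap (ps_dil (-1)) (wrev Sreg).

Lemma wlim_renneg : wlim (renneg R) Sneg.
Proof.
rewrite (_ : renneg R = fun N => wmap (ps_dil (-1)) (wrev (ren R N))).
  by apply: wlim_theta_rev; exact: wlim_ren.
by apply/funext => N; rewrite rennegE.
Qed.

Lemma Sreg_antipode w b : is_index w -> (Sreg * wsgn (wrev Sreg)) w b = (1 : ws) w b.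
Proof.
move=> iw; apply: (@wlim_uniq (fun N => ren R N * wsgn (wrev (ren R N)))) => //.
  by apply: wlimM; [exact: wlim_ren|apply: wlim_sgn_rev; exact: wlim_ren].
rewrite (_ : (fun _ => _) = fun=> 1); first exact: wlim_cst.
by apply/funext => N; rewrite ren_antipode.
Qed.

Lemma zeta_natFE k : is_index k -> zeta_natF R k = (Sreg * Sneg) k (sumn k).
Proof.
move=> ik; apply: cvg_lim => //.
rewrite (_ : zeta_natF_trunc R k = fun N => (ren R N * renneg R N) k (sumn k)).
  by apply: wlim_cvg => //; apply: wlimM; [exact: wlim_ren|exact: wlim_renneg].
by apply/funext => N; rewrite natF_trunc_posp posp_negp.
Qed.

Lemma vanish_Sreg w b : is_index w -> (b < sumn w)%N -> Sreg w b = 0.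
Proof.
move=> iw bw; apply: cvg_lim => //.
rewrite (_ : (fun N => _) = fun=> 0); first exact: cvg_cst.
by apply/funext => N; rewrite vanish_ren.
Qed.

Lemma Sreg_nil b : Sreg [::] b = (1 : ps) b.
Proof.
apply: cvg_lim => //; rewrite (_ : (fun N => _) = fun=> (1 : ps) b); first exact: cvg_cst.
by apply/funext => N; rewrite /ren ws_coef_nil posp_nil xe_nil mulr1.
Qed.

End WordAsymptotics.

(** * Multitangent functions *)

Section Sums.
Variable R : realType.

Lemma harm_diff m n : (0 < m)%N -> (m <= n)%N ->
  harm R n - harm R m <= (n - m)%:R / m%:R.
Proof.
move=> m0; elim: n => [|n IH]; first by rewrite leqn0 => /eqP mE; rewrite mE in m0.
rewrite leq_eqVlt => /orP[/eqP <-|]; first by rewrite subrr subnn mul0r.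
rewrite ltnS => mn; rewrite harmS ?(leq_trans m0)// subSn// -natr1 mulrDl mul1r.
rewrite addrAC lerD ?IH// lef_pV2 ?posrE ?ltr0n ?(leq_trans m0)//.
by rewrite ler_nat.
Qed.

Lemma Lg_double M : (0 < M)%N -> Lg R M.*2 <= 2 * Lg R M.
Proof.
move=> M0; have := harm_diff M0 (leq_addl M M); rewrite addnn -addnn addnK divff ?pnatr_eq0 -?lt0n//.
by have := Lg_ge1 R M; rewrite /Lg addnn; lra.
Qed.

Lemma big_cyc (V : nmodType) M (f : int -> V) :
  \sum_(p <- cyc M) f p = \sum_(1 <= m < M) (f m%:Z + f (- m%:Z)).
Proof.
rewrite /cyc big_cat !big_map /= big_split /=; congr (_ + _).
  by rewrite /index_iota subn1.
by rewrite [RHS](perm_big (rev (iota 1 M.-1))) //= /index_iota subn1 perm_sym perm_rev.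
Qed.

Lemma sum_isqrt M : \sum_(1 <= q < M) (Num.sqrt q%:R)^-1 <= 3 * Num.sqrt M%:R :> R.
Proof.
elim: M => [|M IH]; first by rewrite big_geq// sqrtr0 mulr0.
have [->|M0] := posnP M; first by rewrite big_geq// mulr_ge0.
rewrite big_nat_recr//=.
have M1 : (1 : R) <= M%:R by rewrite ler1n.
suff h : (Num.sqrt M%:R)^-1 <= 3 * (Num.sqrt M.+1%:R - Num.sqrt M%:R) :> R.
  by move: IH h; lra.
set a := Num.sqrt M%:R; set b := Num.sqrt M.+1%:R.
have a2 : a ^+ 2 = M%:R by rewrite sqr_sqrtr// ler0n.
have b2 : b ^+ 2 = M%:R + 1 by rewrite sqr_sqrtr ?ler0n// natr1.
have a1 : 1 <= a by rewrite -[leLHS]sqrtr1 ler_sqrt// ltr0n.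
have ab : a <= b by rewrite ler_sqrt ?ltr0n// ler_nat.
have b2a : b <= 3 / 2 * a.
  rewrite -(ler_pXn2r (n := 2))// ?nnegrE; [|by lra|by lra].
  by rewrite exprMn a2 b2; lra.
rewrite -[leLHS]mul1r ler_pdivrMr; last by lra.
have h1 : (b - a) * (b + a) = 1 by rewrite -subr_sqr a2 b2; ring.
have h2 : (b - a) * (b + a) <= (b - a) * (5 / 2 * a) by rewrite ler_wpM2l//; lra.
have h3 : 0 <= (b - a) * a by rewrite mulr_ge0//; lra.
by move: h2; rewrite h1; lra.
Qed.

Lemma sum_isqrt_rev M : \sum_(1 <= m < M) (Num.sqrt (M - m)%:R)^-1 <= 3 * Num.sqrt M%:R :> R.
Proof.
apply: le_trans (sum_isqrt M); rewrite big_nat_rev /= le_eqVlt; apply/orP; left; apply/eqP.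
by rewrite !big_nat; apply: eq_bigr => m /andP[m0 mM]; congr (Num.sqrt _%:R)^-1; lia.
Qed.

(* [1 / (m sqrt (M - m)) = (1 / M) (1 / sqrt (M - m) + sqrt (M - m) / m)] *)
Lemma sum_inv_isqrt M : (0 < M)%N ->
  \sum_(1 <= m < M) (m%:R * Num.sqrt (M - m)%:R)^-1 <= 4 * Lg R M / Num.sqrt M%:R :> R.
Proof.
move=> M0; have M1 : (0 : R) < M%:R by rewrite ltr0n.
have s0 : 0 < Num.sqrt M%:R :> R by rewrite sqrtr_gt0.
have sM : Num.sqrt M%:R ^+ 2 = M%:R :> R by rewrite sqr_sqrtr// ltW.
apply: (@le_trans _ _ (M%:R^-1 * (\sum_(1 <= m < M) (Num.sqrt (M - m)%:R)^-1 +
    \sum_(1 <= m < M) Num.sqrt M%:R * m%:R^-1))).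
  rewrite -big_split mulr_sumr /= !big_nat; apply: ler_sum => m /andP[m0 mM].
  have mR : (0 : R) < m%:R by rewrite ltr0n.
  have qR : (0 : R) < (M - m)%:R by rewrite ltr0n subn_gt0.
  have q0 : 0 < Num.sqrt (M - m)%:R :> R by rewrite sqrtr_gt0.
  have qs : Num.sqrt (M - m)%:R ^+ 2 = (M - m)%:R :> R by rewrite sqr_sqrtr// ltW.
  have ME : M%:R = m%:R + Num.sqrt (M - m)%:R ^+ 2 :> R by rewrite qs -natrD subnKC// ltnW.
  have qM : Num.sqrt (M - m)%:R <= Num.sqrt M%:R :> R.
    by rewrite ler_sqrt ?ler_nat ?leq_subr// ltW.
  apply: (@le_trans _ _ (M%:R^-1 * ((Num.sqrt (M - m)%:R)^-1 + Num.sqrt (M - m)%:R * m%:R^-1))).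
    move: q0 ME M1; move: (Num.sqrt (M - m)%:R) (M%:R) => q N q0 ME N0.
    rewrite le_eqVlt; apply/orP; left; apply/eqP; rewrite ME.
    by field; rewrite -ME !gt_eqF.
  by rewrite ler_wpM2l ?invr_ge0 ?ler0n// lerD2l ler_wpM2r ?invr_ge0 ?ler0n.
rewrite -mulr_sumr -/(harm R M).
have h := sum_isqrt_rev M; set S := \sum_(1 <= m < M) _ in h *.
move: s0 sM h; move: (Num.sqrt M%:R) => s s0 sM h; rewrite -sM.
have -> : 4 * Lg R M / s = (s ^+ 2)^-1 * (4 * (s * Lg R M)) by field; rewrite gt_eqF.
rewrite ler_wpM2l ?invr_ge0 ?sqr_ge0//.
have h2 : 0 <= s * harm R M by rewrite mulr_ge0 ?harm_ge0// ltW.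
by rewrite /Lg; lra.
Qed.

End Sums.

Section Multitangent.
Variable R : realType.
Notation ps := (power_series R).
Notation ws := (word_series nat ps).

Definition allones (w : seq nat) : bool := all (pred1 1%N) w.

Lemma allones_split i w : ~~ allones w -> allones (drop i w) -> ~~ allones (take i w).
Proof.
move=> nw dw; apply: contra nw => tw.
by rewrite /allones -(cat_take_drop i w) all_cat; apply/andP; split.
Qed.

Lemma allones_sumn w : allones w -> sumn w = size w.
Proof. by move=> /all_pred1P {1}->; rewrite sumn_nseq mul1n. Qed.

Lemma not_allones_sumn w : is_index w -> ~~ allones w -> (1 < sumn w)%N.
Proof.
elim: w => [|a w IH] //= /andP[a0 iw]; rewrite negb_and => /orP[a1|nw].
  by move: a0 a1; rewrite /=; lia.
by have := IH iw nw; lia.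
Qed.

(* A pair [x = (M, p)] stands for the germ at the integer [p] of a multitangent function truncated at
   [M]; the half products on the two sides of [p] have [n1 x] and [n2 x] factors, up to one, and
   [er x], in terms of the distance [qd x] of [p] to the boundary, is the resulting error. *)
Definition dom (x : nat * int) : Prop := (0 < x.1)%N /\ `|x.2| < x.1%:Z.
Definition n1 (x : nat * int) : nat := absz (x.1%:Z + x.2).
Definition n2 (x : nat * int) : nat := absz (x.1%:Z - x.2).
Definition qd (x : nat * int) : nat := (x.1 - absz x.2)%N.
Definition ll (x : nat * int) : R := Lg R x.1.*2.
Definition er (x : nat * int) : R := (Num.sqrt (qd x)%:R)^-1.

Lemma ll1 x : 1 <= ll x. Proof. exact: Lg_ge1. Qed.
Lemma er_ge0 x : 0 <= er x. Proof. exact: isqrt_ge0. Qed.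
Hint Resolve ll1 er_ge0 : core.

Notation gb := (gbig dom ll).
Notation gwb := (gwbig dom ll).

Lemma dom_n1 x : dom x -> [/\ (0 < n1 x)%N, (n1 x <= x.1.*2)%N & (qd x <= n1 x)%N].
Proof. by case: x => M p [/= M0 pM]; rewrite /n1 /qd /=; split; lia. Qed.

Lemma dom_n2 x : dom x -> [/\ (0 < n2 x)%N, (n2 x <= x.1.*2)%N & (qd x <= n2 x)%N].
Proof. by case: x => M p [/= M0 pM]; rewrite /n2 /qd /=; split; lia. Qed.

Lemma dom_qd x : dom x -> (0 < qd x)%N.
Proof. by case: x => M p [/= M0 pM]; rewrite /qd /=; lia. Qed.

Section Transfer.
Variable n : nat * int -> nat.
Hypothesis hn : forall x, dom x -> [/\ (0 < n x)%N, (n x <= x.1.*2)%N & (qd x <= n x)%N].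

Lemma gb_plog f : plog f -> gb (fun=> 1) (f \o n).
Proof.
move=> [C [d [C0 h]]]; exists C, d; split=> // x /hn[n0 nM _].
by apply: (le_trans (h _ n0)); rewrite !mulr1 ler_wpM2l// Lg_exp_mono.
Qed.

Lemma gb_sml f : sml f -> gb er (f \o n).
Proof.
move=> [C [d [C0 h]]]; exists C, d; split=> // x dx; have [n0 nM qn] := hn dx.
have q0 := dom_qd dx.
apply: (le_trans (h _ n0)); apply: ler_pM; rewrite ?mulr_ge0 ?isqrt_ge0 ?Lg_exp_ge0//.
  by rewrite ler_wpM2l// Lg_exp_mono.
by rewrite lef_pV2 ?posrE ?sqrtr_gt0 ?ltr0n// ler_sqrt ?ltr0n// ler_nat.
Qed.

Lemma gwb_plog F : wbig (fun=> 1) F -> gwb (fun=> 1) (F \o n).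
Proof. by move=> h w b iw; exact: gb_plog (h w b iw). Qed.

Lemma gwb_lim F L : wlim F L -> gwb er (fun x => F (n x) - L).
Proof. by move=> h w b iw; exact: gb_sml (h w b iw). Qed.

End Transfer.

Lemma gwb_D (e : nat * int -> R) F G : (forall x, 0 <= e x) -> gwb e F -> gwb e G -> gwb e (fun x => F x + G x).
Proof.
move=> e0 hF hG w b iw; apply: (eq_big_asy (f := fun x => F x w b + G x w b)) => //.
by apply: bigD => //; [exact: hF|exact: hG].
Qed.

Definition Psi : ws := Sneg R * expo R 0 * Sreg R.
Definition Vw x : ws := renneg R (n1 x) * expo R 0 * ren R (n2 x).

Lemma Vw_lim : gwb er (fun x => Vw x - Psi).
Proof.
have h1 := gwb_lim dom_n1 (@wlim_renneg R).
have h2 := gwb_lim dom_n2 (@wlim_ren R).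
have p2 : gwb (fun=> 1) (fun x => ren R (n2 x)).
  by apply: (gwb_plog dom_n2); exact: wlim_plog (@wlim_ren R).
have -> : (fun x => Vw x - Psi) = (fun x =>
    (renneg R (n1 x) - Sneg R) * (expo R 0 * ren R (n2 x)) +
    (Sneg R * expo R 0) * (ren R (n2 x) - Sreg R)).
  apply/funext => x; rewrite /Vw /Psi mulrBl mulrBr !mulrA.
  by rewrite addrA subrK.
apply: gwb_D => //.
  apply: wplogMr => //; apply: wplogM => //; exact: wplog_cst.
by apply: wplogM => //; exact: wplog_cst.
Qed.

Lemma Vw_plog : gwb (fun=> 1) Vw.
Proof.
apply: wplogM => //; last first.
  by apply: (gwb_plog dom_n2); exact: wlim_plog (@wlim_ren R).
apply: wplogM => //; last exact: wplog_cst.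
by apply: (gwb_plog dom_n1); exact: wlim_plog (@wlim_renneg R).
Qed.

Section Strip.
Variables (e : nat * int -> R) (h : nat * int -> R) (n : nat).
Hypothesis e0 : forall x, 0 <= e x.
Hypothesis ph : gb (fun=> 1) h.

Lemma xe_split (F : ws) a w b : (F * xe a) w b =
  \sum_(i < size w) (if allones (drop i w) then
     ifact R (size w - i) * a ^+ (size w - i) *
     (if (size w - i <= b)%N then F (take i w) (b - (size w - i))%N else 0) else 0) + F w b.
Proof.
rewrite ws_coefM_recr xe_nil mulr1 ps_coefD ps_coef_sum; congr (_ + _).
apply: eq_bigr => i _; rewrite xeE -/(allones _) size_drop; case: ifP => _; last by rewrite mulr0 ps_coef0.
by rewrite mulrCA ps_cstM; congr (_ * _); rewrite mulrC psXnM.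
Qed.

(** A factor exp(h t e_1) only sees suffixes of ones. Cutting off r ones lowers the weight and the
    power of t by r each, so the coefficient just below the weight is changed by the same
    coefficients of shorter words, small by hypothesis, times powers of the logarithm. At this
    coefficient the divergent exponentials can thus be discarded. *)
Lemma strip_right (F : nat * int -> ws) :
  (forall w, is_index w -> ~~ allones w -> (size w < n)%N ->
     gb e (fun x => F x w (sumn w).-1)) ->
  forall w, is_index w -> ~~ allones w -> (size w <= n)%N ->
  gb e (fun x => (F x * xe (h x)) w (sumn w).-1 - F x w (sumn w).-1).
Proof.
move=> hF w iw nw sw.
apply: (eq_big_asy (f := fun x => \sum_(i < size w) (if allones (drop i w) then
     (ifact R (size w - i) * h x ^+ (size w - i)) * F x (take i w) (sumn (take i w)).-1 else 0))).
  move=> x _; rewrite xe_split addrK; apply: eq_bigr => i _; case: ifPn => // od.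
  have := sumn_cat (take i w) (drop i w); rewrite cat_take_drop (allones_sumn od) size_drop => sE.
  have := not_allones_sumn (is_index_take i iw) (allones_split nw od) => t1.
  by rewrite ifT; [congr (_ * F x _ _)|]; lia.
apply: big_sumf => // i _; case: (boolP (allones (drop i w))) => od; last exact: big0.
apply: plogM => //; first by apply: bigZ => //; exact: plogX.
apply: hF; [exact: is_index_take|exact: allones_split|].
by rewrite size_takel; have := ltn_ord i; lia.
Qed.

Lemma strip_left (F : nat * int -> ws) :
  (forall w, is_index w -> ~~ allones w -> (size w < n)%N ->
     gb e (fun x => F x w (sumn w).-1)) ->
  forall w, is_index w -> ~~ allones w -> (size w <= n)%N ->
  gb e (fun x => (xe (h x) * F x) w (sumn w).-1 - F x w (sumn w).-1).
Proof.
move=> hF w iw nw sw.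
have hr w' : allones (rev w') = allones w' by exact: all_rev.
apply: (eq_big_asy (f := fun x => (wrev (F x) * xe (h x)) (rev w) (sumn (rev w)).-1 -
    wrev (F x) (rev w) (sumn (rev w)).-1)).
  move=> x _; rewrite sumn_rev; congr (_ - _); last by rewrite /= revK.
  by rewrite -[RHS](congr1 (fun G : ws => G w _) (wrevK (xe (h x) * F x))) wrevM wrev_xe.
apply: strip_right; rewrite ?is_index_rev ?hr ?size_rev// => w' iw' nw' sw'.
rewrite -(sumn_rev w'); apply: (hF (rev w')); rewrite ?is_index_rev ?hr ?size_rev//.
Qed.

End Strip.

(** The same expansion along suffixes of ones, the powers of t being absorbed by [lamX]:
    multiplication by an exponential independent of p preserves the kernel of [lam]. *)
Lemma lam_right M k a (F : int -> ws) w : sumn w = k ->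
  ~~ allones w -> (forall i, ~~ allones (take i w) -> lam M (sumn (take i w)) (fun p => F p (take i w)) = 0) ->
  lam M k (fun p => (F p * xe a) w) = 0.
Proof.
move=> wk nw hF.
pose c i := if allones (drop i w) then ifact R (size w - i) * a ^+ (size w - i) else 0.
rewrite (eq_lam _ _ (G' := fun p => \sum_(i < size w) ps_cst (c i) * (psX ^+ (size w - i) * F p (take i w)) + F p w)).
  have lw : lam M k (fun p => F p w) = 0 by have := hF (size w); rewrite take_size wk; exact.
  rewrite lamD lw addr0 -wk.
  have lam_sum (r : seq 'I_(size w)) : lam M (sumn w) (fun p => \sum_(i <- r) ps_cst (c i) * (psX ^+ (size w - i) * F p (take i w))) = 0.
    elim: r => [|i r IH].
      rewrite (eq_lam _ _ (G' := fun p => ps_cst 0 * 0)); first by rewrite lamZ mul0r.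
      by move=> p; rewrite big_nil mulr0.
    rewrite (eq_lam _ _ (G' := fun p => ps_cst (c i) * (psX ^+ (size w - i) * F p (take i w)) +
       \sum_(i <- r) ps_cst (c i) * (psX ^+ (size w - i) * F p (take i w)))); last first.
      by move=> p; rewrite big_cons.
    rewrite lamD IH addr0 lamZ /c; case: ifPn => [od|]; last by rewrite mul0r.
    have := sumn_cat (take i w) (drop i w); rewrite cat_take_drop (allones_sumn od) size_drop => ->.
    have -> : lam M (sumn (take i w) + (size w - i)) (fun p => psX ^+ (size w - i) * F p (take i w)) =
       lam M (sumn (take i w)) (fun p => F p (take i w)).
      elim: (size w - i)%N => [|m IHm].
        by rewrite addn0; apply: eq_lam => p; rewrite mul1r.
      rewrite addnS (eq_lam _ _ (G' := fun p => psX * (psX ^+ m * F p (take i w)))).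
        by rewrite lamX.
      by move=> p; rewrite exprS mulrA.
    by rewrite hF ?mulr0//; exact: allones_split.
  exact: lam_sum.
move=> p; rewrite ws_coefM_recr xe_nil mulr1; congr (_ + _).
apply: eq_bigr => i _; rewrite xeE -/(allones _) size_drop /c; case: ifP => _.
  by rewrite mulrC -mulrA.
by rewrite rmorph0 mul0r mulr0.
Qed.

End Multitangent.

Section MultitangentMain.
Variable R : realType.
Notation ps := (power_series R).
Notation ws := (word_series nat ps).
Notation ll := (ll R).
Notation er := (er R).
Notation gb := (gbig dom ll).
Notation gwb := (gwbig dom ll).
Hint Resolve ll1 er_ge0 : core.

Lemma gbig_dom T (P : T -> Prop) (l e : T -> R) f g :
  (forall x, P x -> `|f x| <= `|g x|) -> gbig P l e g -> gbig P l e f.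
Proof.
move=> fg [C [d [C0 h]]]; exists C, d; split=> // x Px.
exact: le_trans (fg x Px) (h x Px).
Qed.

Lemma gbig_sub T (P Q : T -> Prop) (l e : T -> R) f :
  (forall x, P x -> Q x) -> gbig Q l e f -> gbig P l e f.
Proof. by move=> PQ [C [d [C0 h]]]; exists C, d; split=> // x /PQ; exact: h. Qed.

Lemma ll_le M d : (0 < M)%N -> ll (M, 0) ^+ d <= 2 ^+ d * Lg R M ^+ d.
Proof.
move=> M0; rewrite -exprMn lerXn2r ?nnegrE ?(le_trans ler01 (ll1 _ _))//.
  by rewrite mulr_ge0// (le_trans ler01 (Lg_ge1 _ _)).
exact: Lg_double.
Qed.

Lemma gb_zero f : gb er f -> sml (fun M => f (M, 0)).
Proof.
move=> [C [d [C0 h]]]; exists (C * 2 ^+ d), d; split; first by rewrite mulr_ge0// exprn_ge0.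
move=> M M0; have dM : dom (M, 0) by split=> //=; rewrite normr0; lia.
apply: (le_trans (h _ dM)); rewrite /er /qd /= subn0 ler_wpM2r ?isqrt_ge0//.
by rewrite -mulrA ler_wpM2l// ll_le.
Qed.

Lemma sum_cyc_bound (f : nat * int -> R) (g : nat -> R) M :
  (forall m, (0 < m < M)%N -> `|f (M, m%:Z)| <= g m /\ `|f (M, - m%:Z)| <= g m) ->
  `|\sum_(p <- cyc M) f (M, p)| <= 2 * \sum_(1 <= m < M) g m.
Proof.
move=> h; rewrite big_cyc mulr_sumr; apply: (le_trans (ler_norm_sum _ _ _)).
rewrite !big_nat; apply: ler_sum => m /h[h1 h2].
by apply: (le_trans (ler_normD _ _)); lra.
Qed.

(** The error (M - |p|)^(-1/2) fails to be small only near the boundary of the window, and it is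
    summable enough there for the mean over p to be again of order M^(-1/2). *)
Lemma gb_mean f : gb er f -> sml (fun M => M%:R^-1 * \sum_(p <- cyc M) f (M, p)).
Proof.
move=> [C [d [C0 h]]]; exists (6 * (C * 2 ^+ d)), d.
split; first by rewrite !mulr_ge0// exprn_ge0.
move=> M M0; have M1 : (0 : R) < M%:R by rewrite ltr0n.
have s0 : 0 < Num.sqrt M%:R :> R by rewrite sqrtr_gt0.
have sM : Num.sqrt M%:R ^+ 2 = M%:R :> R by rewrite sqr_sqrtr// ltW.
set A := C * ll (M, 0) ^+ d.
have A0 : 0 <= A by rewrite mulr_ge0// exprn_ge0// (le_trans ler01 (ll1 _ _)).
have hb : `|\sum_(p <- cyc M) f (M, p)| <= 2 * \sum_(1 <= m < M) (A * (Num.sqrt (M - m)%:R)^-1).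
  apply: sum_cyc_bound => m /andP[m0 mM].
  have d1 : dom (M, m%:Z) by split=> //=; lia.
  have d2 : dom (M, - m%:Z) by split=> //=; lia.
  by split; [have := h _ d1|have := h _ d2]; rewrite /er /qd /= ?abszN.
rewrite normrM ger0_norm ?invr_ge0 ?ler0n// mulrC ler_pdivrMr//.
apply: (le_trans hb); rewrite -mulr_sumr.
apply: (@le_trans _ _ (2 * (A * (3 * Num.sqrt M%:R)))).
  by rewrite !ler_wpM2l// sum_isqrt_rev.
have hA : A <= C * 2 ^+ d * Lg R M ^+ d by rewrite /A -mulrA ler_wpM2l// ll_le.
move: hA s0 sM; move: (Lg R M ^+ d) (Num.sqrt M%:R) => L s hA s0 sM.
rewrite -sM (_ : 2 * (A * (3 * s)) = 6 * s * A); last by ring.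
rewrite (_ : _ * s ^+ 2 = 6 * s * (C * 2 ^+ d * L)); last by field; rewrite gt_eqF.
by rewrite ler_wpM2l// mulr_ge0// ltW.
Qed.

Definition dom' (x : nat * int) : Prop := dom x /\ x.2 != 0.
Definition ap (x : nat * int) : R := (absz x.2)%:R.
Lemma ap_ge0 x : 0 <= ap x. Proof. exact: ler0n. Qed.
Lemma ap_inv_ge0 x : 0 <= (ap x)^-1. Proof. by rewrite invr_ge0 ap_ge0. Qed.
Hint Resolve ap_ge0 ap_inv_ge0 : core.
Lemma dom'_ap x : dom' x -> 1 <= ap x.
Proof. by move=> [_ x0]; rewrite ler1n; lia. Qed.

Lemma gb_sum f : gbig dom' ll (fun x => er x * (ap x)^-1) f ->
  sml (fun M => \sum_(p <- cyc M) f (M, p)).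
Proof.
move=> [C [d [C0 h]]]; exists (8 * (C * 2 ^+ d)), d.+1.
split; first by rewrite !mulr_ge0// exprn_ge0.
move=> M M0; have M1 : (0 : R) < M%:R by rewrite ltr0n.
set A := C * ll (M, 0) ^+ d.
have A0 : 0 <= A by rewrite mulr_ge0// exprn_ge0// (le_trans ler01 (ll1 _ _)).
have hb : `|\sum_(p <- cyc M) f (M, p)| <= 2 * \sum_(1 <= m < M) (A * (m%:R * Num.sqrt (M - m)%:R)^-1).
  apply: sum_cyc_bound => m /andP[m0 mM].
  have d1 : dom' (M, m%:Z) by split; [split=> //=; lia|rewrite /=; lia].
  have d2 : dom' (M, - m%:Z) by split; [split=> //=; lia|rewrite /=; lia].
  by split; [have := h _ d1|have := h _ d2]; rewrite /er /qd /ap /= ?abszN invfM [_^-1 * _^-1]mulrC.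
apply: (le_trans hb); rewrite -mulr_sumr.
apply: (@le_trans _ _ (2 * (A * (4 * Lg R M / Num.sqrt M%:R)))).
  by rewrite !ler_wpM2l// sum_inv_isqrt.
have hA : A <= C * 2 ^+ d * Lg R M ^+ d by rewrite /A -mulrA ler_wpM2l// ll_le.
have L0 := Lg_gt0 R M; have s0 := isqrt_ge0 R M; rewrite exprS.
move: hA L0 s0; move: (Lg R M) ((Num.sqrt M%:R)^-1) => L s hA L0 s0.
rewrite (_ : 2 * (A * (4 * L * s)) = 8 * (L * s) * A); last by ring.
rewrite (_ : 8 * _ * _ * s = 8 * (L * s) * (C * 2 ^+ d * L ^+ d)); last by ring.
by rewrite ler_wpM2l// !mulr_ge0// ltW.
Qed.

Lemma uword_Vw M p : dom (M, p) ->
  uword R M p = xe (- harm R (n1 (M, p))) * Vw R (M, p) * xe (harm R (n2 (M, p))).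
Proof.
move=> [/= M0 pM]; rewrite uword_decomp// negp_ren posp_ren /Vw -/(n1 (M, p)) -/(n2 (M, p)).
by rewrite !mulrA.
Qed.

Lemma uword_lam M w : (0 < M)%N -> is_index w -> ~~ allones w ->
  lam M (sumn w) (fun p => uword R M p w) = 0.
Proof.
move=> M0 iw nw; apply: tau_form_lam; last exact: uword_form.
exact: ltnW (not_allones_sumn iw nw).
Qed.

Lemma uword_rho M w : (0 < M)%N -> is_index w -> ~~ allones w ->
  rho M (sumn w) (fun p => uword R M p w) = 0.
Proof.
move=> M0 iw nw; apply: tau_form_rho; last exact: uword_form.
exact: not_allones_sumn.
Qed.

(** The freedom to multiply by exponentials on both sides will be used with H_M and - H_M, which
    makes the germs converge. *)
Lemma conj_lam M a b w : (0 < M)%N -> is_index w -> ~~ allones w ->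
  lam M (sumn w) (fun p => (xe a * uword R M p * xe b) w) = 0.
Proof.
move=> M0 iw nw; apply: lam_right => // i ni.
have it := is_index_take i iw; move: (take i w) ni it => {iw nw} {}w nw iw.
have ar v : allones (rev v) = allones v by exact: all_rev.
rewrite -(sumn_rev w) (eq_lam _ _ (G' := fun p => (wrev (uword R M p) * xe a) (rev w))).
  apply: lam_right; rewrite ?ar// => j nj.
  rewrite -sumn_rev; apply: uword_lam; rewrite ?ar ?is_index_rev ?ar//.
  by apply: is_index_take; rewrite is_index_rev.
move=> p; have := congr1 (fun G : ws => wcoef G w) (wrevK (xe a * uword R M p)).
by rewrite wrevM wrev_xe => <-.
Qed.

Section Conj.
Variables (e g h : nat * int -> R) (n : nat).
Hypothesis e0 : forall x, 0 <= e x.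
Hypothesis er_e : forall x, dom x -> er x <= e x.
Hypotheses (pg : gb (fun=> 1) g) (ph : gb (fun=> 1) h).
Hypothesis Psi0 : forall w, is_index w -> ~~ allones w -> (size w < n)%N -> Psi R w (sumn w).-1 = 0.

Lemma conj_Vw w : is_index w -> ~~ allones w -> (size w <= n)%N ->
  gb er (fun x => (xe (g x) * Vw R x * xe (h x)) w (sumn w).-1 - Psi R w (sumn w).-1).
Proof.
have hV v : is_index v -> ~~ allones v -> (size v < n)%N -> gb er (fun x => Vw R x v (sumn v).-1).
  move=> iv nv sv; apply: eq_big_asy (@Vw_lim R v (sumn v).-1 iv) => x _.
  by rewrite ws_coefB ps_coefD ps_coefN (Psi0 iv nv sv) subr0.
have hL v : is_index v -> ~~ allones v -> (size v < n)%N ->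
    gb er (fun x => (xe (g x) * Vw R x) v (sumn v).-1).
  move=> iv nv sv; apply: (eq_big_asy (f := fun x =>
     ((xe (g x) * Vw R x) v (sumn v).-1 - Vw R x v (sumn v).-1) + Vw R x v (sumn v).-1)).
    by move=> x _; rewrite subrK.
  by apply: bigD => //; [exact: (strip_left (@er_ge0 R) pg hV iv nv (ltnW sv))|exact: hV].
move=> iw nw sw.
apply: (eq_big_asy (f := fun x =>
   ((xe (g x) * Vw R x * xe (h x)) w (sumn w).-1 - (xe (g x) * Vw R x) w (sumn w).-1) +
   (((xe (g x) * Vw R x) w (sumn w).-1 - Vw R x w (sumn w).-1) +
    (Vw R x - Psi R) w (sumn w).-1))).
  by move=> x _; rewrite ws_coefB ps_coefD ps_coefN; ring.
apply: bigD => //; first exact: (strip_right (@er_ge0 R) ph hL).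
by apply: bigD => //; [exact: (strip_left (@er_ge0 R) pg hV)|exact: Vw_lim].
Qed.

End Conj.

Lemma plog_n1 : gb (fun=> 1) (fun x => harm R (n1 x)).
Proof. exact: (gb_plog dom_n1 (plog_harm R)). Qed.
Lemma plog_n2 : gb (fun=> 1) (fun x => harm R (n2 x)).
Proof. exact: (gb_plog dom_n2 (plog_harm R)). Qed.

(** This coefficient is the limit of the residues. Each residue of the window is this constant up to
    an error, the exponentials being stripped by induction on the length, and by [uword_rho] the
    residues add up to 0. Division by M bounds the constant by a mean of errors, which tends to
    0. *)
Lemma Psi_low w : is_index w -> ~~ allones w -> Psi R w (sumn w).-1 = 0.
Proof.
move: {2}(size w) (leqnn (size w)) => n.
elim/ltn_ind: n w => n IH w sw iw nw.
have Psi0 v : is_index v -> ~~ allones v -> (size v < n)%N -> Psi R v (sumn v).-1 = 0.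
  by move=> iv nv sv; apply: (IH (size v)).
have gU := conj_Vw (bigN plog_n1) plog_n2 Psi0 iw nw sw.
set k' := (sumn w).-1 in gU *; set psi := Psi R w k' in gU *.
set f := (fun x => _) in gU.
apply: (@sml_cst R).
apply: (gbig_dom (g := fun M => f (M, 0) * M%:R^-1 + M%:R^-1 * \sum_(p <- cyc M) f (M, p))).
  move=> M M0; have M1 : (1 : R) <= M%:R by rewrite ler1n.
  have := uword_rho M0 iw nw; rewrite /rho -/k'.
  have fE p : dom (M, p) -> uword R M p w k' = f (M, p) + psi.
    by move=> dp; rewrite uword_Vw// /f subrK.
  rewrite fE; last by split=> //=; rewrite normr0; lia.
  have -> : \sum_(p <- cyc M) uword R M p w k' = \sum_(p <- cyc M) f (M, p) + (2 * (M%:R - 1)) * psi.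
    have -> : (2 * (M%:R - 1)) * psi = \sum_(p <- cyc M) psi.
      by rewrite big_cyc sumr_const_nat -[_ *+ (M - 1)]mulr_natr natrB//; ring.
    rewrite -big_split /=; apply: eq_big_seq => p; rewrite mem_cyc => /andP[_ pM].
    by rewrite fE.
  move=> e; have -> : f (M, 0) * M%:R^-1 + M%:R^-1 * \sum_(p <- cyc M) f (M, p) =
     - (psi * ((2 * M%:R - 1) / M%:R)).
    have -> : f (M, 0) = - (psi + (\sum_(p <- cyc M) f (M, p) + 2 * (M%:R - 1) * psi)).
      by apply/eqP; rewrite -addr_eq0 addrA e.
    by field; rewrite gt_eqF//; lra.
  rewrite normrN normrM ler_peMr//; rewrite ger0_norm; last by rewrite divr_ge0//; lra.
  by rewrite ler_pdivlMr; lra.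
apply: (bigD (@Lg_ge1 R) (@isqrt_ge0 R)); last exact: gb_mean.
apply: (gbig_dom (g := fun M => f (M, 0))); last exact: gb_zero.
move=> M M0; rewrite normrM ler_piMr// ger0_norm ?invr_ge0// invf_le1 ?ltr0n//.
by rewrite ler1n.
Qed.

End MultitangentMain.

Section MultitangentRelation.
Variable R : realType.
Notation ps := (power_series R).
Notation ws := (word_series nat ps).
Notation ll := (ll R).
Notation er := (er R).
Notation ap := (ap R).
Notation gb := (gbig dom ll).
Notation gwb := (gwbig dom ll).
Notation gb' := (gbig dom' ll).
Notation gwb' := (gwbig dom' ll).
Hint Resolve ll1 er_ge0 ap_ge0 ap_inv_ge0 : core.

Definition hsum (s M : nat) : R := \sum_(1 <= m < M) (m%:R^-1) ^+ s.

Lemma hsum_cvg s : (1 < s)%N -> cvgn (hsum s).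
Proof.
move=> s1; have [l [C [C0 h]]] : exists l C, 0 <= C /\
    forall N, (0 < N)%N -> `|hsum s N - l| <= C / Num.sqrt N%:R.
  apply: cvg_of_increments; exists 1, 0%N; split=> // N N0.
  rewrite /hsum big_nat_recr//= addrAC subrr add0r expr0 !mul1r.
  rewrite ger0_norm ?exprn_ge0 ?invr_ge0// -exprVn.
  by rewrite ler_wiXn2l ?invr_ge0// invf_le1 ?ltr0n// ler1n.
by apply/cvg_ex; exists l; apply: sml_cvg; exact: sml_rate C0 h.
Qed.

Lemma sum_cyc_pow s M : \sum_(p <- cyc M) (p%:~R^-1 : R) ^+ s = (1 + (-1) ^+ s) * hsum s M.
Proof.
rewrite big_cyc /hsum mulr_sumr; apply: eq_bigr => m _.
by rewrite mulrNz invrN (exprNn _^-1); ring.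
Qed.

Lemma dom'_dom x : dom' x -> dom x. Proof. by case. Qed.

Lemma harm_absdiff x (n : nat) : dom x -> (0 < n)%N -> (qd x <= n)%N ->
  (absz (n%:Z - x.1%:Z)%R <= absz x.2)%N ->
  `|harm R x.1 - harm R n| <= ap x * er x.
Proof.
case: x => M p [/= M0 pM] n0 qn np.
have q0 : (0 < qd (M, p))%N by exact: (@dom_qd (M, p)).
have qM : (qd (M, p) <= M)%N by rewrite /qd /= leq_subr.
have key a b : (0 < a)%N -> (a <= b)%N -> (qd (M, p) <= a)%N -> (b - a <= absz p)%N ->
    harm R b - harm R a <= ap (M, p) * er (M, p).
  move=> a0 ab qa bap; apply: (le_trans (harm_diff _ a0 ab)).
  rewrite ler_pM ?invr_ge0 ?ler0n//; first by rewrite ler_nat.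
  apply: (@le_trans _ _ (qd (M, p))%:R^-1).
    by rewrite lef_pV2 ?posrE ?ltr0n// ler_nat.
  have q1 : (1 : R) <= (qd (M, p))%:R by rewrite ler1n.
  rewrite /er lef_pV2 ?posrE ?sqrtr_gt0 ?ltr0n//.
  have s1 : 1 <= Num.sqrt (qd (M, p))%:R :> R by rewrite -[leLHS]sqrtr1 ler_sqrt// ltr0n.
  by rewrite -[leRHS]sqr_sqrtr ?ler0n// expr2 ler_peMl// (le_trans ler01).
have [Mn|nM] := leqP M n.
  have hh := harm_le R Mn; rewrite distrC ger0_norm ?subr_ge0//; apply: key => //.
  by move: np; rewrite /=; lia.
have hh := harm_le R (ltnW nM); rewrite ger0_norm ?subr_ge0//; apply: key => //; first exact: ltnW.
by move: np; rewrite /=; lia.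
Qed.

(** [hA] and [hB] are the exponents left at p after conjugation with H_M. They are bounded by |p|
    times the error [er], because H_M and H_(M+p) or H_(M-p) differ by at most |p| terms. *)
Definition hA (x : nat * int) : R := harm R x.1 - harm R (n1 x).
Definition hB (x : nat * int) : R := harm R (n2 x) - harm R x.1.

Lemma hA_small : gb (fun x => er x * ap x) hA.
Proof.
exists 1, 0%N; split=> // x dx; rewrite expr0 !mul1r mulrC.
have [n0 _ qn] := dom_n1 dx; apply: harm_absdiff => //.
by case: x dx {n0 qn} => M p [/= M0 pM]; rewrite /n1 /=; lia.
Qed.

Lemma hB_small : gb (fun x => er x * ap x) hB.
Proof.
exists 1, 0%N; split=> // x dx; rewrite expr0 !mul1r mulrC distrC.
have [n0 _ qn] := dom_n2 dx; apply: harm_absdiff => //.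
by case: x dx {n0 qn} => M p [/= M0 pM]; rewrite /n2 /=; lia.
Qed.

Lemma plog_M : gb (fun=> 1) (fun x => harm R x.1).
Proof.
have [C [d [C0 h]]] := plog_harm R; exists C, d; split=> // x [M0 _].
apply: (le_trans (h _ M0)); rewrite !mulr1 ler_wpM2l// Lg_exp_mono//.
by rewrite -addnn leq_addr.
Qed.

Lemma hA_plog : gb (fun=> 1) hA.
Proof. by apply: bigB => //; [exact: plog_M|exact: plog_n1]. Qed.
Lemma hB_plog : gb (fun=> 1) hB.
Proof. by apply: bigB => //; [exact: plog_n2|exact: plog_M]. Qed.

Lemma xe_sub1 (e h : nat * int -> R) : (forall x, 0 <= e x) ->
  gb (fun=> 1) h -> gb e h -> gwb e (fun x => xe (h x) - 1).
Proof.
move=> e0 ph sh w b iw; case: w iw => [|a w] iw.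
  apply: (eq_big_asy (f := fun=> 0)); last exact: big0.
  by move=> x _; rewrite ws_coefB xe_nil subrr ps_coef0.
apply: (eq_big_asy (f := fun x => (if allones (a :: w) then ifact R (size w).+1 * (psX ^+ (size w).+1 : ps) b else 0) *
    (h x ^+ size w * h x))).
  move=> x _; rewrite ws_coefB ws_coef1 subr0 xeE -/(allones _); case: ifP => _; last by rewrite mul0r ps_coef0.
  by rewrite ps_cstM -exprSr; ring.
by apply: bigZ => //; apply: plogM => //; exact: plogX.
Qed.

Definition Ww (x : nat * int) : ws := xe (hA x) * Vw R x * xe (hB x).

Lemma Ww_uword M p : dom (M, p) -> Ww (M, p) = xe (harm R M) * uword R M p * xe (- harm R M).
Proof.
move=> dx; rewrite uword_Vw// /Ww /hA /hB /=.
by rewrite -xeM -[xe (harm R (n2 _) - _)]xeM !mulrA.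
Qed.

Lemma gbig_eap f : gb' er f -> gb' (fun x => er x * ap x) f.
Proof. by apply: big_le => // x /(@dom'_ap R) a1; rewrite ler_peMr// er_ge0. Qed.

Lemma Ww_lim : gwb' (fun x => er x * ap x) (fun x => Ww x - Psi R).
Proof.
have ea0 x : 0 <= er x * ap x by rewrite mulr_ge0 ?er_ge0.
have sub e F : gwb e F -> gwb' e F by move=> h w b iw; apply: gbig_sub (h w b iw); exact: dom'_dom.
have pB := gwplog_xe (@ll1 R) hB_plog; have pA := gwplog_xe (@ll1 R) hA_plog.
have sA := xe_sub1 ea0 hA_plog hA_small; have sB := xe_sub1 ea0 hB_plog hB_small.
have -> : (fun x => Ww x - Psi R) = (fun x =>
   (xe (hA x) - 1) * (Vw R x * xe (hB x)) + ((Vw R x - Psi R) * xe (hB x) + Psi R * (xe (hB x) - 1))).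
  apply/funext => x; rewrite /Ww !mulrBl !mulrBr mul1r mulr1 !mulrA.
  by rewrite !addrA subrK subrK.
have D (e : nat * int -> R) F G : (forall x, 0 <= e x) -> gwb' e F -> gwb' e G -> gwb' e (fun x => F x + G x).
  move=> e0 hF hG w b iw; apply: (eq_big_asy (f := fun x => F x w b + G x w b)) => //.
  by apply: bigD => //; [exact: hF|exact: hG].
apply: (D _ _ _ ea0).
  apply: (sub); apply: wplogMr => //; apply: wplogM => //; exact: Vw_plog.
apply: (D _ _ _ ea0).
  apply: wplogMr => //; last exact: sub.
  by move=> w b iw; apply: gbig_eap; apply: gbig_sub (@Vw_lim R w b iw); exact: dom'_dom.
by apply: (sub); apply: wplogM => //; exact: wplog_cst.
Qed.

(** A bound without the factor |p| of [Ww_lim], obtained for the residue because the limit is 0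
    there and on shorter words. It is indispensable: the residue is summed against 1 / |p| only, the
    higher poles against at least 1 / p^2. *)
Lemma Ww_low w : is_index w -> ~~ allones w -> gb er (fun x => Ww x w (sumn w).-1).
Proof.
move=> iw nw.
have h := conj_Vw hA_plog hB_plog (n := size w) (fun v iv nv _ => Psi_low R iv nv) iw nw (leqnn _).
by apply: eq_big_asy h => x _; rewrite (Psi_low R iw nw) subr0.
Qed.

Lemma inv_ap M p s : (0 < s)%N -> p != 0 -> `|(p%:~R^-1 : R) ^+ s| <= (ap (M, p))^-1 ^+ s.
Proof.
move=> s0 p0; by rewrite normrX normfV -intr_norm /ap /= natr_absz.
Qed.

(* The constant term at [z = 0] of the partial fraction expansion of the
   multitangent function attached to [w]: its principal parts at the nonzero
   integers contribute the values [(1 + (-1)^s) zeta(s)]. *)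
Lemma Psi_top w : is_index w -> ~~ allones w ->
  Psi R w (sumn w) = \sum_(j < (sumn w).-1)
    Psi R w (sumn w - j.+2)%N * ((1 + (-1) ^+ j.+2) * limn (hsum j.+2)).
Proof.
move=> iw nw; have k2 := not_allones_sumn iw nw.
set k := sumn w in k2 *.
(* The value at j = 0, the limit of the residues, is 0 by [Psi_low]; thus the divergent sum [hsum 1]
   disappears. *)
pose psi (j : nat) : R := if j == 0%N then 0 else Psi R w (k - j.+1)%N.
pose T (x : nat * int) : R := \sum_(j < k) (Ww x w (k - j.+1)%N - psi j) * (x.2%:~R^-1 : R) ^+ j.+1.
have gT : gb' (fun x => er x * (ap x)^-1) T.
  have ee0 x : 0 <= er x * (ap x)^-1 by rewrite mulr_ge0 ?er_ge0 ?ap_inv_ge0.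
  apply: big_sumf => // j _.
  have gp : gb' (fun x => (ap x)^-1 ^+ j.+1) (fun x => (x.2%:~R^-1 : R) ^+ j.+1).
    by exists 1, 0%N; split=> // -[M p] [_ p0]; rewrite expr0 !mul1r inv_ap.
  have [j0|j0] := eqVneq (j : nat) 0%N.
    rewrite j0 in gp *; rewrite /psi eqxx.
    have gW : gb' er (fun x => Ww x w (k - 1)%N - 0).
      apply: eq_big_asy (gbig_sub dom'_dom (Ww_low iw nw)) => x _.
      by rewrite subr0 subn1.
    by apply: big_le (bigM gW gp) => // x _; rewrite expr1.
  rewrite /psi (negbTE j0).
  have gW : gb' (fun x => er x * ap x) (fun x => Ww x w (k - j.+1)%N - Psi R w (k - j.+1)%N).
    by apply: eq_big_asy (@Ww_lim w (k - j.+1)%N iw) => x _; rewrite ws_coefB ps_coefD ps_coefN.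
  apply: big_le (bigM gW gp) => // x /(@dom'_ap R) a1; have ap0 : 0 < ap x by exact: lt_le_trans ltr01 a1.
  case: (nat_of_ord j) j0 => // j' _.
  rewrite -mulrA ler_wpM2l ?er_ge0// exprS mulrA divff ?gt_eqF// mul1r exprS ler_piMr ?ap_inv_ge0//.
  by rewrite exprn_ile1 ?ap_inv_ge0// invf_le1.
have sT := gb_sum gT.
have lamE M : (0 < M)%N -> Vw R (M, 0) w k =
    \sum_(p <- cyc M) T (M, p) + \sum_(j < k) psi j * ((1 + (-1) ^+ j.+1) * hsum j.+1 M).
  move=> M0.
  have := conj_lam (harm R M) (- harm R M) M0 iw nw; rewrite /lam -/k.
  have dM0 : dom (M, 0) by split=> //=; rewrite normr0; lia.
  (* At p = 0 both half products stop at M, so conjugation with H_M removes their exponentials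
     exactly. *)
  have V0 : (xe (harm R M) * uword R M 0 * xe (- harm R M)) = Vw R (M, 0).
    have e1 : n1 (M, 0) = M by rewrite /n1 /=; lia.
    have e2 : n2 (M, 0) = M by rewrite /n2 /=; lia.
    rewrite -Ww_uword// /Ww /hA /hB e1 e2 subrr xe0.
    by rewrite mul1r mulr1.
  rewrite V0 => /eqP; rewrite subr_eq0 => /eqP ->.
  rewrite exchange_big /=.
  transitivity (\sum_(j < k) \sum_(p <- cyc M) (Ww (M, p) w (k - j.+1)%N * (p%:~R^-1 : R) ^+ j.+1)).
    apply: eq_bigr => j _; apply: eq_big_seq => p; rewrite mem_cyc => /andP[_ pM].
    by rewrite Ww_uword.
  rewrite /T [X in _ = X + _]exchange_big -big_split /=; apply: eq_bigr => j _.
  rewrite -sum_cyc_pow mulr_sumr -big_split /=; apply: eq_bigr => p _.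
  by rewrite -mulrDl subrK.
have cV : (fun M => Vw R (M, 0) w k) @ \oo --> Psi R w k.
  apply: sml_cvg; apply: (gb_zero (f := fun x => Vw R x w k - Psi R w k)).
  by apply: eq_big_asy (@Vw_lim R w k iw) => x _; rewrite ws_coefB.
have cS : (fun M => \sum_(p <- cyc M) T (M, p) + \sum_(j < k) psi j * ((1 + (-1) ^+ j.+1) * hsum j.+1 M))
    @ \oo --> 0 + \sum_(j < k) psi j * ((1 + (-1) ^+ j.+1) * limn (hsum j.+1)).
  apply: cvgD; first exact: sml_cvg0.
  apply: cvg_big => [|j _]; first exact: add_continuous.
  have [->|j0] := eqVneq (j : nat) 0%N.
    by rewrite /psi /= mul0r; under eq_fun do rewrite mul0r; exact: cvg_cst.
  apply: cvgMr; apply: cvgMr; apply: hsum_cvg.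
  by rewrite ltnS lt0n.
rewrite -(cvg_lim _ cV)//.
have -> : lim ((fun M => Vw R (M, 0) w k) @ \oo) =
    0 + \sum_(j < k) psi j * ((1 + (-1) ^+ j.+1) * limn (hsum j.+1)).
  apply: cvg_lim => //; apply: cvg_trans cS; apply: near_eq_cvg; near=> M.
  by rewrite lamE//; near: M; exact: nbhs_infty_gt.
rewrite add0r; case: k k2 @psi @T gT sT lamE cV cS => // k k2 psi T _ _ _ _ _.
rewrite big_ord_recl /= {1}/psi /= mul0r add0r.
by apply: eq_bigr => j _; rewrite /psi.
Unshelve. all: by end_near.
Qed.

End MultitangentRelation.

(** * Truncated multiple zeta values and their spans *)

Section Truncations.
Variable R : realType.

(** The nested sum peeled from its smallest index. [lo] is the index chosen last, so the end of the
    recursion sees the largest index as exponent of z, and 0 for the empty word when started at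
    0. *)
Fixpoint ztail (z : R) (k : seq nat) (lo M : nat) : R :=
  if k is a :: k' then \sum_(x < M | (lo < x)%N) x%:R^-1 ^+ a * ztail z k' x M
  else z ^+ lo.

Lemma polylog_trunc_tail k z M : polylog_trunc k z M = ztail z k 0 M.
Proof.
rewrite /polylog_trunc /increasing_pos.
suff H lo : \sum_(m : (size k).-tuple 'I_M | path ltn lo (map val m))
    z ^+ last lo (map val m) / (\prod_(i < size k) (tnth m i)%:R ^+ nth 0%N k i) =
    ztail z k lo M by exact: H.
elim: k lo => [|a k IH] lo.
  rewrite /= big_mkcond (big_pred1 [tuple]) /=; first by rewrite big_ord0 divr1.
  by move=> t; apply/esym/eqP; exact: tuple0.
rewrite big_mkcond sum_tuple_cons /= [RHS]big_mkcond; apply: eq_bigr => x _.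
case: ifP => lx; last by rewrite big1// => t _; rewrite lx.
rewrite -IH mulr_sumr [RHS]big_mkcond /=; apply: eq_bigr => t _.
rewrite /= ?lx /=; case: ifP => _; last by rewrite ?mulr0.
rewrite big_ord_recl /= tnth0 invfM exprVn mulrCA; congr (_ * (_ * _^-1)).
by apply: eq_bigr => i _; rewrite tnthS.
Qed.

Lemma zeta_trunc_polylog k M : zeta_trunc R k M = polylog_trunc k 1 M.
Proof.
by apply: eq_bigr => m _; rewrite expr1n mul1r.
Qed.

Lemma ztail_rcons z k a lo M : ztail z (rcons k a) lo M.+1 =
  ztail z (rcons k a) lo M +
  (if (lo < M)%N then z ^+ M * M%:R^-1 ^+ a * ztail 1 k lo M else 0).
Proof.
elim: k lo => [|b k IH] lo /=.
  rewrite [LHS]big_mkcond big_ord_recr /= -big_mkcond /=; congr (_ + _).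
  by case: ifP; rewrite ?expr1n ?mulr1// mulrC.
rewrite [LHS]big_mkcond big_ord_recr /= IH.
have -> : ztail z (rcons k a) M M = 0.
  case: k {IH} => [|c k] /=; apply: big_pred0 => x; apply/negbTE; rewrite -leqNgt ltnW//.
rewrite ltnn addr0 mulr0 if_same addr0.
under eq_bigr do rewrite IH.
rewrite -big_mkcond /=; under eq_bigr do rewrite mulrDr.
rewrite big_split /=; congr (_ + _).
case: ifP => lM; last first.
  by apply: big1 => x lx; rewrite ifF ?mulr0//; have := ltn_ord x; lia.
rewrite mulr_sumr; apply: eq_bigr => x lx.
by rewrite ltn_ord mulrCA.
Qed.

Lemma polylog_trunc_nil (z : R) M : polylog_trunc [::] z M = 1.
Proof. by rewrite polylog_trunc_tail /= expr0. Qed.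

Lemma zeta_trunc_nil M : zeta_trunc R [::] M = 1.
Proof. by rewrite zeta_trunc_polylog polylog_trunc_nil. Qed.

Lemma polylog_trunc_rcons k a z M : polylog_trunc (rcons k a) z M =
  \sum_(1 <= m < M) z ^+ m * m%:R^-1 ^+ a * zeta_trunc R k m.
Proof.
rewrite polylog_trunc_tail; elim: M => [|M IH].
  by rewrite big_geq//; case: k => [|b k] /=; rewrite big_ord0.
rewrite ztail_rcons IH -polylog_trunc_tail -zeta_trunc_polylog.
case: M {IH} => [|M] /=; first by rewrite !big_geq// addr0.
by rewrite [RHS]big_nat_recr.
Qed.

Lemma zeta_trunc_rcons k a M : zeta_trunc R (rcons k a) M =
  \sum_(1 <= m < M) m%:R^-1 ^+ a * zeta_trunc R k m.
Proof.
rewrite zeta_trunc_polylog polylog_trunc_rcons; apply: eq_bigr => m _.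
by rewrite expr1n mul1r.
Qed.

(* Words are reversed here: the head of [r] is the exponent of the largest summation index. *)
Definition zr (r : seq nat) (N : nat) : R := zeta_trunc R (rev r) N.

Lemma zr_nil N : zr [::] N = 1. Proof. exact: zeta_trunc_nil. Qed.

Lemma zr_cons a r N : zr (a :: r) N = \sum_(1 <= m < N) m%:R^-1 ^+ a * zr r m.
Proof. by rewrite /zr rev_cons zeta_trunc_rcons. Qed.

Lemma zr_consS a r N : (0 < N)%N ->
  zr (a :: r) N.+1 = zr (a :: r) N + N%:R^-1 ^+ a * zr r N.
Proof. by move=> N0; rewrite !zr_cons big_nat_recr. Qed.

Lemma zr_cons1 a r : zr (a :: r) 1 = 0.
Proof. by rewrite zr_cons big_geq. Qed.

(** The quasi-shuffle product: the two largest summation indices are compared, and a tie adds their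
    exponents. *)
Fixpoint stuffle (r : seq nat) : seq nat -> seq (seq nat) :=
  if r is a :: r1 then
    fix stuffle_r (s : seq nat) : seq (seq nat) :=
      if s is b :: s1 then
        [seq a :: x | x <- stuffle r1 s] ++ [seq b :: x | x <- stuffle_r s1] ++
        [seq (a + b)%N :: x | x <- stuffle r1 s1]
      else [:: r]
  else fun s => [:: s].
Arguments stuffle : simpl never.

Lemma stuffle_nilr r : stuffle r [::] = [:: r]. Proof. by case: r. Qed.

Lemma stuffle_nill s : stuffle [::] s = [:: s]. Proof. by []. Qed.

Lemma stuffle_cons a r b s : stuffle (a :: r) (b :: s) =
  [seq a :: x | x <- stuffle r (b :: s)] ++ [seq b :: x | x <- stuffle (a :: r) s] ++
  [seq (a + b)%N :: x | x <- stuffle r s].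
Proof. by []. Qed.

(** Induction on N: both sides have the same increments, the product of two increments accounting
    for the merged letters. *)
Lemma zr_mul r s N : (0 < N)%N -> zr r N * zr s N = \sum_(x <- stuffle r s) zr x N.
Proof.
case: N => // N _; elim: N r s => [|N IH] r s.
  case: r s => [|a r] [|b s]; rewrite ?stuffle_nilr ?stuffle_nill ?big_seq1 ?zr_nil ?mul1r ?mulr1//.
  rewrite zr_cons1 mul0r stuffle_cons !big_cat !big_map /=.
  by do 3!(rewrite big1 ?add0r; last by move=> x _; rewrite zr_cons1).
case: r s => [|a r] [|b s]; rewrite ?stuffle_nilr ?stuffle_nill ?big_seq1 ?zr_nil ?mul1r ?mulr1//.
rewrite (zr_consS a r (ltn0Sn N)) (zr_consS b s (ltn0Sn N)) stuffle_cons !big_cat !big_map.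
have st (c : nat) (L : seq (seq nat)) : \sum_(x <- L) zr (c :: x) N.+2 =
    \sum_(x <- L) zr (c :: x) N.+1 + N.+1%:R^-1 ^+ c * \sum_(x <- L) zr x N.+1.
  by rewrite mulr_sumr -big_split; apply: eq_bigr => x _; rewrite zr_consS.
rewrite !st -!IH exprD.
have := IH (a :: r) (b :: s); rewrite stuffle_cons !big_cat !big_map => h.
rewrite mulrDl !mulrDr h.
set x := N.+1%:R^-1 ^+ a; set y := N.+1%:R^-1 ^+ b. rewrite /=; ring.
Qed.

Lemma stuffle_sumn r s x : x \in stuffle r s -> sumn x = (sumn r + sumn s)%N.
Proof.
elim: r s x => [|a r IHr] s x; first by rewrite stuffle_nill inE => /eqP ->.
elim: s x => [|b s IHs] x; first by rewrite stuffle_nilr inE => /eqP ->; rewrite addn0.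
rewrite stuffle_cons !mem_cat => /or3P[] /mapP[y hy ->] /=.
- by rewrite (IHr _ _ hy) /=; lia.
- by rewrite (IHs _ hy) /=; lia.
- by rewrite (IHr _ _ hy) /=; lia.
Qed.

Lemma stuffle_size r s x : x \in stuffle r s -> (size x <= size r + size s)%N.
Proof.
elim: r s x => [|a r IHr] s x; first by rewrite stuffle_nill inE => /eqP ->.
elim: s x => [|b s IHs] x; first by rewrite stuffle_nilr inE => /eqP ->; rewrite addn0.
rewrite stuffle_cons !mem_cat => /or3P[] /mapP[y hy ->] /=.
- by have := IHr _ _ hy; rewrite /=; lia.
- by have := IHs _ hy; rewrite /=; lia.
- by have := IHr _ _ hy; rewrite /=; lia.
Qed.

Lemma stuffle_index r s x : is_index r -> is_index s -> x \in stuffle r s -> is_index x.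
Proof.
rewrite /is_index.
elim: r s x => [|a r IHr] s x; first by rewrite stuffle_nill inE => _ ? /eqP ->.
elim: s x => [|b s IHs] x; first by rewrite stuffle_nilr inE => ? _ /eqP ->.
move=> /= /andP[a0 ir] /andP[b0 is_].
rewrite stuffle_cons !mem_cat => /or3P[] /mapP[y hy ->] /=.
- by rewrite a0 (IHr (b :: s))//= b0.
- by rewrite b0 (IHs y)//= a0.
- by rewrite addn_gt0 a0 (IHr s).
Qed.

Definition radm (r : seq nat) : bool := if r is a :: _ then (1 < a)%N else true.

Lemma admissible_rev r : admissible (rev r) = is_index r && radm r.
Proof.
rewrite /admissible /is_index all_rev; congr (_ && _).
case: r => [|a r] //; rewrite rev_cons /= last_rcons.
by case: eqP => // h; have := congr1 size h; rewrite size_rcons.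
Qed.

Lemma stuffle_radm r s x : is_index r -> is_index s -> radm r -> radm s ->
  x \in stuffle r s -> radm x.
Proof.
case: r s => [|a r] [|b s] ir is_ ar bs; rewrite ?stuffle_nilr ?stuffle_nill ?inE; try by move/eqP => ->.
rewrite stuffle_cons !mem_cat => /or3P[] /mapP[y hy ->] //=.
by move: ar; rewrite /=; lia.
Qed.

Definition lead1 (r : seq nat) : nat := find (predC1 1%N) r.

(* Solved for [F (1^{s+1} r)], this trades a word for words with fewer leading ones and the product
   of [1^s r] with the harmonic sum: the induction step of the regularization. *)
Lemma stuffle_one s r : is_index r -> radm r -> exists L : seq (seq nat),
  [/\ forall F : seq nat -> R, \sum_(x <- stuffle (nseq s 1%N ++ r) [:: 1%N]) F x =
        s.+1%:R * F (nseq s.+1 1%N ++ r) + \sum_(x <- L) F x,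
      {subset L <= stuffle (nseq s 1%N ++ r) [:: 1%N]} &
      forall x, x \in L -> (lead1 x < s.+1)%N].
Proof.
move=> ir ar; elim: s => [|s [L [FL sL hL]]].
  case: r ir ar => [|b r] ir ar.
    by exists [::]; split=> // F; rewrite stuffle_nill big_nil addr0 mul1r /= big_seq1.
  exists ([seq b :: x | x <- stuffle r [:: 1%N]] ++ [:: (b + 1)%N :: r]).
  rewrite [nseq 0 _ ++ _]/= stuffle_cons stuffle_nilr; split.
  - move=> F; rewrite !stuffle_nilr !big_cat /= !big_seq1 mul1r; exact: addrCA.
  - by move=> x; rewrite !stuffle_nilr !mem_cat => /orP[->|] //=; rewrite !inE => ->; rewrite !orbT.
  move=> x; rewrite mem_cat => /orP[/mapP[y _ ->]|]; last rewrite inE => /eqP ->.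
    by rewrite /lead1 /=; move: ar; rewrite /=; case: b {ir} => [|[|b]].
  by rewrite /lead1 /=; move: ar; rewrite /=; case: b {ir} => [|[|b]].
exists ([seq 1%N :: x | x <- L] ++ [:: 2%N :: (nseq s 1%N ++ r)]).
have E : stuffle (nseq s.+1 1%N ++ r) [:: 1%N] =
   [seq 1%N :: x | x <- stuffle (nseq s 1%N ++ r) [:: 1%N]] ++ [:: nseq s.+2 1%N ++ r] ++
   [:: 2%N :: (nseq s 1%N ++ r)].
  by rewrite [nseq s.+1 _ ++ _]/= stuffle_cons !stuffle_nilr.
rewrite E; split.
- move=> F; rewrite !big_cat !big_map (FL (fun x => F (1%N :: x))) /= !big_seq1.
  rewrite -[s.+2]addn1 natrD mulrDl mul1r -!addrA; congr (_ + _).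
  by rewrite addrCA.
- move=> x; rewrite !mem_cat => /orP[/mapP[y /sL hy ->]|->]; last by rewrite !orbT.
  by rewrite map_f.
move=> x; rewrite mem_cat => /orP[/mapP[y /hL hy ->]|]; last by rewrite inE => /eqP ->.
by rewrite /lead1 /= ltnS.
Qed.

Lemma lead1P r : is_index r -> exists2 r0, r = nseq (lead1 r) 1%N ++ r0 & is_index r0 && radm r0.
Proof.
rewrite /lead1; elim: r => [|a r IH]; first by exists [::].
move=> /= /andP[a0 ir]; case: eqP => [->|/eqP a1] /=.
  by have [r0 e h] := IH ir; exists r0; rewrite //= -e.
by exists (a :: r); rewrite //= a0 ir ltn_neqAle eq_sym a1.
Qed.

End Truncations.

(** * Rational spans and asymptotic polynomials in H_N *)

Section Span.
Variable R : realType.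

Definition israt (c : R) : Prop := exists q : rat, c = ratr q.

Lemma israt_nat n : israt n%:R. Proof. by exists n%:R; rewrite ratr_nat. Qed.
Lemma isratV c : israt c -> israt c^-1.
Proof. by move=> [q ->]; exists q^-1; rewrite fmorphV. Qed.
Lemma isratM c d : israt c -> israt d -> israt (c * d).
Proof. by move=> [q ->] [p ->]; exists (q * p); rewrite rmorphM. Qed.
Lemma isratD c d : israt c -> israt d -> israt (c + d).
Proof. by move=> [q ->] [p ->]; exists (q + p); rewrite rmorphD. Qed.
Lemma israt_sgn n : israt ((-1) ^+ n).
Proof. by exists ((-1) ^+ n); rewrite rmorphXn rmorphN1. Qed.
Lemma israt_ifact n : israt (ifact R n). Proof. exact/isratV/israt_nat. Qed.

Lemma qspan_sub (S : set R) : S `<=` qspan S.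
Proof.
by move=> x Sx; exists 1%N, (fun=> 1), (fun=> x); split=> //; rewrite big_ord1 rmorph1 mul1r.
Qed.

Lemma qspan0 (S : set R) : qspan S 0.
Proof.
exists 0%N, (fun=> 0), (fun=> 0); split; last by rewrite big_ord0.
by case.
Qed.

Lemma qspanZ (S : set R) c x : israt c -> qspan S x -> qspan S (c * x).
Proof.
move=> [q ->] [d [p [s [hs ->]]]]; exists d, (fun i => q * p i), s; split=> //.
by rewrite mulr_sumr; apply: eq_bigr => i _; rewrite rmorphM mulrA.
Qed.

Lemma qspanD (S : set R) x y : qspan S x -> qspan S y -> qspan S (x + y).
Proof.
move=> [d [q [s [hs ->]]]] [d' [q' [s' [hs' ->]]]]; exists (d + d')%N.
exists (fun i => match fintype.split i with inl j => q j | inr j => q' j end).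
exists (fun i => match fintype.split i with inl j => s j | inr j => s' j end).
split=> [i|]; first by case: (fintype.split i).
rewrite big_split_ord /=; congr (_ + _); apply: eq_bigr => i _.
  by rewrite (unsplitK (inl i)).
by rewrite (unsplitK (inr i)).
Qed.

Lemma qspanN (S : set R) x : qspan S x -> qspan S (- x).
Proof. by rewrite -mulN1r => h; apply: qspanZ h; exact: (israt_sgn 1). Qed.

Lemma qspanB (S : set R) x y : qspan S x -> qspan S y -> qspan S (x - y).
Proof. by move=> hx hy; apply: qspanD => //; exact: qspanN. Qed.

Lemma qspan_sum (S : set R) I (r : seq I) (P : pred I) (F : I -> R) :
  (forall i, P i -> qspan S (F i)) -> qspan S (\sum_(i <- r | P i) F i).
Proof. by move=> h; apply: big_ind => //; [exact: qspan0|move=> x y; exact: qspanD]. Qed.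

Lemma qspan_trans (S T : set R) : S `<=` qspan T -> qspan S `<=` qspan T.
Proof.
move=> ST x [d [q [s [hs ->]]]]; apply: qspan_sum => i _.
by apply: qspanZ; [exists (q i)|exact: ST].
Qed.

Lemma qspan_le (S T : set R) : S `<=` T -> qspan S `<=` qspan T.
Proof. by move=> ST; apply: qspan_trans => x /ST; exact: qspan_sub. Qed.

Lemma qspanM (S T U : set R) x y : (forall s t, S s -> T t -> qspan U (s * t)) ->
  qspan S x -> qspan T y -> qspan U (x * y).
Proof.
move=> h [d [q [s [hs ->]]]] [d' [q' [s' [hs' ->]]]].
rewrite mulr_suml; apply: qspan_sum => i _; rewrite mulr_sumr; apply: qspan_sum => j _.
by rewrite mulrACA; apply: qspanZ (h _ _ (hs i) (hs' j)); apply: isratM; eexists.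
Qed.

Lemma Zspan_depth_le_mono w m m' : m <= m' -> Zspan_depth_le R w m `<=` Zspan_depth_le R w m'.
Proof.
by move=> mm; apply: qspan_le => x [a [ha wa da] <-]; exists a => //; split=> //; exact: le_trans mm.
Qed.

Lemma Zspan_depth_le_Zspan w m : Zspan_depth_le R w m `<=` Zspan R w.
Proof. by apply: qspan_le => x [a [ha wa da] <-]; exists a. Qed.

Lemma Zspan_depth_le_neg w m x : m < 0 -> Zspan_depth_le R w m x -> x = 0.
Proof.
move=> m0 [d [q [s [hs ->]]]]; apply: big1 => i _.
by have [a [_ _ da] _] := hs i; move: (le_lt_trans da m0).
Qed.

Lemma Zspan_depth_le_zeta r : is_index r -> radm r ->
  Zspan_depth_le R (sumn r) (size r)%:Z (zeta R (rev r)).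
Proof.
move=> ir ar; apply: qspan_sub; exists (rev r) => //.
by split; rewrite ?admissible_rev ?ir// /weight /depth ?sumn_rev ?size_rev.
Qed.

Lemma Zspan_zeta k : admissible k -> Zspan R (sumn k) (zeta R k).
Proof. by move=> hk; apply: qspan_sub; exists k. Qed.

Lemma big_pow a b : (b <= a)%N -> big (fun N => N%:R^-1 ^+ b) (fun N => N%:R^-1 ^+ a : R).
Proof.
move=> ba; exists 1, 0%N; split=> // N N0; rewrite expr0 !mul1r.
rewrite ger0_norm ?exprn_ge0 ?invr_ge0// ler_wiXn2l ?invr_ge0//.
by rewrite invf_le1 ?ltr0n// ler1n.
Qed.

Lemma zr_consB a r N : (0 < N)%N ->
  zr R r N * N%:R^-1 ^+ a = zr R (a :: r) N.+1 - zr R (a :: r) N.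
Proof. by move=> N0; rewrite zr_consS// addrAC subrr add0r mulrC. Qed.

Lemma plog_zr r : is_index r -> plog (zr R r).
Proof.
elim: r => [|a r IH] /=.
  by move=> _; apply: (eq_big_asy (f := fun=> 1)) (plog_cst _ _ _) => N _; rewrite zr_nil.
move=> /andP[a0 ir]; apply: plog_of_increments.
by apply: eq_big_asy (zr_consB a r) _; exact: big_le (plogM _ (IH ir) (big_pow a0)).
Qed.

Lemma zr_adm r : is_index r -> radm r -> sml (fun N => zr R r N - zeta R (rev r)).
Proof.
move=> ir ar; suff [l hl] : exists l, sml (fun N => zr R r N - l).
  by have -> : zeta R (rev r) = l by apply: cvg_lim => //; exact: sml_cvg hl.
case: r ir ar => [|a r] ir ar.
  by exists 1; apply: eq_big_asy (big0 _ _ (@isqrt_ge0 R)) => N _; rewrite zr_nil subrr.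
have [|l [C [C0 hC]]] := @cvg_of_increments R (zr R (a :: r)).
  apply: eq_big_asy (zr_consB a r) _.
  apply: big_le (plogM _ (plog_zr _) (big_pow (b := 2) _)) => //.
    by move=> N _; rewrite exprVn.
  by case/andP: ir.
by exists l; exact: sml_rate hC.
Qed.

Lemma zeta_mul r s : is_index r -> is_index s -> radm r -> radm s ->
  zeta R (rev r) * zeta R (rev s) = \sum_(x <- stuffle r s) zeta R (rev x).
Proof.
move=> ir js ar bs.
have h x : x \in stuffle r s -> zr R x @ \oo --> zeta R (rev x).
  move=> hx; apply/sml_cvg/zr_adm; [exact: stuffle_index hx|exact: stuffle_radm hx].
have h1 : zr R r \* zr R s @ \oo --> zeta R (rev r) * zeta R (rev s).
  by apply: cvgM; apply/sml_cvg/zr_adm.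
have h2 : (fun N => \sum_(x <- stuffle r s) zr R x N) @ \oo -->
    \sum_(x <- stuffle r s) zeta R (rev x).
  rewrite big_seq; under eq_cvg do rewrite big_seq.
  by apply: cvg_big => [|x hx]; [exact: add_continuous|exact: h].
have h3 : zr R r \* zr R s @ \oo --> \sum_(x <- stuffle r s) zeta R (rev x).
  apply: cvg_trans h2; apply: near_eq_cvg; near=> N; rewrite /= zr_mul//.
  by near: N; exact: nbhs_infty_gt.
by rewrite -(cvg_lim _ h1)// -(cvg_lim _ h3).
Unshelve. all: by end_near.
Qed.

Lemma admissible_revP k : admissible k -> exists2 r, k = rev r & is_index r && radm r.
Proof. by move=> hk; exists (rev k); rewrite ?revK// -admissible_rev revK. Qed.

Lemma ZspanM w w' x y : Zspan R w x -> Zspan R w' y -> Zspan R (w + w') (x * y).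
Proof.
apply: qspanM => ? ? [k [/admissible_revP[r -> /andP[ir ar]] <-] <-].
move=> [k' [/admissible_revP[s -> /andP[js bs]] <-] <-].
rewrite zeta_mul// big_seq; apply: qspan_sum => z hz; apply: qspan_sub; exists (rev z) => //.
split; first by rewrite admissible_rev (stuffle_index ir js hz) (stuffle_radm ir js ar bs hz).
by rewrite /weight !sumn_rev (stuffle_sumn hz).
Qed.

Lemma Zspan_prodM w w' x y : (0 < w)%N -> (0 < w')%N -> Zspan R w x -> Zspan R w' y ->
  Zspan_prod R (w + w') (x * y).
Proof. by move=> w0 w0' hx hy; apply: qspan_sub; exists w, w'; split=> //; exists x => //; exists y. Qed.

Lemma zeta_nil : zeta R [::] = 1.
Proof.
rewrite /zeta (_ : zeta_trunc R [::] = fun=> 1); first exact: lim_cst.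
by apply/funext => N; exact: zeta_trunc_nil.
Qed.

Lemma Zspan_israt c : israt c -> Zspan R 0 c.
Proof.
move=> hc; rewrite -[c]mulr1; apply: qspanZ => //; apply: qspan_sub; exists [::] => //.
exact: zeta_nil.
Qed.

Lemma zr_single N : zr R [:: 1%N] N = harm R N.
Proof. by rewrite zr_cons; apply: eq_bigr => m _; rewrite zr_nil mulr1 expr1. Qed.

(** The variable is H_N rather than log N + gamma: multiplying by it is multiplying by the truncated
    sum of the word (1), which the stuffle product describes. *)
Definition pasym (f : nat -> R) (P : {poly R}) : Prop := sml (fun N => f N - P.[harm R N]).

Lemma eq_pasym f g P : (forall N, (0 < N)%N -> f N = g N) -> pasym f P -> pasym g P.
Proof. by move=> fg; apply: eq_big_asy => N N0; rewrite fg. Qed.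

Lemma pasym_cst c : pasym (fun=> c) c%:P.
Proof. by apply: eq_big_asy (big0 _ _ (@isqrt_ge0 R)) => N _; rewrite hornerC subrr. Qed.

Lemma pasymD f g P Q : pasym f P -> pasym g Q -> pasym (fun N => f N + g N) (P + Q).
Proof.
move=> hf hg; apply: eq_big_asy (bigD _ (@isqrt_ge0 R) hf hg) => // N _.
by rewrite hornerD opprD addrACA.
Qed.

Lemma pasymZ c f P : pasym f P -> pasym (fun N => c * f N) (c *: P).
Proof.
by move=> hf; apply: eq_big_asy (bigZ _ c hf) => // N _; rewrite hornerZ mulrBr.
Qed.

Lemma pasym_harm f P : pasym f P -> pasym (fun N => f N * harm R N) (P * 'X).
Proof.
move=> hf; apply: eq_big_asy (plogM _ (plog_harm R) hf) => // N _.
by rewrite hornerMX mulrBr ![harm R N * _]mulrC.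
Qed.

Lemma pasymXn f P n : pasym f P -> pasym (fun N => f N * harm R N ^+ n) (P * 'X^n).
Proof.
move=> hf; elim: n => [|n IH]; first by rewrite expr0 mulr1; apply: eq_pasym hf => N _; rewrite expr0 mulr1.
by rewrite exprSr mulrA; apply: eq_pasym (pasym_harm IH) => N _; rewrite exprSr mulrA.
Qed.

Lemma pasym_sum I (r : seq I) (f : I -> nat -> R) (P : I -> {poly R}) :
  (forall i, pasym (f i) (P i)) -> pasym (fun N => \sum_(i <- r) f i N) (\sum_(i <- r) P i).
Proof.
move=> h; elim: r => [|i r IH].
  by rewrite big_nil; apply: eq_pasym (pasym_cst 0) => N _; rewrite big_nil.
by rewrite big_cons; apply: eq_pasym (pasymD (h i) IH) => N _; rewrite big_cons.
Qed.

(** Division by u removes the constant term in the limit, so the remaining polynomial also tends to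
    0 and induction applies. All uniqueness statements for regularization polynomials rest on
    this. *)
Lemma poly_cvg0 (T : Type) (F : set_system T) {FF : ProperFilter F} (u : T -> R) (D : {poly R}) :
  u @ F --> +oo -> D.[u x] @[x --> F] --> (0 : R) -> D = 0.
Proof.
move=> hu.
have u0 : \forall x \near F, 0 < u x by move/cvgryPgt: hu => /(_ 0).
have hv : (fun x => (u x)^-1) @ F --> (0 : R) by apply/gtr0_cvgV0.
elim/poly_ind: D => [//|D c IH].
under eq_cvg do rewrite hornerMXaddC.
move=> h; have D0 : D = 0.
  apply: IH.
  have h1 : ((D.[u x] * u x + c - c) * (u x)^-1) @[x --> F] --> (0 : R).
    rewrite -[X in _ --> X](mulr0 (0 - c)).
    by apply: cvgM => //; apply: cvgB => //; exact: cvg_cst.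
  apply: cvg_trans h1; apply: near_eq_cvg; near=> x.
  by rewrite addrK mulfK// gt_eqF//; near: x.
move: h; rewrite D0 mul0r add0r => h; have h' : (fun=> c) @ F --> (0 : R).
  by apply: cvg_trans h; apply: near_eq_cvg; near=> x; rewrite horner0 mul0r add0r.
suff -> : c = 0 by [].
by rewrite -(cvg_lim _ h')// (cvg_lim _ (cvg_cst c)).
Unshelve. all: by end_near.
Qed.

Lemma harm_cvgy : harm R @ \oo --> +oo.
Proof.
apply/cvgryPgt => A; near=> N.
apply: (@lt_le_trans _ _ (ln N%:R)); last exact: ln_le_harm.
rewrite -[A]expRK ltr_ln ?posrE ?expR_gt0//; last by rewrite ltr0n; near: N; exact: nbhs_infty_gt.
by near: N; exact: nbhs_infty_gtr.
Unshelve. all: by end_near.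
Qed.

Lemma pasym_uniq f P Q : pasym f P -> pasym f Q -> P = Q.
Proof.
move=> hP hQ; apply/eqP; rewrite -subr_eq0; apply/eqP.
apply: (poly_cvg0 harm_cvgy); apply: sml_cvg0.
apply: eq_big_asy (bigB _ (@isqrt_ge0 R) hQ hP) => // N _.
by rewrite hornerD hornerN opprB addrC subrKA.
Qed.

Lemma pasym_lim f P l : pasym f P -> sml (fun N => f N - l) -> P = l%:P.
Proof.
move=> hP hl; apply: pasym_uniq hP _.
by apply: eq_big_asy hl => N _; rewrite hornerC.
Qed.

(** Homogeneity in weight and a filtration by depth, the variable having weight 1 and depth 1. For j
    > d the depth bound is negative, so the degree is at most d. *)
Definition gr (w d : nat) (P : {poly R}) : Prop :=
  forall j, if (j <= w)%N then Zspan_depth_le R (w - j) (d%:Z - j%:Z) P`_j else P`_j = 0.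

Lemma gr0 w d : gr w d 0.
Proof. by move=> j; rewrite coef0; case: ifP => // _; exact: qspan0. Qed.

Lemma grD w d P Q : gr w d P -> gr w d Q -> gr w d (P + Q).
Proof.
move=> hP hQ j; move: (hP j) (hQ j); rewrite coefD; case: ifP => _; first exact: qspanD.
by move=> -> ->; rewrite addr0.
Qed.

Lemma grZ w d c P : israt c -> gr w d P -> gr w d (c *: P).
Proof.
move=> hc hP j; move: (hP j); rewrite coefZ; case: ifP => _; first exact: qspanZ.
by move=> ->; rewrite mulr0.
Qed.

Lemma grX w d P : gr w d P -> gr w.+1 d.+1 (P * 'X).
Proof.
move=> hP [|j]; rewrite coefMX /=; first exact: qspan0.
move: (hP j); rewrite ltnS subSS; case: ifP => // _; apply: Zspan_depth_le_mono; lia.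
Qed.

Lemma gr_le w d d' P : (d <= d')%N -> gr w d P -> gr w d' P.
Proof.
move=> dd hP j; move: (hP j); case: ifP => // _; apply: Zspan_depth_le_mono; lia.
Qed.

Lemma grC r : is_index r -> radm r -> gr (sumn r) (size r) (zeta R (rev r))%:P.
Proof.
move=> ir ar j; rewrite coefC; case: eqP => [->|_]; last by case: ifP => // _; exact: qspan0.
by rewrite leq0n subn0 subr0; exact: Zspan_depth_le_zeta.
Qed.

Lemma gr_coef w d P j : gr w d P -> (d < j)%N -> P`_j = 0.
Proof.
move=> hP dj; move: (hP j); case: ifP => // _; apply: Zspan_depth_le_neg; lia.
Qed.

Lemma gr_size w d P : gr w d P -> (size P <= d.+1)%N.
Proof. by move=> hP; apply/leq_sizeP => j hj; exact: gr_coef hP _. Qed.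

Definition regular (f : nat -> R) (w d : nat) : Prop := exists2 P, pasym f P & gr w d P.

Lemma regular_sum (I : eqType) (L : seq I) (f : I -> nat -> R) w d (c : I -> R) :
  (forall x, x \in L -> israt (c x)) -> (forall x, x \in L -> regular (f x) w d) ->
  regular (fun N => \sum_(x <- L) c x * f x N) w d.
Proof.
elim: L => [|x L IH] hc h.
  exists 0; last exact: gr0.
  by apply: eq_pasym (pasym_cst 0) => N _; rewrite big_nil.
have [P hP gP] := h x (mem_head _ _).
have [Q hQ gQ] := IH (fun y hy => hc y (mem_behead (s := x :: L) hy))
  (fun y hy => h y (mem_behead (s := x :: L) hy)).
exists (c x *: P + Q); last by apply: grD => //; apply: grZ => //; apply: hc; exact: mem_head.
by apply: eq_pasym (pasymD (pasymZ (c x) hP) hQ) => N _; rewrite big_cons.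
Qed.

Lemma lead1_nseq s r : is_index r -> radm r -> lead1 (nseq s 1%N ++ r) = s.
Proof.
rewrite /lead1 => ir ar; elim: s => [|s IH] /=; last by rewrite IH.
by case: r ir ar => [|[|[|a]] r].
Qed.

(** Induction on the number of leading ones. [stuffle_one] expresses (s + 1) times the word by H_N
    times the word with one letter 1 removed, minus words with at most s leading ones; without
    leading ones the sums converge. *)
Lemma zr_regular r : is_index r -> regular (zr R r) (sumn r) (size r).
Proof.
move: {2}(lead1 r).+1 (ltnSn (lead1 r)) => n; elim: n r => // n IH r; rewrite ltnS => rn ir.
have [r0 rE /andP[ir0 ar0]] := lead1P ir; move: rn rE; move: (lead1 r) => s sn rE.
case: s sn rE => [|s] sn rE.
  rewrite rE /=; exists (zeta R (rev r0))%:P; last exact: grC.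
  apply: eq_big_asy (zr_adm ir0 ar0) => N _; by rewrite hornerC.
have [L [hL sL lL]] := stuffle_one R s ir0 ar0.
set r1 := nseq s 1%N ++ r0.
have ir1 : is_index r1 by rewrite /is_index all_cat all_nseq orbT.
have [P hP gP] : regular (zr R r1) (sumn r1) (size r1) by apply: IH; rewrite ?lead1_nseq.
have zr1 N : (0 < N)%N ->
    zr R r N = (s.+1%:R)^-1 * (zr R r1 N * harm R N + -1 * \sum_(x <- L) zr R x N).
  move=> N0; rewrite -zr_single zr_mul// hL mulN1r addrK mulKf ?pnatr_eq0//.
  by rewrite rE.
have sr : sumn r = (sumn r1).+1 by rewrite rE /= /r1.
have zr2 : size r = (size r1).+1 by rewrite rE.
have [Q hQ gQ] : regular (fun N => \sum_(x <- L) 1 * zr R x N) (sumn r) (size r).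
  apply: regular_sum => [? _|x]; first exact: (israt_nat 1).
  move=> xL.
  have [P' hP' gP'] : regular (zr R x) (sumn x) (size x).
    apply: IH; first by apply: leq_trans (lL x xL) sn.
    by apply: stuffle_index (sL x xL).
  exists P' => //; have := sL x xL => hx.
  rewrite sr -[(sumn r1).+1]addn1 -(stuffle_sumn hx).
  by apply: gr_le gP'; have := stuffle_size hx; rewrite zr2 /= addn1.
exists (s.+1%:R^-1 *: (P * 'X + -1 *: Q)).
  apply: eq_pasym (pasymZ _ (pasymD (pasym_harm hP) (pasymZ (-1) hQ))) => N N0.
  by rewrite zr1//; under eq_bigr do rewrite mul1r.
apply: grZ; first exact/isratV/israt_nat.
apply: grD; first by rewrite sr zr2; exact: grX.
by apply: grZ => //; exact: (israt_sgn 1).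
Qed.

End Span.

(** * Coefficients of the renormalized product *)

Section Shift.
Variable R : realType.
Notation ps := (power_series R).
Notation ws := (word_series nat ps).

(** The origin of the binomial coefficients and of the signs in (2). The relation (t + 1) [tau] = t
    is Pascal's rule for the coefficients of (t / (1 + t))^a. *)
Lemma tau1_coef a l : (tau R 1 ^+ a) (a + l)%N = (-1) ^+ l * 'C(a + l - 1, l)%:R.
Proof.
have rec b c : (tau R 1 ^+ b.+1) c.+1 = (tau R 1 ^+ b) c - (tau R 1 ^+ b.+1) c.
  have /(congr1 (fun f : ps => (f * tau R 1 ^+ b) c.+1)) := tauE R 1.
  rewrite psXM -mulrA -exprS mulrDl ps_coefD psXM ps_cstM mul1r => <-.
  by rewrite addrAC subrr add0r.
elim: a l => [|a IHa] l.
  rewrite expr0 add0n ps_coef1; case: l => [|l]; first by rewrite expr0 mul1r.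
  by rewrite subSS subn0 bin_small ?mulr0.
elim: l => [|l IHl]; rewrite ?addnS addSn rec.
  have := IHa 0%N; rewrite addn0 => ->.
  by rewrite tau_low// subr0 !bin0.
move: IHl (IHa l.+1); rewrite addnS addSn => -> ->.
rewrite exprS !subSS !subn0 binS natrD; ring.
Qed.

Section Truncation.
Variable B : nat.

(** Comparison up to t^B only, because [push] sums over a finite list of letters. *)
Definition eqB (f g : ps) : Prop := forall b, (b <= B)%N -> f b = g b.

Lemma eqBM f f' g g' : eqB f f' -> eqB g g' -> eqB (f * g) (f' * g').
Proof.
move=> hf hg b bB; rewrite !ps_coefM; apply: eq_bigr => i _.
by rewrite hf ?hg//; have := ltn_ord i; lia.
Qed.

Lemma eqB_sum I (r : seq I) (f g : I -> ps) : (forall i, eqB (f i) (g i)) ->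
  eqB (\sum_(i <- r) f i) (\sum_(i <- r) g i).
Proof. by move=> h b bB; rewrite !ps_coef_sum; apply: eq_bigr => i _; exact: h. Qed.

Lemma eqB_prod (r : seq nat) (f g : nat -> ps) : (forall i, i \in r -> eqB (f i) (g i)) ->
  eqB (\prod_(i <- r) f i) (\prod_(i <- r) g i).
Proof.
elim: r => [|a r IH] h; first by rewrite !big_nil.
rewrite !big_cons; apply: eqBM; first by apply: h; exact: mem_head.
by apply: IH => i ir; apply: h; rewrite inE ir orbT.
Qed.

Definition letters := iota 0 B.+1.
(* The coefficients of the expansion of [tau m ^+ a] in powers of [m^-1]. *)
Definition gl (c a : nat) : ps :=
  if (a <= c)%N then ps_cst ((-1) ^+ (c - a) * 'C(c - 1, c - a)%:R) * psX ^+ c else 0.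

Lemma gl_coef c a (f : ps) b : (gl c a * f) b =
  if (a <= c <= b)%N then (-1) ^+ (c - a) * 'C(c - 1, c - a)%:R * f (b - c)%N else 0.
Proof.
rewrite /gl; case: (leqP a c) => ac /=; last by rewrite mul0r ps_coef0.
by rewrite -mulrA ps_cstM psXnM; case: ifP => _; rewrite ?mulr0.
Qed.

Lemma tau_gl m a : (0 < m)%N ->
  eqB (tau R m%:Z ^+ a) (\sum_(c <- letters) gl c a * ps_cst (m%:R^-1 ^+ c)).
Proof.
move=> m0 b bB; rewrite tau_dil; last by lia.
rewrite -rmorphXn /= ps_coef_sum (bigD1_seq b) ?iota_uniq//=; last by rewrite mem_iota; lia.
rewrite big1 ?addr0 => [|c cb]; last first.
  by rewrite gl_coef; case: ifP => // /andP[_ h] /=; rewrite ifF ?mulr0//; lia.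
rewrite gl_coef leqnn andbT subnn /=; case: leqP => ab; last by rewrite tau_low// mulr0.
have -> : (tau R 1 ^+ a) b = (-1) ^+ (b - a) * 'C(b - 1, b - a)%:R.
  by rewrite -{1}(subnKC ab) tau1_coef subnKC.
by rewrite mulrC pmulrn.
Qed.

(** The coefficient of t^c in (t / (t + m))^a is m^-c times a number independent of m. Hence one
    substitution, the same for all m, rebuilds every E_m and every product of them from leading
    coefficients. *)
Definition lift_top (F : word_series nat R) : ws := wpush letters gl (wmap (@ps_cst R) F).

Lemma lift_topM F G : lift_top (F * G) = lift_top F * lift_top G.
Proof. by rewrite /lift_top (wmapM (@ps_cst R)) wpushM. Qed.

Lemma expo_lift m w : (0 < m)%N -> eqB (expo R m%:Z w) (lift_top (topw (expo R m%:Z)) w).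
Proof.
move=> m0; rewrite topw_expo; last by lia.
rewrite /lift_top (_ : wmap _ _ = wexp (fps R) (fun a : nat => ps_cst (m%:R^-1 ^+ a))); last first.
  by apply: wsP => v /=; rewrite rmorphM rmorph_prod.
rewrite wpush_wexp /=; apply: eqBM => //.
by apply: eqB_prod => a _; exact: tau_gl.
Qed.

Lemma posp_lift N w : (0 < N)%N -> eqB (posp R N w) (lift_top (topw (posp R N)) w).
Proof.
case: N => // N _; elim: N w => [|N IH] w.
  rewrite /posp big_nil (_ : topw 1 = 1); last by apply: wsP => -[|a v] //=; rewrite if_same.
  by rewrite /lift_top (wmap1 _ (@ps_cst R)) wpush1.
rewrite pospS// topwM; [|exact: vanish_posp|by apply: vanish_expo; lia].
rewrite lift_topM !ws_coefM; apply: eqB_sum => i; apply: eqBM; first exact: IH.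
exact: expo_lift.
Qed.

End Truncation.

(** The sum over compositions in (2), in recursive form and with an arbitrary function in place of
    the zeta values. *)
Fixpoint shsum (h : seq nat) (a : nat) (F : seq nat -> R) : R :=
  if h is c :: h' then
    \sum_(l < a.+1) 'C(c + l - 1, l)%:R * shsum h' (a - l) (fun v => F ((c + l)%N :: v))
  else if a == 0%N then F [::] else 0.

Lemma big_iota_between B a A (f : nat -> R) : (a + A <= B)%N ->
  \sum_(c <- iota 0 B.+1) (if (a <= c <= a + A)%N then f c else 0) = \sum_(l < A.+1) f (a + l)%N.
Proof.
move=> aB; rewrite -[iota _ _]/(index_iota 0 B.+1) (@big_cat_nat _ _ _ a) //=; last by lia.
rewrite big_nat big1 ?add0r => [|c hc]; last by rewrite ifF//; lia.
rewrite (@big_cat_nat _ _ _ (a + A).+1) //=; [|lia..].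
rewrite [X in _ + X]big_nat [X in _ + X]big1 ?addr0 => [|c hc]; last by rewrite ifF//; lia.
rewrite -addnS -{1}[a]add0n big_addn addKn big_mkord; apply: eq_bigr => l _.
by rewrite addnC ifT//; have := ltn_ord l; lia.
Qed.

Lemma push_shsum B h F b : (b <= B)%N ->
  push (letters B) gl h (fun v => ps_cst (F v)) b =
  if (sumn h <= b)%N then (-1) ^+ (b - sumn h) * shsum h (b - sumn h) F else 0.
Proof.
elim: h b F => [|a h IH] b F bB /=.
  by rewrite subn0; case: eqP => [->|_]; rewrite ?expr0 ?mul1r ?mulr0.
rewrite ps_coef_sum.
rewrite (eq_bigr (fun c => if (a <= c <= b)%N then (-1) ^+ (c - a) * 'C(c - 1, c - a)%:R *
    (if (sumn h <= b - c)%N then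
       (-1) ^+ (b - c - sumn h) * shsum h (b - c - sumn h) (fun v => F (c :: v)) else 0) else 0)); last first.
  move=> c _; rewrite -IH; last exact: leq_trans (leq_subr _ _) bB.
  exact: gl_coef.
case: leqP => hb; last first.
  apply: big1 => c _; case: ifP => // hc; rewrite ifF ?mulr0//; lia.
have E : (a + (b - (a + sumn h)) <= B)%N by lia.
rewrite mulr_sumr.
pose f c := (-1) ^+ (b - (a + sumn h)) * ('C(c - 1, c - a)%:R * shsum h (b - (a + sumn h) - (c - a)) (fun v => F (c :: v))).
transitivity (\sum_(l < (b - (a + sumn h)).+1) f (a + l)%N); last first.
  by apply: eq_bigr => l _; rewrite /f addKn.
rewrite -(big_iota_between f E); apply: eq_bigr => c _; rewrite /f.
case: (ifP (a <= c <= b)%N) => hc; last by rewrite ifF//; lia.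
case: (leqP (sumn h) (b - c)) => hh; last by rewrite mulr0 ifF//; lia.
rewrite ifT; last by lia.
have -> : (b - (a + sumn h) = (c - a) + (b - c - sumn h))%N by lia.
by rewrite addKn exprD; ring.
Qed.

Lemma posp_shsum N h b : (0 < N)%N -> (sumn h <= b)%N ->
  posp R N h b = (-1) ^+ (b - sumn h) * shsum h (b - sumn h) (topw (posp R N)).
Proof. by move=> N0 hb; rewrite (posp_lift h N0 (leqnn b)) push_shsum// hb. Qed.

Lemma shift_index_cons A c h (x : 'I_A.+1) (t : (size h).-tuple 'I_A.+1) :
  @shift_index (c :: h) A (cons_tuple x t) = (c + x)%N :: shift_index t.
Proof.
rewrite /shift_index enum_ordSl /= tnth0; congr (_ :: _).
by rewrite -map_comp; apply: eq_map => i /=; rewrite tnthS.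
Qed.

Lemma shsum_tuple A h a (F : seq nat -> R) : (a <= A)%N -> shsum h a F =
  \sum_(l : (size h).-tuple 'I_A.+1 | (\sum_(i < size h) tnth l i)%N == a)
    (\prod_(i < size h) 'C(nth 0 h i + tnth l i - 1, tnth l i))%N%:R * F (@shift_index h A l).
Proof.
elim: h a F => [|c h IH] a F aA.
  rewrite big_mkcond (big_pred1 [tuple]) /=; last first.
    by move=> t; apply/esym/eqP; exact: tuple0.
  rewrite !big_ord0 mul1r eq_sym; case: eqP => // _; congr F.
  by rewrite /shift_index; case: (enum _) => //= -[].
rewrite [RHS]big_mkcond sum_tuple_cons [LHS]/=.
rewrite (big_ord_widen A.+1 (fun l => 'C(c + l - 1, l)%:R * shsum h (a - l) (fun v => F ((c + l)%N :: v)))) ?ltnS//.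
rewrite big_mkcond; apply: eq_bigr => x _; rewrite ltnS; case: leqP => xa; last first.
  rewrite big1// => t _; rewrite big_ord_recl tnth0 ifF//; apply/negbTE; lia.
rewrite (IH (a - x)%N); last by exact: leq_trans (leq_subr _ _) aA.
rewrite mulr_sumr big_mkcond; apply: eq_bigr => t _.
rewrite !big_ord_recl shift_index_cons !tnth0.
under [in RHS]eq_bigr do rewrite tnthS.
under [X in _ = if _ then (_ * X)%N%:R * _ else _]eq_bigr do rewrite tnthS.
have -> : ((x + \sum_(i < size h) tnth t i)%N == a) = ((\sum_(i < size h) tnth t i)%N == a - x)%N by lia.
by case: ifP => // _; rewrite natrM mulrA.
Qed.
End Shift.

(** * Constant terms: from S to regularized zeta values *)

Section Constants.
Variable R : realType.
Notation ps := (power_series R).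
Notation ws := (word_series nat ps).

(** The bound on the length is strict, so that taking for [d] the length of a word describes
    corrections of smaller depth. *)
Definition comb (k d : nat) (f : nat -> R) : Prop := exists L : seq (R * seq nat),
  (forall p, p \in L -> [/\ israt p.1, is_index p.2, sumn p.2 = k & (size p.2 < d)%N]) /\
  forall N, (0 < N)%N -> f N = \sum_(p <- L) p.1 * zr R p.2 N.

Lemma eq_comb k d f g : (forall N, (0 < N)%N -> f N = g N) -> comb k d f -> comb k d g.
Proof. by move=> fg [L [hL fL]]; exists L; split=> // N N0; rewrite -fg// fL. Qed.

Lemma comb0 k d : comb k d (fun=> 0).
Proof. by exists [::]; split=> // N _; rewrite big_nil. Qed.

Lemma combD k d f g : comb k d f -> comb k d g -> comb k d (fun N => f N + g N).
Proof.
move=> [L [hL fL]] [L' [hL' fL']]; exists (L ++ L'); split=> [p|N N0].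
  by rewrite mem_cat => /orP[/hL|/hL'].
by rewrite big_cat fL// fL'.
Qed.

Lemma combZ k d c f : israt c -> comb k d f -> comb k d (fun N => c * f N).
Proof.
move=> hc [L [hL fL]]; exists [seq (c * p.1, p.2) | p <- L]; split=> [p /mapP[q /hL[]]|N N0].
  by move=> *; subst p; split=> //=; exact: isratM.
by rewrite fL// big_map mulr_sumr; apply: eq_bigr => p _; rewrite mulrA.
Qed.

Lemma comb_sum k d n (f : 'I_n -> nat -> R) :
  (forall i, comb k d (f i)) -> comb k d (fun N => \sum_(i < n) f i N).
Proof.
move=> h; rewrite /index_enum; elim: (Finite.enum _) => [|i r IH].
  by apply: eq_comb (comb0 k d) => N _; rewrite big_nil.
by apply: eq_comb (combD (h i) IH) => N _; rewrite big_cons.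
Qed.

Lemma comb_le k d d' f : (d <= d')%N -> comb k d f -> comb k d' f.
Proof.
move=> dd [L [hL fL]]; exists L; split=> // p /hL[? ? ? sp]; split=> //; exact: leq_trans dd.
Qed.

Lemma comb_zr r : is_index r -> comb (sumn r) (size r).+1 (zr R r).
Proof.
move=> ir; exists [:: (1, r)]; split=> [p|N _]; last by rewrite big_seq1 mul1r.
by rewrite inE => /eqP -> /=; split=> //; exact: (israt_nat R 1).
Qed.

Lemma comb_int k d s f : (0 < s)%N -> comb k d f ->
  comb (s + k) d.+1 (fun N => \sum_(1 <= m < N) m%:R^-1 ^+ s * f m).
Proof.
move=> s0 [L [hL fL]]; exists [seq (p.1, s :: p.2) | p <- L]; split=> [p /mapP[q /hL[]]|N N0].
  by move=> ? iq sq ? ->; split=> //=; rewrite ?s0 ?sq.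
rewrite big_map /=; under [RHS]eq_bigr do rewrite zr_cons mulr_sumr.
rewrite exchange_big /= big_nat [RHS]big_nat; apply: eq_bigr => m /andP[m0 _].
by rewrite fL// mulr_sumr; apply: eq_bigr => p _; rewrite mulrCA.
Qed.

Lemma comb_regular k d f : comb k d.+1 f -> regular f k d.
Proof.
move=> [L [hL fL]].
have [P hP gP] : regular (fun N => \sum_(p <- L) p.1 * zr R p.2 N) k d.
  apply: regular_sum => p /hL[] // _ ip pk sp.
  have [P hP gP] := zr_regular R ip; exists P => //; rewrite -pk; exact: gr_le gP.
by exists P => //; apply: eq_pasym hP => N N0; rewrite fL.
Qed.

Lemma topw_posp_rec w N : w != [::] -> (0 < N)%N -> topw (posp R N) w =
  \sum_(i < size w) ifact R (size w - i) *
    \sum_(1 <= m < N) m%:R^-1 ^+ sumn (drop i w) * topw (posp R m) (take i w).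
Proof.
move=> w0; case: N => // N _; elim: N => [|N IH].
  rewrite /posp big_nil big1 => [|i _]; last by rewrite big_geq ?mulr0.
  by case: w w0 => //= a v _; rewrite if_same.
rewrite pospS// topwM; [|exact: vanish_posp|by apply: vanish_expo; lia].
rewrite ws_coefM_recr topw_expo; last by lia.
have -> : wexp (ifact R) (fun a : nat => (N.+1%:~R : R)^-1 ^+ a) [::] = 1.
  by rewrite /= /ifact fact0 invr1 big_nil mulr1.
rewrite mulr1 IH -big_split; apply: eq_bigr => i _ /=.
rewrite [in RHS]big_nat_recr//= mulrDr addrC; congr (_ + _).
rewrite size_drop mulrC -mulrA; congr (_ * (_ * _)).
by elim: (drop i w) => [|a v IHv]; rewrite ?big_nil// big_cons IHv -exprD.
Qed.

(** The leading coefficient of the half product is a sum over weakly increasing indices with weight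
    1 / j! at a tie of j indices. The strictly increasing part is the truncated zeta value; ties
    merge letters and lower the depth. *)
Lemma topw_posp_comb w : is_index w -> exists2 g, comb (sumn w) (size w) g &
  forall N, (0 < N)%N -> topw (posp R N) w = zr R (rev w) N + g N.
Proof.
move: {2}(size w).+1 (ltnSn (size w)) => n; elim: n w => // n IH w; rewrite ltnS.
case/lastP: w => [|u a] wn iw.
  by exists (fun=> 0) => [|N _]; [exact: comb0|rewrite addr0 zr_nil /= posp_nil].
move: wn; rewrite size_rcons => wn.
have [a0 iu] : (0 < a)%N /\ is_index u by move: iw; rewrite /is_index all_rcons => /andP.
have [gu cu hu] := IH u wn iu.
exists (fun N => \sum_(m < size u) ifact R (size (rcons u a) - m) *
    (\sum_(1 <= l < N) l%:R^-1 ^+ sumn (drop m (rcons u a)) *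
       topw (posp R l) (take m (rcons u a))) + \sum_(1 <= m < N) m%:R^-1 ^+ a * gu m).
  apply: combD; last by rewrite sumn_rcons addnC; exact: comb_int.
  apply: comb_sum => i; apply: combZ; first exact: israt_ifact.
  have iv := is_index_take i iw; have sv : size (take i (rcons u a)) = i.
    by rewrite size_take size_rcons ltnS ltnW// ltn_ord.
  have [|g cg hg] := IH (take i (rcons u a)) _ iv; first by rewrite sv; have := ltn_ord i; lia.
  have -> : sumn (rcons u a) = (sumn (drop i (rcons u a)) + sumn (take i (rcons u a)))%N.
    by rewrite -{1}(cat_take_drop i (rcons u a)) sumn_cat addnC.
  apply: (@comb_le _ i.+2); first by have := ltn_ord i; lia.
  apply: comb_int.
    rewrite -(cat_take_drop i (rcons u a)) in iw.
    have iw' : is_index (drop i (rcons u a)) by move: iw; rewrite /is_index all_cat => /andP[].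
    apply: leq_trans (size_le_sumn iw'); rewrite size_drop size_rcons; have := ltn_ord i; lia.
  apply: (@eq_comb _ _ (fun N => zr R (rev (take i (rcons u a))) N + g N)).
    by move=> N N0; rewrite hg.
  apply: combD; last by apply: comb_le cg; rewrite sv.
  have := @comb_zr (rev (take i (rcons u a))); rewrite is_index_rev sumn_rev size_rev sv; exact.
move=> N N0; rewrite topw_posp_rec//; last by case: (u).
rewrite size_rcons big_ord_recr /= [RHS]addrCA; congr (_ + _).
rewrite subSnn.
have -> : ifact R (1%N) = 1 by rewrite /ifact factS fact0 invr1.
rewrite mul1r rev_rcons zr_cons -big_split big_nat [RHS]big_nat.
apply: eq_bigr => m /andP[m0 _] /=.
rewrite drop_rcons// drop_size (_ : take (size u) (rcons u a) = u); last by rewrite -cats1 take_size_cat.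
by rewrite /= addn0 -mulrDr; congr (_ * _); exact: hu.
Qed.

Definition pconst (f : nat -> R) (c : R) : Prop := exists2 P, pasym f P & P`_0 = c.

Lemma pconst_uniq f c d : pconst f c -> pconst f d -> c = d.
Proof. by move=> [P hP <-] [Q hQ <-]; rewrite (pasym_uniq hP hQ). Qed.

Lemma eq_pconst f g c : (forall N, (0 < N)%N -> f N = g N) -> pconst f c -> pconst g c.
Proof. by move=> fg [P hP cP]; exists P => //; exact: eq_pasym hP. Qed.

Lemma pconst_cst c : pconst (fun=> c) c.
Proof. by exists c%:P; [exact: pasym_cst|rewrite coefC]. Qed.

Lemma pconstD f g c d : pconst f c -> pconst g d -> pconst (fun N => f N + g N) (c + d).
Proof.
by move=> [P hP <-] [Q hQ <-]; exists (P + Q); [exact: pasymD|rewrite coefD].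
Qed.

Lemma pconstZ a f c : pconst f c -> pconst (fun N => a * f N) (a * c).
Proof. by move=> [P hP <-]; exists (a *: P); [exact: pasymZ|rewrite coefZ]. Qed.

Lemma pconst_harm f c n : (0 < n)%N -> pconst f c -> pconst (fun N => f N * harm R N ^+ n) 0.
Proof.
move=> n0 [P hP _]; exists (P * 'X^n); first exact: pasymXn.
by rewrite coefMXn n0.
Qed.

Lemma pconst_sum n (f : 'I_n -> nat -> R) c : (forall i, pconst (f i) (c i)) ->
  pconst (fun N => \sum_(i < n) f i N) (\sum_(i < n) c i).
Proof.
move=> h; rewrite /index_enum; elim: (Finite.enum _) => [|i r IH].
  by rewrite big_nil; apply: eq_pconst (pconst_cst 0) => N _; rewrite big_nil.
by rewrite big_cons; apply: eq_pconst (pconstD (h i) IH) => N _; rewrite big_cons.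
Qed.

Lemma pconst_sum0 n (f : 'I_n -> nat -> R) : (forall i, pconst (f i) 0) ->
  pconst (fun N => \sum_(i < n) f i N) 0.
Proof. by move=> /pconst_sum; rewrite big1. Qed.

Lemma shsum_pconst h a (F : seq nat -> nat -> R) G : is_index h ->
  (forall v, is_index v -> pconst (F v) (G v)) ->
  pconst (fun N => shsum h a (F^~ N)) (shsum h a G).
Proof.
elim: h a F G => [|c h IH] a F G /=.
  by move=> _ hF; case: eqP => _; [exact: hF|exact: pconst_cst].
move=> /andP[c0 ih] hF; apply: pconst_sum => l; apply: pconstZ.
apply: (IH _ (fun v => F ((c + l)%N :: v)) (fun v => G ((c + l)%N :: v))) => // v iv.
by apply: hF; rewrite /= addn_gt0 c0.
Qed.

(* Renormalising by [exp(- H_N t)] only adds multiples of [H_N], so it keeps the constant term. *)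
Lemma Sreg_pconst w b : is_index w ->
  (forall v c, is_index v -> exists d, pconst (fun N => posp R N v c) d) ->
  pconst (fun N => posp R N w b) (Sreg R w b).
Proof.
move=> iw ex; have [d hd] := ex w b iw; suff -> : Sreg R w b = d by [].
have h : pconst (fun N => ren R N w b) (0 + d).
  apply: (@eq_pconst (fun N => (\sum_(i < size w) (if allones (drop i w) then
     ifact R (size w - i) * (- harm R N) ^+ (size w - i) *
     (if (size w - i <= b)%N then posp R N (take i w) (b - (size w - i))%N else 0) else 0)) +
     posp R N w b)).
    by move=> N _; rewrite /ren xe_split.
  apply: pconstD => //; apply: pconst_sum0 => i; case: (allones _); last exact: pconst_cst.
  case: (_ <= b)%N; last by apply: eq_pconst (pconst_cst 0) => N _; rewrite mulr0.
  have [c hc] := ex (take i w) (b - (size w - i))%N (is_index_take i iw).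
  have n0 : (0 < size w - i)%N by rewrite subn_gt0.
  have := pconstZ (ifact R (size w - i) * (-1) ^+ (size w - i)) (pconst_harm n0 hc).
  rewrite mulr0; apply: eq_pconst => N _; rewrite [(- harm R N) ^+ _]exprNn; ring.
apply: pconst_uniq (_ : pconst (fun N => ren R N w b) _) _; last by rewrite -[d]add0r; exact: h.
exists (Sreg R w b)%:P; last by rewrite coefC.
have [C C0 hC] := ren_rate R b iw.
by apply: eq_big_asy (sml_rate C0 hC) => N _; rewrite hornerC.
Qed.

Lemma topw_posp_ex w : is_index w -> exists d, pconst (fun N => topw (posp R N) w) d.
Proof.
move=> iw; have [g cg hg] := topw_posp_comb iw.
have [P hP _] := comb_regular (comb_le (leqnSn _) cg).
have [Q hQ _] := zr_regular R (etrans (is_index_rev w) iw).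
exists (Q + P)`_0, (Q + P) => //.
by apply: eq_pasym (pasymD hQ hP) => N N0; rewrite hg.
Qed.

Lemma posp_pconst v c : is_index v -> exists d, pconst (fun N => posp R N v c) d.
Proof.
move=> iv; case: (leqP (sumn v) c) => vc; last first.
  by exists 0; apply: eq_pconst (pconst_cst 0) => N _; rewrite vanish_posp.
(* The default 0 is never met at an index, by [topw_posp_ex]. *)
pose G u := xget (0 : R) [set d | pconst (fun N => topw (posp R N) u) d].
have hG u : is_index u -> pconst (fun N => topw (posp R N) u) (G u).
  by move=> /topw_posp_ex; exact: xgetPex.
exists ((-1) ^+ (c - sumn v) * shsum v (c - sumn v) G).
apply: eq_pconst (pconstZ _ (shsum_pconst _ iv hG)) => N N0.
by rewrite posp_shsum.
Qed.

(** The identity [posp_shsum] holds for all positive N, hence for constant terms, and these are not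
    affected by the renormalization. *)
Lemma Sreg_shift w b : is_index w -> (sumn w <= b)%N ->
  Sreg R w b = (-1) ^+ (b - sumn w) * shsum w (b - sumn w) (fun v => Sreg R v (sumn v)).
Proof.
move=> iw hb; apply: pconst_uniq (Sreg_pconst b iw posp_pconst) _.
have h v : is_index v -> pconst (fun N => topw (posp R N) v) (Sreg R v (sumn v)).
  by move=> iv; exact: (Sreg_pconst _ iv posp_pconst).
apply: eq_pconst (pconstZ _ (shsum_pconst _ iw h)) => N N0.
by rewrite posp_shsum.
Qed.

Lemma Sreg_top w : is_index w -> w != [::] -> exists P, [/\ pasym (zr R (rev w)) P,
  gr (sumn w) (size w) P & Zspan_depth_le R (sumn w) ((size w)%:Z - 1) (Sreg R w (sumn w) - P`_0)].
Proof.
move=> iw w0; have [g cg hg] := topw_posp_comb iw.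
have [P hP gP] : regular g (sumn w) (size w).-1.
  by apply: comb_regular; case: (w) w0 cg.
have [Q hQ gQ] := zr_regular R (etrans (is_index_rev w) iw).
exists Q; split=> //; first by rewrite sumn_rev size_rev in gQ.
have -> : Sreg R w (sumn w) = (Q + P)`_0.
  apply: pconst_uniq (Sreg_pconst _ iw posp_pconst) _; exists (Q + P) => //.
  by apply: eq_pasym (pasymD hQ hP) => N N0; rewrite -hg.
rewrite coefD addrAC subrr add0r; have := gP 0%N; rewrite ?leq0n subn0 subr0.
by apply: Zspan_depth_le_mono; case: (w) w0 => //= *; lia.
Qed.

Lemma shsum_span (S : set R) h a F : is_index h ->
  (forall v, is_index v -> sumn v = (sumn h + a)%N -> size v = size h -> qspan S (F v)) ->
  qspan S (shsum h a F).
Proof.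
elim: h a F => [|c h IH] a F /=.
  by move=> _; case: eqP => [-> hF|_ _]; [exact: hF|exact: qspan0].
move=> /andP[c0 ih] hF; apply: qspan_sum => l _; apply: qspanZ; first exact: israt_nat.
apply: IH => // v iv sv zv; apply: hF; rewrite /= ?addn_gt0 ?c0 ?zv// sv.
by have := ltn_ord l; lia.
Qed.

Lemma shsumB h a F G : shsum h a F - shsum h a G = shsum h a (fun v => F v - G v) :> R.
Proof.
elim: h a F G => [|c h IH] a F G /=; first by case: eqP => _; rewrite ?subr0.
by rewrite -sumrB; apply: eq_bigr => l _; rewrite -mulrBr IH.
Qed.

(** [Sreg_shift] keeps the length of the word while raising its weight to b, and leading
    coefficients are controlled by [Sreg_top]. *)
Lemma Sreg_depth w b : is_index w -> (0 < b)%N ->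
  Zspan_depth_le R b (size w)%:Z (Sreg R w b).
Proof.
move=> iw b0; case: w iw => [|a w] iw.
  by rewrite Sreg_nil ps_coef1 gtn_eqF//; exact: qspan0.
case: (leqP (sumn (a :: w)) b) => wb; last by rewrite vanish_Sreg//; exact: qspan0.
rewrite Sreg_shift//; apply: qspanZ; first exact: israt_sgn.
apply: shsum_span => // v iv sv zv; rewrite subnKC// in sv.
have v0 : v != [::] by rewrite -size_eq0 zv.
have [P [hP gP]] := Sreg_top iv v0; rewrite sv zv => hd.
rewrite -[Sreg R v b](subrK P`_0); apply: qspanD.
  by apply: (Zspan_depth_le_mono _ hd); lia.
by have := gP 0%N; rewrite ?leq0n subn0 subr0 sv zv.
Qed.

End Constants.

(** * Regularizations *)

Section SeriesRegularization.
Variable R : realType.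

Lemma harm_ln_gamma : sml (fun N => harm R N - (ln N%:R + euler_gamma R)).
Proof.
pose f N : R := harm R N - ln N%:R.
have [|l [C [C0 hC]]] := @cvg_of_increments R f.
  exists 1, 0%N; split=> // N N0; rewrite expr0 !mul1r /f harmS//.
  have /andP[h1 h2] := lnS_bounds R N0.
  have N1 : (1 : R) <= N%:R by rewrite ler1n.
  have -> : harm R N + N%:R^-1 - ln N.+1%:R - (harm R N - ln N%:R) =
     N%:R^-1 - (ln N.+1%:R - ln N%:R) by ring.
  have h3 : N%:R^-1 - N.+1%:R^-1 <= (N%:R ^+ 2)^-1 :> R.
    rewrite -subr_ge0 -natr1.
    have -> : (N%:R ^+ 2)^-1 - (N%:R^-1 - (N%:R + 1)^-1) = ((N%:R ^+ 2) * (N%:R + 1))^-1 :> R.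
      by field; lra.
    by rewrite invr_ge0 mulr_ge0 ?exprn_ge0//; lra.
  move: h1 h2 h3; move: (ln N.+1%:R) (ln N%:R) (N.+1%:R^-1) (N%:R^-1) (N%:R ^- 2) => a b c d e h1 h2 h3.
  by rewrite ger0_norm; lra.
suff -> : euler_gamma R = l.
  apply: eq_big_asy (sml_rate C0 hC) => N _; rewrite /f; ring.
apply: cvg_lim => //.
(* The definition of gamma includes the term 1 / N, whereas [harm N] stops at N - 1. *)
have h1 : (fun N => f N + N%:R^-1) @ \oo --> l + 0.
  apply: cvgD; first by apply: sml_cvg; exact: sml_rate hC.
  apply/gtr0_cvgV0; last exact: cvgr_idn.
  by near=> N; rewrite ltr0n; near: N; exact: nbhs_infty_gt.
rewrite addr0 in h1; apply: cvg_trans h1; apply: near_eq_cvg; near=> N.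
rewrite /f addrAC -harmS; last by near: N; exact: nbhs_infty_gt.
by rewrite /series /= /harm big_add1.
Unshelve. all: by end_near.
Qed.

Lemma sml_horner (P : {poly R}) (u : nat -> R) : sml (fun N => harm R N - u N) ->
  sml (fun N => P.[harm R N] - P.[u N]).
Proof.
move=> hu; elim/poly_ind: P => [|P c IH].
  by apply: eq_big_asy (big0 _ _ (@isqrt_ge0 R)) => N _; rewrite !horner0 subrr.
have pP : plog (fun N => P.[harm R N]).
  elim/poly_ind: P {IH} => [|P d IH].
    by apply: eq_big_asy (plog_cst _ _ 0) => N _; rewrite horner0.
  apply: (@eq_big_asy _ _ _ _ _ (fun N => P.[harm R N] * harm R N + d)).
    by move=> N _; rewrite hornerMXaddC.
  apply: bigD => //; [by apply: plogM => //; exact: plog_harm|exact: plog_cst].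
have pu : plog u.
  apply: (@eq_big_asy _ _ _ _ _ (fun N => harm R N - (harm R N - u N))).
    by move=> N _; rewrite opprB addrC subrK.
  by apply: bigB => //; [exact: plog_harm|exact: sml_plog].
apply: (@eq_big_asy _ _ _ _ _ (fun N => P.[harm R N] * (harm R N - u N) +
   u N * (P.[harm R N] - P.[u N]))).
  by move=> N _; rewrite !hornerMXaddC; ring.
by apply: (bigD _ (@isqrt_ge0 R)) => //; exact: plogM.
Qed.

Lemma reg_poly_series k P : pasym (zeta_trunc R k) P -> reg_poly R SeriesReg k = P.
Proof.
move=> hP.
have h : is_reg_poly SeriesReg k P.
  apply: sml_cvg0.
  apply: eq_big_asy (bigD _ (@isqrt_ge0 R) hP (sml_horner P harm_ln_gamma)) => // N _.
  by rewrite subrKA.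
apply: xget_unique => // Q hQ; apply/eqP; rewrite -subr_eq0; apply/eqP.
apply: (@poly_cvg0 R _ \oo _ (fun N : nat => ln N%:R + euler_gamma R)).
  apply/cvgryPgt => A; near=> N; rewrite -ltrBlDr -[A - _]expRK ltr_ln ?posrE ?expR_gt0//.
    by near: N; exact: nbhs_infty_gtr.
  by rewrite ltr0n; near: N; exact: nbhs_infty_gt.
have hs := cvgB h hQ; rewrite subr0 in hs.
rewrite (_ : (fun N : nat => _) = (fun M : nat => zeta_trunc R k M - P.[ln M%:R + euler_gamma R]) -
  (fun M : nat => zeta_trunc R k M - Q.[ln M%:R + euler_gamma R])); first exact: hs.
by apply/funext => N; rewrite hornerD hornerN;
  transitivity ((zeta_trunc R k N - P.[ln N%:R + euler_gamma R]) -
    (zeta_trunc R k N - Q.[ln N%:R + euler_gamma R])); first ring.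
Unshelve. all: by end_near.
Qed.

(** The other words of the stuffle product have weight j + 1 and a letter at least 2, hence depth at
    most j, and leave the leading coefficient untouched; each step divides it by j + 1. *)
Lemma ones_regular j : exists U, [/\ pasym (zr R (nseq j 1%N)) U, gr j j U & U`_j = ifact R j].
Proof.
elim: j => [|j [U [hU gU cU]]].
  exists (1%:P); split; [|by rewrite -(zeta_nil R); exact: (@grC R [::])|by rewrite coefC /ifact fact0 invr1].
    by apply: eq_pasym (pasym_cst 1) => N _; rewrite zr_nil.
have [L [hL sL lL]] := @stuffle_one R j [::] isT isT.
rewrite cats0 in hL sL lL.
have ij : is_index (nseq j 1%N) by rewrite /is_index all_nseq orbT.
have sj : sumn (nseq j 1%N) = j by rewrite sumn_nseq mul1n.
have [Q hQ gQ] : regular (fun N => \sum_(x <- L) 1 * zr R x N) j.+1 j.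
  apply: regular_sum => [? _|x xL]; first exact: (israt_nat _ 1).
  have ix := stuffle_index ij (isT : is_index [:: 1%N]) (sL x xL).
  have sx := stuffle_sumn (sL x xL); rewrite sj /= addn0 addn1 in sx.
  have [P hP gP] := zr_regular R ix; exists P => //; rewrite -sx; apply: gr_le gP.
  have [r0 xE /andP[ir0 ar0]] := lead1P ix; have := lL x xL; have := sx.
  rewrite {1}xE sumn_cat sumn_nseq mul1n {3}xE size_cat size_nseq.
  case: r0 ir0 ar0 {xE} => [|a r0] /=; first by lia.
  by move=> /andP[_ ir0] a1; have := size_le_sumn ir0; lia.
exists (j.+1%:R^-1 *: (U * 'X + -1 *: Q)); split.
- apply: eq_pasym (pasymZ _ (pasymD (pasym_harm hU) (pasymZ (-1) hQ))) => N N0.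
  under [in LHS]eq_bigr do rewrite mul1r.
  have := zr_mul R (nseq j 1%N) [:: 1%N] N0; rewrite zr_single hL => ->.
  by rewrite mulN1r addrK mulKf ?pnatr_eq0// cats0.
- apply: grZ; first exact/isratV/israt_nat.
  apply: grD; first exact: grX.
  by apply: grZ; [exact: (israt_sgn _ 1)|exact: gr_le gQ].
rewrite coefZ coefD coefMX coefZ (gr_coef gQ)// mulr0 addr0 /= cU /ifact.
by rewrite factS natrM invfM.
Qed.

End SeriesRegularization.

(** * Polylogarithms as Abel means of truncated sums *)

Section Polylog.
Variable R : realType.

Lemma binom_series_step d M (z : R) :
  (1 - z) * \sum_(0 <= m < M.+1) 'C(m + d.+1, d.+1)%:R * z ^+ m =
  \sum_(0 <= m < M.+1) 'C(m + d, d)%:R * z ^+ m - 'C(M + d.+1, d.+1)%:R * z ^+ M.+1.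
Proof.
elim: M => [|M IH]; first by rewrite !big_nat1 !add0n !binn !expr0; ring.
rewrite big_nat_recr//= mulrDr IH [in RHS]big_nat_recr//=.
have -> : 'C(M.+1 + d.+1, d.+1)%:R = 'C(M + d.+1, d.+1)%:R + 'C(M.+1 + d, d)%:R :> R.
  by rewrite -natrD addSn binS addnS.
rewrite !exprS; ring.
Qed.

(** The partial sums of the expansion of (1 - z)^-(d + 1); they serve as majorants for coefficients
    of polynomial growth. *)
Lemma binom_series_le d M (z : R) : 0 <= z < 1 ->
  (1 - z) ^+ d.+1 * \sum_(0 <= m < M) 'C(m + d, d)%:R * z ^+ m <= 1.
Proof.
move=> /andP[z0 z1]; elim: d => [|d IH].
  rewrite expr1 (_ : _ * _ = 1 - z ^+ M) ?gerBl ?exprn_ge0//.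
  elim: M => [|M IH]; first by rewrite big_geq// mulr0 expr0 subrr.
  by rewrite big_nat_recr//= mulrDr IH bin0 exprS; ring.
case: M IH => [|M] IH; first by rewrite big_geq// mulr0.
apply: le_trans IH; rewrite exprSr -mulrA ler_wpM2l ?exprn_ge0 ?subr_ge0 ?(ltW z1)//.
by rewrite binom_series_step gerBl mulr_ge0 ?exprn_ge0.
Qed.

Lemma cvg_pseries_binom (f : nat -> R) C d z : (forall m, `|f m| <= C * 'C(m + d, d)%:R) ->
  `|z| < 1 -> cvgn (pseries f z).
Proof.
move=> hf z1; apply: normed_cvg; apply: nondecreasing_is_cvgn.
  apply/nondecreasing_seqP => n.
  by rewrite /= /series /= big_nat_recr//= lerDl.
have C0 : 0 <= C by have := le_trans (normr_ge0 _) (hf 0%N); rewrite add0n binn mulr1.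
have zb : 0 <= `|z| < 1 by rewrite normr_ge0.
have z0 : 0 < (1 - `|z|) ^+ d.+1 by rewrite exprn_gt0// subr_gt0.
exists (C / (1 - `|z|) ^+ d.+1) => _ [M _ <-].
rewrite ler_pdivlMr//; apply: (@le_trans _ _ (C * 1)); last by rewrite mulr1.
apply: le_trans (ler_wpM2l C0 (binom_series_le d M zb)).
rewrite mulrCA [leLHS]mulrC ler_wpM2l ?(ltW z0)//.
rewrite mulr_sumr /series /=; apply: ler_sum => m _.
by rewrite normrM normrX mulrA ler_wpM2r.
Qed.

Lemma plog_linear (f : nat -> R) : plog f -> exists2 C, 0 <= C &
  forall N, (0 < N)%N -> `|f N| <= C * N%:R.
Proof.
move=> [C [d [C0 h]]]; have [K K0 hK] := Lg_le_sqrt R d.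
exists (C * K) => [|N N0]; first exact: mulr_ge0.
apply: (le_trans (h N N0)); rewrite mulr1 -mulrA ler_wpM2l//.
apply: (le_trans (hK N N0)); rewrite ler_wpM2l//.
have N1 : (1 : R) <= N%:R by rewrite ler1n.
by rewrite -[leRHS](ger0_norm (ler0n _ _)) -sqrtr_sqr ler_sqrt ?exprn_ge0// expr2 ler_peMr.
Qed.

Definition pls (f : nat -> R) (z : R) : R := limn (pseries (fun m => f m.+1) z).

Lemma plog_shift_binom (f : nat -> R) : plog f ->
  exists C, forall m, `|f m.+1| <= C * 'C(m + 1, 1)%:R.
Proof.
by move=> /plog_linear[C _ hC]; exists C => m; rewrite bin1 addn1; exact: hC.
Qed.

Lemma pls_cvg f z : plog f -> `|z| < 1 -> pseries (fun m => f m.+1) z @ \oo --> pls f z.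
Proof. by move=> /plog_shift_binom[C hC] z1; exact: (cvg_pseries_binom hC). Qed.

Lemma pls_lin n (c : 'I_n -> R) (f : 'I_n -> nat -> R) e g z : `|z| < 1 ->
  (forall j, plog (f j)) -> plog e ->
  (forall N, (0 < N)%N -> g N = \sum_(j < n) c j * f j N + e N) ->
  pls g z = \sum_(j < n) c j * pls (f j) z + pls e z.
Proof.
move=> z1 pf pe gE; apply: cvg_lim => //.
have h : (fun M => \sum_(j < n) c j * pseries (fun m => f j m.+1) z M + pseries (fun m => e m.+1) z M)
    @ \oo --> \sum_(j < n) c j * pls (f j) z + pls e z.
  apply: cvgD; last exact: pls_cvg.
  apply: cvg_big => [|j _]; first exact: add_continuous.
  by apply: cvgMr; exact: pls_cvg.
rewrite (_ : pseries _ z = (fun M => \sum_(j < n) c j * pseries (fun m => f j m.+1) z M +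
  pseries (fun m => e m.+1) z M)); first exact: h.
apply/funext => M; rewrite /pseries /series /=.
under [X in X + _]eq_bigr do rewrite mulr_sumr.
rewrite exchange_big -big_split /=; apply: eq_bigr => m _.
by rewrite gE// mulrDl mulr_suml; congr (_ + _); apply: eq_bigr => j _; rewrite mulrA.
Qed.

(** An Abelian theorem. The terms before K have a bounded sum, killed by the factor 1 - z; the later
    ones are compared with a geometric series. *)
Lemma pls_sml e : sml e -> (1 - z) * pls e z @[z --> (1 : R)^'-] --> (0 : R).
Proof.
move=> he; have pe := sml_plog he; have /cvgr0Pnorm_le h0 := sml_cvg0 he.
apply/cvgr0Pnorm_le => eps eps0.
have e2 : 0 < eps / 2 by rewrite divr_gt0.
have [K _ hK] := h0 _ e2.
pose C := \sum_(0 <= m < K) `|e m.+1|.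
have C0 : 0 <= C by apply: sumr_ge0.
near=> z.
have z1 : z < 1 by near: z; exact: nbhs_left_lt.
have z0 : 0 < z by near: z; apply: nbhs_left_gt.
have z2 : 1 - eps / 2 / (C + 1) < z.
  by near: z; apply: nbhs_left_gt; rewrite gtrBl divr_gt0// ltr_wpDl.
have z1' : `|z| < 1 by rewrite gtr0_norm.
have q0 : 0 < 1 - z by rewrite subr_gt0.
suff hp : `|pls e z| <= C + eps / 2 / (1 - z).
  rewrite normrM gtr0_norm//.
  apply: (@le_trans _ _ ((1 - z) * (C + eps / 2 / (1 - z)))); first by rewrite ler_wpM2l// ltW.
  rewrite mulrDr [X in _ + X]mulrC divfK ?gt_eqF//.
  have : (1 - z) * (C + 1) <= eps / 2.
    by rewrite -ler_pdivlMr ?ltr_wpDl//; lra.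
  lra.
have hn : (fun M => `|pseries (fun m => e m.+1) z M|) @ \oo --> `|pls e z|.
  by apply: cvg_norm; exact: pls_cvg.
rewrite -(cvg_lim _ hn)//; apply: limr_le; first by apply/cvg_ex; exists `|pls e z|.
near=> M.
have KM : (K <= M)%N by near: M; exact: nbhs_infty_ge.
rewrite /pseries /series /= (@big_cat_nat _ _ _ K)//=.
apply: (le_trans (ler_normD _ _)); apply: lerD.
  apply: (le_trans (ler_norm_sum _ _ _)); apply: ler_sum => m _.
  by rewrite normrM normrX (gtr0_norm z0) ler_piMr// exprn_ile1// ltW.
apply: (le_trans (ler_norm_sum _ _ _)).
apply: (@le_trans _ _ (\sum_(K <= m < M) eps / 2 * z ^+ m)).
  rewrite big_nat [leRHS]big_nat; apply: ler_sum => m /andP[Km _].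
  rewrite normrM normrX (gtr0_norm z0) ler_wpM2r ?exprn_ge0 ?(ltW z0)//.
  by apply: hK => /=; exact: leqW.
rewrite -mulr_sumr ler_pM2l//.
have zb : 0 <= z < 1 by rewrite ltW.
have := binom_series_le 0 M zb; rewrite expr1 -ler_pdivlMl// mulr1; apply: le_trans.
rewrite (@big_cat_nat _ _ _ K 0 M)//=.
under [X in _ <= _ + X]eq_bigr do rewrite bin0 mul1r.
by rewrite lerDr; apply: sumr_ge0 => m _; rewrite mulr_ge0// exprn_ge0// ltW.
Unshelve. all: by end_near.
Qed.

Lemma polylog_trunc_1 k (z : R) : polylog_trunc k z 1 = zeta_trunc R k 1.
Proof.
case/lastP: k => [|k a]; first by rewrite polylog_trunc_nil zeta_trunc_nil.
by rewrite polylog_trunc_rcons zeta_trunc_rcons !big_geq.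
Qed.

Lemma polylog_truncS k (z : R) M : polylog_trunc k z M.+2 =
  polylog_trunc k z M.+1 + z ^+ M.+1 * (zeta_trunc R k M.+2 - zeta_trunc R k M.+1).
Proof.
case/lastP: k => [|k a]; first by rewrite !polylog_trunc_nil !zeta_trunc_nil subrr mulr0 addr0.
rewrite !polylog_trunc_rcons !zeta_trunc_rcons [in LHS]big_nat_recr//=; congr (_ + _).
by rewrite [X in X - _]big_nat_recr//= [X in X - _]addrC addrK mulrA.
Qed.

Lemma polylog_abel_trunc k (z : R) M : polylog_trunc k z M.+1 =
  (1 - z) * pseries (fun m => zeta_trunc R k m.+1) z M.+1 + z * (zeta_trunc R k M.+1 * z ^+ M).
Proof.
rewrite /pseries /series /=; elim: M => [|M IH].
  by rewrite polylog_trunc_1 big_nat1 expr0; ring.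
by rewrite polylog_truncS IH [in RHS]big_nat_recr//= !exprS; ring.
Qed.

Lemma plog_zeta_trunc k : is_index k -> plog (zeta_trunc R k).
Proof.
move=> ik; have := @plog_zr R (rev k); rewrite is_index_rev => /(_ ik).
by rewrite /zr revK.
Qed.

(** Summation by parts makes the polylogarithm an Abel mean of the truncated zeta values, so their
    asymptotics govern its behaviour at z = 1. *)
Lemma polylogE k z : is_index k -> `|z| < 1 ->
  polylog k z = (1 - z) * pls (zeta_trunc R k) z.
Proof.
move=> ik z1; have hc := pls_cvg (plog_zeta_trunc ik) z1.
apply: cvg_lim => //; rewrite -cvg_shiftS /=.
have h : (fun M => (1 - z) * pseries (fun m => zeta_trunc R k m.+1) z M.+1 +
    z * (zeta_trunc R k M.+1 * z ^+ M)) @ \oo --> (1 - z) * pls (zeta_trunc R k) z + z * 0.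
  apply: cvgD; apply: cvgMr; first by rewrite (cvg_shiftS (pseries _ z)).
  by apply: cvg_series_cvg_0; apply/cvg_ex; exists (pls (zeta_trunc R k) z); exact: hc.
rewrite mulr0 addr0 in h.
by under eq_cvg do rewrite polylog_abel_trunc.
Qed.

Definition ones_coef (j m : nat) : R := m%:R^-1 * zeta_trunc R (nseq j 1%N) m.

Lemma is_index_ones j : is_index (nseq j 1%N).
Proof. by rewrite /is_index all_nseq orbT. Qed.

Lemma polylog_onesS j z : polylog (nseq j.+1 1%N) z = limn (pseries (ones_coef j) z) :> R.
Proof.
have -> : nseq j.+1 1%N = rcons (nseq j 1%N) 1%N by elim: j => //= j {1}->.
rewrite /polylog; congr (limn _); apply/funext => M.
rewrite polylog_trunc_rcons /pseries /series /=.
case: M => [|M]; first by rewrite !big_geq.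
rewrite [RHS]big_ltn// /ones_coef invr0 !mul0r add0r; apply: eq_bigr => m _.
by rewrite expr1 -mulrA mulrC.
Qed.

Lemma polylog_onesS_derive j x : `|x| < 1 ->
  is_derive x (1 : R) (polylog (nseq j.+1 1%N)) (pls (zeta_trunc R (nseq j 1%N)) x).
Proof.
(* A radius strictly between |x| and 1, where the series and its first two formal derivatives
   converge. *)
move=> x1; pose K : R := (1 + `|x|) / 2.
have K0 : 0 <= K by rewrite /K divr_ge0// addr_ge0.
have K1 : `|K| < 1 by rewrite ger0_norm// /K; lra.
have xK : `|x| < `|K| by rewrite (ger0_norm K0) /K; lra.
have [C C0 hC] := plog_linear (plog_zeta_trunc (is_index_ones j)).
have dE : pseries_diffs (ones_coef j) = (fun m => zeta_trunc R (nseq j 1%N) m.+1).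
  by apply/funext => m; rewrite /pseries_diffs /ones_coef mulVKf ?pnatr_eq0.
have h0 : cvgn (pseries (ones_coef j) K).
  apply: (@cvg_pseries_binom _ C 0) => // -[|m]; rewrite bin0 mulr1 /ones_coef.
    by rewrite invr0 mul0r normr0.
  by rewrite normrM ger0_norm ?invr_ge0// mulrC ler_pdivrMr ?ltr0n// hC.
have h1 : cvgn (pseries (pseries_diffs (ones_coef j)) K).
  by rewrite dE; apply: (@cvg_pseries_binom _ C 1) => // m; rewrite bin1 addn1 hC.
have h2 : cvgn (pseries (pseries_diffs (pseries_diffs (ones_coef j))) K).
  rewrite dE; apply: (@cvg_pseries_binom _ (2 * C) 2) => // m; rewrite /pseries_diffs.
  rewrite normrM ger0_norm//.
  apply: (@le_trans _ _ (m.+1%:R * (C * m.+2%:R))); first by rewrite ler_wpM2l// hC.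
  have -> : 'C(m + 2, 2)%:R = m.+1%:R * m.+2%:R / 2 :> R.
    apply: (@mulIf _ 2%:R); rewrite ?pnatr_eq0// divfK ?pnatr_eq0//.
    rewrite -!natrM; congr _%:R; rewrite addn2.
    by have := mul_bin_diag m.+2 1; rewrite bin1 /= => e; rewrite mulnC -e mulnC.
  by rewrite le_eqVlt; apply/orP; left; apply/eqP; field.
have := pseries_snd_diffs h0 h1 h2 xK; rewrite dE.
rewrite (_ : (fun x => limn (pseries (ones_coef j) x)) = polylog (nseq j.+1 1%N)) //.
by apply/funext => y; rewrite polylog_onesS.
Qed.

Lemma is_derive_log_pow n (x : R) : x < 1 ->
  is_derive x (1 : R) (fun y => (- ln (1 - y)) ^+ n.+1) (n.+1%:R * (- ln (1 - x)) ^+ n / (1 - x)).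
Proof.
move=> x1; have q0 : 0 < 1 - x by rewrite subr_gt0.
have d1 : is_derive x (1 : R) (fun y : R => 1 - y) (-1).
  by have := is_deriveB (is_derive_cst (1 : R) x 1) (is_derive_id x (1 : R)); rewrite sub0r.
have d2 := @is_derive1_comp R (@ln R) (fun y => 1 - y) x _ _ (is_derive1_ln q0) d1.
have d3 := is_deriveX n.+1 (is_deriveN d2); rewrite exprfctE in d3.
apply: is_derive_eq.
by rewrite mulrN1 opprK /= /GRing.scale /=.
Qed.

(** Induction: for j + 1 both sides vanish at 0 and have as derivative the polylogarithm of j ones
    divided by 1 - z, so their difference is constant by the mean value theorem. *)
Lemma polylog_ones j z : 0 <= z < 1 ->
  polylog (nseq j 1%N) z = ifact R j * (- ln (1 - z)) ^+ j.
Proof.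
elim: j z => [|j IH] z /andP[z0 z1].
  rewrite expr0 mulr1 /ifact fact0 invr1 /polylog (_ : polylog_trunc _ _ = fun=> 1).
    exact: lim_cst.
  by apply/funext => M; exact: polylog_trunc_nil.
pose F x : R := polylog (nseq j.+1 1%N) x - ifact R j.+1 * (- ln (1 - x)) ^+ j.+1.
have F0 : F 0 = 0.
  rewrite /F subr0 ln1 oppr0 expr0n mulr0 subr0 polylog_onesS.
  rewrite (_ : pseries _ _ = fun=> 0); first exact: lim_cst.
  apply/funext => M; rewrite /pseries /series /= big1// => m _.
  by case: m => [|m]; rewrite ?expr0n ?mulr0// /ones_coef invr0 !mul0r.
have dF (x : R) : 0 <= x < 1 -> is_derive x (1 : R) F 0.
  move=> /andP[x0 x1]; have x1' : `|x| < 1 by rewrite ger0_norm.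
  have h := is_deriveB (polylog_onesS_derive j x1')
    (is_deriveZ (ifact R j.+1) (is_derive_log_pow j x1)).
  apply: is_derive_eq.
  have q0 : 1 - x != 0 by rewrite subr_eq0 eq_sym lt_eqF.
  have := IH x; rewrite x0 x1 => /(_ isT); rewrite polylogE ?is_index_ones// => e.
  rewrite /GRing.scale /=; apply/eqP; rewrite subr_eq0; apply/eqP.
  apply: (mulfI q0); rewrite e /ifact factS natrM; field.
  by rewrite q0 pnatr_eq0 -lt0n fact_gt0 /= addrC natr1 pnatr_eq0.
suff : F z = 0 by move/eqP; rewrite subr_eq0 => /eqP.
case: (eqVneq z 0) => [->//|zn0].
have z0' : 0 < z by rewrite lt_neqAle eq_sym zn0.
have [||c _] := @MVT R F (fun=> 0) 0 z z0'.
- by move=> x; rewrite in_itv /= => /andP[x0 xz]; apply: dF; rewrite (ltW x0) (lt_trans xz).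
- apply: derivable_within_continuous => x; rewrite in_itv /= => /andP[x0 xz].
  by have [] := dF x _; rewrite ?x0 ?(le_lt_trans xz).
by rewrite F0 subr0 mul0r.
Qed.

End Polylog.

Section IntegralRegularization.
Variable R : realType.

Definition ones_poly (j : nat) : {poly R} :=
  xget 0 [set U | [/\ pasym (zr R (nseq j 1%N)) U, gr j j U & U`_j = ifact R j]].

Lemma ones_polyP j : [/\ pasym (zr R (nseq j 1%N)) (ones_poly j), gr j j (ones_poly j) &
  (ones_poly j)`_j = ifact R j].
Proof. exact: (xgetPex 0 (ones_regular R j)). Qed.

Lemma ones_decomp w n (P : {poly R}) : (n <= w.+1)%N -> (size P <= n)%N ->
  (forall j, (j <= w)%N -> Zspan R (w - j) P`_j) ->
  exists2 c : nat -> R, P = \sum_(j < n) c j *: ones_poly j &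
    forall j, (j < n)%N -> Zspan R (w - j) (c j).
Proof.
elim: n P => [|n IH] P nw sP hP.
  by exists (fun=> 0) => //; rewrite big_ord0; apply/eqP; rewrite -size_poly_eq0 -leqn0.
have [_ gU cU] := ones_polyP n.
pose a := P`_n * n`!%:R.
have ha : Zspan R (w - n) a by rewrite /a mulrC; apply: qspanZ; [exact: israt_nat|exact: hP].
have [||j jw|c cE hc] := IH (P - a *: ones_poly n); first exact: ltnW.
- apply/leq_sizeP => i ni; rewrite coefB coefZ.
  have [in'|->] : (n < i)%N \/ i = n by move: ni; rewrite leq_eqVlt => /orP[/eqP ->|]; [right|left].
    by rewrite (gr_coef gU in') mulr0 subr0; move/leq_sizeP: sP; exact.
  by rewrite cU /a -mulrA [_ * ifact _ _]mulrC ifactE mulr1 subrr.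
- rewrite coefB coefZ; apply: qspanB; first exact: hP.
  have := gU j; case: ifP => [jn|_ ->]; last by rewrite mulr0; exact: qspan0.
  move=> /Zspan_depth_le_Zspan hj.
  have -> : (w - j = (w - n) + (n - j))%N by lia.
  exact: ZspanM.
exists (fun j => if j == n then a else c j).
  rewrite big_ord_recr /= eqxx -[LHS](subrK (a *: ones_poly n)); congr (_ + _).
  by rewrite [LHS]cE; apply: eq_bigr => j _; rewrite ltn_eqF.
move=> j; rewrite ltnS leq_eqVlt; case: eqP => [-> //|_] /=; exact: hc.
Qed.

(** The passage between the regularizations replaces the polynomial of j ones by T^j / j!: the Abel
    means of the truncated sums of j ones are known exactly, and those of the error tend to 0. *)
Lemma reg_poly_integral k n (c : nat -> R) : is_index k ->
  pasym (zeta_trunc R k) (\sum_(j < n) c j *: ones_poly j) ->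
  reg_poly R IntegralReg k = \sum_(j < n) (c j * ifact R j) *: 'X^j.
Proof.
move=> ik hk.
pose e N := zeta_trunc R k N - \sum_(j < n) c j * zr R (nseq j 1%N) N.
have se : sml e.
  have h : pasym (fun N => \sum_(j < n) c j * zr R (nseq j 1%N) N) (\sum_(j < n) c j *: ones_poly j).
    rewrite /index_enum; apply: pasym_sum => j; apply: pasymZ.
    by have [] := ones_polyP j.
  apply: eq_big_asy (bigB _ (@isqrt_ge0 R) hk h) => // N _.
  by rewrite /e opprB addrA subrK.
set Q := \sum_(j < n) _.
have nearE : \forall z \near (1 : R)^'-, polylog k z - Q.[- ln (1 - z)] = (1 - z) * pls e z.
  near=> z.
  have z1 : z < 1 by near: z; exact: nbhs_left_lt.
  have z0 : 0 < z by near: z; apply: nbhs_left_gt.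
  have z1' : `|z| < 1 by rewrite gtr0_norm.
  rewrite polylogE// (@pls_lin R n (fun j => c j) (fun j => zeta_trunc R (nseq j 1%N)) e)//.
  - rewrite mulrDr addrAC -[RHS]add0r; congr (_ + _); apply/eqP; rewrite subr_eq0; apply/eqP.
    rewrite mulr_sumr horner_sum; apply: eq_bigr => j _.
    rewrite hornerZ hornerXn mulrCA -polylogE ?is_index_ones// polylog_ones ?mulrA//.
    by rewrite (ltW z0).
  - by move=> j; apply: plog_zeta_trunc; exact: is_index_ones.
  - exact: sml_plog.
  - move=> N _; rewrite /e addrC -[LHS](subrK (\sum_(j < n) c j * zr R (nseq j 1%N) N)).
    by congr (_ + _); apply: eq_bigr => j _; rewrite /zr rev_nseq.
have h : is_reg_poly IntegralReg k Q.
  apply: cvg_trans (pls_sml se); apply: near_eq_cvg.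
  by apply: filterS nearE => z ->.
apply: xget_unique => // Q' hQ'; apply/eqP; rewrite -subr_eq0; apply/eqP.
apply: (@poly_cvg0 R _ ((1 : R)^'-) _ (fun z : R => - ln (1 - z))).
  apply/cvgryPgt => A; near=> z.
  have z1 : z < 1 by near: z; exact: nbhs_left_lt.
  rewrite ltrNr -[ltRHS]expRK ltr_ln ?posrE ?expR_gt0// ?subr_gt0//.
  rewrite ltrBlDr -ltrBlDl; near: z; apply: nbhs_left_gt.
  by rewrite gtrBl expR_gt0.
have hs := cvgB h hQ'; rewrite subr0 in hs.
rewrite (_ : (fun z : R => _) = (fun z => polylog k z - Q.[- ln (1 - z)]) -
  (fun z => polylog k z - Q'.[- ln (1 - z)])); first exact: hs.
apply/funext => z; rewrite hornerD hornerN.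
by transitivity ((polylog k z - Q.[- ln (1 - z)]) - (polylog k z - Q'.[- ln (1 - z)])); first ring.
Unshelve. all: by end_near.
Qed.

Lemma zeta_pasym k P : admissible k -> pasym (zeta_trunc R k) P -> P = (zeta R k)%:P.
Proof.
move=> /admissible_revP[r -> /andP[ir ar]] hP.
by apply: pasym_lim hP _; exact: zr_adm.
Qed.

Lemma zeta_reg_series k P : pasym (zeta_trunc R k) P -> zeta_reg R SeriesReg k = P`_0.
Proof.
move=> hP; rewrite /zeta_reg; case: ifP => [ak|_].
  by rewrite (zeta_pasym ak hP) coefC.
by rewrite /reg_const (reg_poly_series hP) horner_coef0.
Qed.

Lemma size_lt_sumn w : is_index w -> ~~ allones w -> (size w < sumn w)%N.
Proof.
elim: w => //= a w IH /andP[a0 iw]; case: (eqVneq a 1%N) => [->|a1] /= h; first by have := IH iw h; lia.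
by have := size_le_sumn iw; lia.
Qed.

Lemma zeta_trunc_regular k : is_index k -> exists2 P, pasym (zeta_trunc R k) P & gr (sumn k) (size k) P.
Proof.
move=> ik; have [P hP gP] := @zr_regular R (rev k) (etrans (is_index_rev k) ik).
exists P; last by rewrite -sumn_rev -[size k]size_rev.
by apply: eq_pasym hP => N _; rewrite /zr revK.
Qed.

(** The constant terms differ by the sum over j >= 1 of c_j times the constant term of
    [ones_poly j], of weights k - j and j. A letter other than 1 makes the length, which bounds j,
    smaller than k, so both weights are positive. *)
Lemma zeta_reg_congr b : is_index b -> ~~ allones b ->
  Zspan_prod R (sumn b) (zeta_reg R SeriesReg b - zeta_reg R IntegralReg b).
Proof.
move=> ib nb; have [P hP gP] := zeta_trunc_regular ib.
rewrite (zeta_reg_series hP) /zeta_reg; case: ifP => [ab|_].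
  by rewrite (zeta_pasym ab hP) coefC subrr; exact: qspan0.
have sb := size_lt_sumn ib nb.
have [|||c PE hc] := @ones_decomp (sumn b) (size b).+1 P.
- by lia.
- exact: gr_size gP.
- by move=> j jb; have := gP j; rewrite jb; exact: Zspan_depth_le_Zspan.
rewrite /reg_const (@reg_poly_integral b (size b).+1 c)// -?PE// horner_coef0 PE.
rewrite !big_ord_recl /= !coefD !coef_sum !coefZ.
have U0 : (ones_poly 0)`_0 = 1 by have [_ _ ->] := ones_polyP 0; rewrite /ifact fact0 invr1.
rewrite U0 coefXn mulr1 /ifact fact0 invr1 !mulr1.
rewrite [X in _ - (_ + X)]big1 ?addr0 => [|j _]; last by rewrite coefZ coefXn mulr0.
rewrite addrAC subrr add0r; apply: qspan_sum => j _; rewrite coefZ.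
have jb := ltn_ord j; have [_ gU _] := ones_polyP (bump 0 j).
have -> : sumn b = (sumn b - bump 0 j + bump 0 j)%N by rewrite /bump; lia.
apply: Zspan_prodM; [rewrite /bump; lia|by []| |].
  by apply: hc; rewrite /bump; lia.
by have := gU 0%N; rewrite subn0; exact: Zspan_depth_le_Zspan.
Qed.

End IntegralRegularization.

(** * The congruences *)

Section Congruences.
Variable R : realType.
Notation ps := (power_series R).
Notation ws := (word_series nat ps).

Lemma Zspan_prod_Zspan w : Zspan_prod R w `<=` Zspan R w.
Proof.
apply: qspan_trans => x [w1 [w2 [_ _ <- [y hy [z hz ->]]]]]; exact: ZspanM.
Qed.

Lemma Sreg0 v : is_index v -> Sreg R v 0 = (v == [::])%:R.
Proof.
case: v => [|a v] iv; first by rewrite Sreg_nil ps_coef1.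
by rewrite vanish_Sreg//=; case/andP: iv; lia.
Qed.

Lemma Sreg_Zspan v c : is_index v -> Zspan R c (Sreg R v c).
Proof.
case: c => [|c] iv; first by rewrite Sreg0//; apply: Zspan_israt; exact: israt_nat.
by apply: Zspan_depth_le_Zspan; exact: Sreg_depth.
Qed.

Lemma SnegE v c : Sneg R v c = (-1) ^+ c * Sreg R (rev v) c.
Proof. by []. Qed.

Lemma Sneg0 v : is_index v -> Sneg R v 0 = (v == [::])%:R.
Proof.
move=> iv; rewrite SnegE expr0 mul1r Sreg0 ?is_index_rev//.
by rewrite -!size_eq0 size_rev.
Qed.

Lemma Sneg_Zspan v c : is_index v -> Zspan R c (Sneg R v c).
Proof.
by move=> iv; rewrite SnegE; apply: qspanZ; [exact: israt_sgn|apply: Sreg_Zspan; rewrite is_index_rev].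
Qed.

Lemma Sneg_depth v c : is_index v -> (0 < c)%N -> Zspan_depth_le R c (size v)%:Z (Sneg R v c).
Proof.
move=> iv c0; rewrite SnegE -size_rev; apply: qspanZ; first exact: israt_sgn.
by apply: Sreg_depth; rewrite ?is_index_rev.
Qed.

Lemma sum_drop_nil (f : nat -> R) (w : seq nat) :
  \sum_(i < (size w).+1) f i * (drop i w == [::])%:R = f (size w).
Proof.
rewrite big_ord_recr /= drop_size eqxx mulr1 big1 ?add0r// => i _.
by rewrite -size_eq0 size_drop subn_eq0 leqNgt ltn_ord mulr0.
Qed.

Lemma sum_take_nil (f : nat -> R) (w : seq nat) :
  \sum_(i < (size w).+1) (take i w == [::])%:R * f i = f 0%N.
Proof.
rewrite big_ord_recl /= take0 eqxx mul1r big1 ?addr0// => i _.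
by rewrite -size_eq0 size_takel ?mul0r// /bump add1n.
Qed.

(** Only terms with the whole power of t on one side are not products of positive weights. [F] may
    have constant terms at nonempty words because it will be S^- E_0. *)
Lemma mul_ends (F G : ws) w b : is_index w -> (0 < b)%N ->
  (forall v c, is_index v -> Zspan R c (F v c)) ->
  (forall v c, is_index v -> Zspan R c (G v c)) ->
  (forall v, is_index v -> G v 0%N = (v == [::])%:R) ->
  Zspan_prod R b ((F * G) w b -
    (F w b + \sum_(i < (size w).+1) F (take i w) 0%N * G (drop i w) b)).
Proof.
case: b => // b iw _ hF hG hG0; rewrite ws_coefM ps_coef_sum.
have fw : F w b.+1 = \sum_(i < (size w).+1) F (take i w) b.+1 * G (drop i w) 0%N.
  under eq_bigr do rewrite hG0 ?is_index_drop//.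
  by rewrite (sum_drop_nil (fun i => F (take i w) b.+1)) take_size.
rewrite fw -big_split -sumrB; apply: qspan_sum => i _ /=.
rewrite ps_coefM big_ord_recl big_ord_recr /= subn0 /bump !add1n subnn.
rewrite [X in X - _](_ : _ = F (take i w) b.+1 * G (drop i w) 0%N + F (take i w) 0%N * G (drop i w) b.+1 +
  \sum_(j < b) F (take i w) (1 + j)%N * G (drop i w) (b.+1 - (1 + j))%N); last by ring.
rewrite addrAC subrr add0r; apply: qspan_sum => j _.
have jb := ltn_ord j.
have -> : b.+1 = ((1 + j) + (b.+1 - (1 + j)))%N by lia.
rewrite addKn; apply: Zspan_prodM; [by []|lia| |].
  by apply: hF; exact: is_index_take.
by apply: hG; exact: is_index_drop.
Qed.

Lemma mul_ends_delta (F G : ws) w b : is_index w -> (0 < b)%N ->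
  (forall v c, is_index v -> Zspan R c (F v c)) ->
  (forall v c, is_index v -> Zspan R c (G v c)) ->
  (forall v, is_index v -> F v 0%N = (v == [::])%:R) ->
  (forall v, is_index v -> G v 0%N = (v == [::])%:R) ->
  Zspan_prod R b ((F * G) w b - (F w b + G w b)).
Proof.
move=> iw b0 hF hG hF0 hG0; have := mul_ends iw b0 hF hG hG0.
under eq_bigr do rewrite hF0 ?is_index_take//.
by rewrite (sum_take_nil (fun i => G (drop i w) b)) drop0.
Qed.

Lemma natF_congr w : is_index w -> (0 < sumn w)%N ->
  Zspan_prod R (sumn w) (zeta_natF R w - (Sreg R w (sumn w) + Sneg R w (sumn w))).
Proof.
move=> iw w0; rewrite zeta_natFE//; apply: mul_ends_delta => //.
- exact: Sreg_Zspan.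
- exact: Sneg_Zspan.
- exact: Sreg0.
- exact: Sneg0.
Qed.

Lemma Sneg_congr v b : is_index v -> (0 < b)%N ->
  Zspan_prod R b (Sneg R v b + (-1) ^+ (b + size v) * Sreg R v b).
Proof.
move=> iv b0.
have GE u c : wsgn (wrev (Sreg R)) u c = (-1) ^+ size u * Sreg R (rev u) c.
  rewrite /= (_ : (-1) ^+ size u = ps_cst ((-1) ^+ size u) :> ps) ?ps_cstM//.
  by rewrite rmorphXn rmorphN1.
have h : Zspan_prod R b ((Sreg R * wsgn (wrev (Sreg R))) v b -
    (Sreg R v b + wsgn (wrev (Sreg R)) v b)).
  apply: mul_ends_delta => //.
  - exact: Sreg_Zspan.
  - move=> u c iu; rewrite GE; apply: qspanZ; first exact: israt_sgn.
    by apply: Sreg_Zspan; rewrite is_index_rev.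
  - exact: Sreg0.
  - move=> u iu; rewrite GE Sreg0 ?is_index_rev// -size_eq0 size_rev size_eq0.
    by case: eqP => [->|_]; rewrite ?expr0 ?mulr1 ?mulr0.
have e0 : (1 : ws) v b = 0.
  rewrite ws_coef1; case: (size v == 0)%N; last exact: ps_coef0.
  by rewrite ps_coef1; case: b b0 {h}.
rewrite Sreg_antipode// e0 GE sub0r in h.
have := qspanZ (isratM (israt_sgn R (b + size v)) (israt_sgn R 1)) h.
suff <- : - (-1) ^+ (b + size v) * - (Sreg R v b + (-1) ^+ size v * Sreg R (rev v) b) =
    Sneg R v b + (-1) ^+ (b + size v) * Sreg R v b by rewrite mulrN1.
rewrite SnegE mulrNN mulrDr addrC; congr (_ + _).
by rewrite exprD -mulrA signrMK.
Qed.

Lemma expo0E v : expo R 0 v = fps R (size v).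
Proof.
rewrite expoE (_ : tau R 0 = 1) ?expr1n ?mulr1//.
Qed.

Lemma Sneg_expoE v a : (Sneg R * expo R 0) v a =
  \sum_(j < (size v).+1) ifact R (size v - j) * Sneg R (take j v) a.
Proof.
rewrite ws_coefM ps_coef_sum; apply: eq_bigr => j _.
by rewrite expo0E mulrC ps_cstM size_drop.
Qed.

Lemma Sneg_expo_Zspan v a : is_index v -> Zspan R a ((Sneg R * expo R 0) v a).
Proof.
move=> iv; rewrite Sneg_expoE; apply: qspan_sum => j _; apply: qspanZ; first exact: israt_ifact.
by apply: Sneg_Zspan; exact: is_index_take.
Qed.

Lemma Sneg_expo0 v : is_index v -> (Sneg R * expo R 0) v 0%N = ifact R (size v).
Proof.
move=> iv; rewrite Sneg_expoE.
under eq_bigr do rewrite Sneg0 ?is_index_take// mulrC.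
by rewrite (sum_take_nil (fun j => ifact R (size v - j))) subn0.
Qed.

Lemma Psi_congr w b : is_index w -> (0 < b)%N -> Zspan_prod R b (Psi R w b -
  (\sum_(j < (size w).+1) ifact R (size w - j) * Sneg R (take j w) b +
   \sum_(i < (size w).+1) ifact R i * Sreg R (drop i w) b)).
Proof.
move=> iw b0; have := mul_ends iw b0 Sneg_expo_Zspan Sreg_Zspan Sreg0.
rewrite -Sneg_expoE.
rewrite (eq_bigr (fun i : 'I_(size w).+1 => ifact R i * Sreg R (drop i w) b)) //.
move=> i _; rewrite Sneg_expo0 ?is_index_take// size_takel//.
by rewrite -ltnS ltn_ord.
Qed.

Lemma Psi0 w : is_index w -> Psi R w 0%N = ifact R (size w).
Proof.
move=> iw; rewrite /Psi ws_coefM ps_coef_sum.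
under eq_bigr do rewrite ps_coefM big_ord1 subn0 Sreg0 ?is_index_drop//.
by rewrite (sum_drop_nil (fun i => (Sneg R * expo R 0) (take i w) 0%N)) take_size Sneg_expo0.
Qed.

Lemma Psi_Zspan w b : is_index w -> Zspan R b (Psi R w b).
Proof.
case: b => [|b] iw; first by rewrite Psi0//; apply: Zspan_israt; exact: israt_ifact.
have := Zspan_prod_Zspan (Psi_congr iw (ltn0Sn b)).
set x := (X in _ - X) => h; rewrite -[Psi _ _ _](subrK x); apply: qspanD => //.
apply: qspanD; apply: qspan_sum => i _; apply: qspanZ; try exact: israt_ifact.
  by apply: Sneg_Zspan; exact: is_index_take.
by apply: Sreg_Zspan; exact: is_index_drop.
Qed.

Lemma hsum_zeta s : limn (hsum R s) = zeta R [:: s].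
Proof.
congr (limn _); apply/funext => M; rewrite -[[:: s]]/(rcons [::] s) zeta_trunc_rcons.
by apply: eq_bigr => m _; rewrite zeta_trunc_nil mulr1.
Qed.

Lemma zeta1_Zspan s : (1 < s)%N -> Zspan R s (zeta R [:: s]).
Proof.
move=> s1; have := @Zspan_zeta R [:: s]; rewrite /= addn0; apply.
by rewrite /admissible /= s1 !andbT ltnW.
Qed.

(** In [Psi_top] every term is a product except that of the pole of highest order, whose other
    factor is the rational number 1 / n!. *)
Lemma Psi_top_congr w : is_index w -> ~~ allones w ->
  Zspan_prod R (sumn w) (Psi R w (sumn w) -
    ifact R (size w) * ((1 + (-1) ^+ sumn w) * zeta R [:: sumn w])).
Proof.
move=> iw nw; have := not_allones_sumn iw nw; rewrite (Psi_top R iw nw).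
case: (sumn w) => [|[|k]] // _; rewrite /= big_ord_recr /= subnn Psi0// hsum_zeta addrK.
apply: qspan_sum => j _; have jk := ltn_ord j; rewrite hsum_zeta mulrCA.
apply: qspanZ.
  by apply: isratD; [exact: (israt_nat R 1)|exact: israt_sgn].
have E : k.+2 = ((k.+2 - j.+2) + j.+2)%N by lia.
have p0 : (0 < k.+2 - j.+2)%N by lia.
have := Zspan_prodM p0 (ltn0Sn _) (Psi_Zspan (k.+2 - j.+2) iw) (@zeta1_Zspan j.+2 isT).
by rewrite -E.
Qed.

Lemma Zspan_depth_le0 w x : (0 < w)%N -> Zspan_depth_le R w 0 x -> x = 0.
Proof.
move=> w0 [d [q [s [hs ->]]]]; apply: big1 => i _.
have [a [_ wa da] _] := hs i; exfalso; move: w0; rewrite -wa.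
by case: a da {wa}.
Qed.

(** In depth one the correction to the zeta value has depth 0, hence vanishes in positive weight;
    the formula is an equality. *)
Lemma Sreg_single c b : (0 < c <= b)%N -> (1 < b)%N ->
  Sreg R [:: c] b = (-1) ^+ (b - c) * ('C(b - 1, b - c)%:R * zeta R [:: b]).
Proof.
move=> /andP[c0 cb] b1; rewrite Sreg_shift /= ?c0 ?addn0//; congr (_ * _).
rewrite big_ord_recr /= subnn eqxx subnKC// big1 ?add0r => [|l _]; last first.
  by rewrite ifF ?mulr0//; have := ltn_ord l; lia.
congr (_ * _).
have ib : is_index [:: b] by rewrite /= andbT; lia.
have [P [hP _]] := Sreg_top R ib isT; rewrite /= addn0.
have ab : admissible [:: b] by rewrite /admissible ib.
have -> : P = (zeta R [:: b])%:P by apply: zeta_pasym => //; exact: hP.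
by rewrite coefC /= subrr => /Zspan_depth_le0 h; apply/eqP; rewrite -subr_eq0 h//; lia.
Qed.

(** The terms in which E_0 takes at least two letters, from the end or from the beginning of [w];
    this is where depth n - 2 comes from. *)
Definition Psi_rest (w : seq nat) (b : nat) : R :=
  \sum_(j < (size w).-1) ifact R (size w - j) * Sneg R (take j w) b +
  \sum_(i < (size w).-1) ifact R i.+2 * Sreg R (drop i.+2 w) b.

Lemma Psi_rest_depth w b : is_index w -> (0 < b)%N ->
  Zspan_depth_le R b ((size w)%:Z - 2) (Psi_rest w b).
Proof.
move=> iw b0; apply: qspanD; apply: qspan_sum => j _; have jw := ltn_ord j;
  apply: qspanZ; try exact: israt_ifact.
  apply: Zspan_depth_le_mono (Sneg_depth (is_index_take j iw) b0).
  by rewrite size_takel; lia.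
apply: Zspan_depth_le_mono (Sreg_depth R (is_index_drop j.+2 iw) b0).
by rewrite size_drop; lia.
Qed.

(** The terms where E_0 takes at most one letter are isolated, and S^- at the word without its last
    letter is turned into S by [Sneg_congr]; as that word has length n - 1, the sign is (-1)^(b +
    n). *)
Lemma Psi_split w b : is_index w -> (0 < size w)%N -> (0 < b)%N ->
  Zspan_prod R b (Psi R w b - (Sreg R w b + Sneg R w b + Psi_rest w b + Sreg R (behead w) b +
    (-1) ^+ (b + size w) * Sreg R (take (size w).-1 w) b)).
Proof.
move=> iw w0 b0; have h1 := Psi_congr iw b0.
have h2 := Sneg_congr (is_index_take (size w).-1 iw) b0.
have sw : size w = (size w).-1.+1 by rewrite prednK.
rewrite size_takel ?leq_pred// in h2.
have i0 : ifact R 0 = 1 by rewrite /ifact fact0 invr1.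
have i1 : ifact R 1 = 1 by rewrite /ifact factS fact0 invr1.
rewrite /Psi_rest.
have := qspanD h1 h2; congr (qspan _ _).
set n := (size w).-1 in sw *; rewrite sw.
rewrite [\sum_(j < n.+2) _ * Sneg _ _ _]big_ord_recr [\sum_(j < n.+1) _ * Sneg _ _ _]big_ord_recr /=.
rewrite [\sum_(j < n.+2) _]big_ord_recl [\sum_(j < n.+1) _]big_ord_recl /= drop0.
have tw : take n.+1 w = w by rewrite -sw take_size.
rewrite subnn subSnn i0 i1 !mul1r tw /bump /= drop1 addnS exprS.
under [\sum_(j < n) _ * Sreg _ _ _]eq_bigr do rewrite !add1n.
by ring.
Qed.

Lemma Sreg_nil0 b : (0 < b)%N -> Sreg R [::] b = 0.
Proof. by case: b => // b _; rewrite Sreg_nil ps_coef1. Qed.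

(** For w = (1, k - 1) the principal parts give zeta(k) for the coefficient of [Psi], while its
    expansion gives - (k - 1) zeta(k) - zeta(k), since S(w) + S^-(w) is a sum of products. Hence (k
    + 1) zeta(k) is one too. *)
Lemma zeta_even k : (2 < k)%N -> ~~ odd k -> Zspan_prod R k (zeta R [:: k]).
Proof.
move=> k2 ek; pose w := [:: 1%N; k.-1].
have iw : is_index w by rewrite /= andbT; lia.
have nw : ~~ allones w by rewrite /=; lia.
have wk : sumn w = k by rewrite /=; lia.
have k0 : (0 < k)%N by lia.
have h1 := Psi_top_congr iw nw; rewrite wk in h1.
have h2 := Psi_split iw isT k0.
have h3 := Sneg_congr iw k0.
have rest0 : Psi_rest w k = 0.
  by rewrite /Psi_rest !big_ord1 SnegE Sreg_nil0// !mulr0 addr0.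
have e1 : Sreg R (behead w) k = - (k.-1%:R * zeta R [:: k]).
  rewrite [behead w]/= Sreg_single; [|lia..].
  have -> : (k - k.-1 = 1)%N by lia.
  by rewrite bin1 expr1 mulN1r subn1.
have e2 : Sreg R (take (size w).-1 w) k = - zeta R [:: k].
  rewrite [take _ _]/= Sreg_single; [|lia..].
  rewrite binn mul1r -signr_odd oddB; last by lia.
  by rewrite (negbTE ek) /= expr1 mulN1r.
have sg : (-1) ^+ (k + size w) = 1 :> R by rewrite -signr_odd oddD (negbTE ek).
have sk : (-1) ^+ k = 1 :> R by rewrite -signr_odd (negbTE ek).
have i2 : ifact R (size w) = 2^-1 by [].
rewrite rest0 e1 e2 sg mul1r in h2; rewrite sg mul1r in h3; rewrite sk i2 in h1.
have := qspanZ (isratV (israt_nat R k.+1)) (qspanD (qspanB h2 h1) h3); congr (qspan _ _).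
move: (Sreg R w k) (Sneg R w k) (Psi R w k) (zeta R [:: k]) => a b c z.
have -> : k.+1%:R = k.-1%:R + 2 :> R by rewrite -natrD; congr _%:R; lia.
have kp : 0 <= k.-1%:R :> R by [].
by field; rewrite gt_eqF//; lra.
Qed.

(** The leftover (1 + (-1)^k) zeta(k) vanishes for odd k and is a sum of products for even k > 2;
    this is the reason for excluding weight 2. *)
Lemma Psi_prod w : is_index w -> ~~ allones w -> sumn w != 2%N ->
  Zspan_prod R (sumn w) (Psi R w (sumn w)).
Proof.
move=> iw nw w2; have wk := not_allones_sumn iw nw.
have h := Psi_top_congr iw nw; rewrite -[Psi _ _ _](subrK (ifact R (size w) *
  ((1 + (-1) ^+ sumn w) * zeta R [:: sumn w]))); apply: qspanD => //.
apply: qspanZ; first exact: israt_ifact.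
case: (boolP (odd (sumn w))) => ow.
  by rewrite -signr_odd ow expr1 subrr mul0r; exact: qspan0.
apply: qspanZ; first by apply: isratD; [exact: (israt_nat R 1)|exact: israt_sgn].
by apply: zeta_even => //; lia.
Qed.

Section Shifts.
Variables (h : seq nat) (a : nat).
Hypotheses (ih : is_index h) (a0 : (0 < a)%N).

Lemma shift_index_sumn (l : (size h).-tuple 'I_a.+1) : is_composition l ->
  sumn (shift_index l) = (sumn h + a)%N.
Proof.
move=> /eqP hl; rewrite /shift_index sumnE big_map big_enum /= big_split /= hl; congr (_ + _)%N.
by rewrite sumnE (big_nth 0%N) big_mkord.
Qed.

Lemma shift_index_index (l : (size h).-tuple 'I_a.+1) : is_index (shift_index l).
Proof.
apply/allP => x /mapP[i _ ->]; rewrite addn_gt0.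
by move/allP: ih => -> //; exact: mem_nth.
Qed.

(** The weight is at least [size h + a], larger than the length [size h]. *)
Lemma shift_index_not_allones (l : (size h).-tuple 'I_a.+1) : is_composition l ->
  ~~ allones (shift_index l).
Proof.
move=> hl; apply/negP => /allones_sumn; rewrite shift_index_sumn// size_map size_enum_ord.
by have := size_le_sumn ih; lia.
Qed.

Lemma shifted_sum_congr c : Zspan_prod R (sumn h + a)
  (shifted_sum R SeriesReg h a - shifted_sum R c h a).
Proof.
rewrite /shifted_sum -sumrB; apply: qspan_sum => l hl; rewrite -mulrBr.
apply: qspanZ; first exact: israt_nat.
case: c; first by rewrite subrr; exact: qspan0.
rewrite -(shift_index_sumn hl); apply: zeta_reg_congr; first exact: shift_index_index.
exact: shift_index_not_allones.
Qed.

(** [Sreg_shift] with each leading coefficient of S replaced by a regularized zeta value, at the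
    cost of smaller depth. *)
Lemma Sreg_shifted_sum : Zspan_depth_le R (sumn h + a) ((size h)%:Z - 1)
  (Sreg R h (sumn h + a)%N - (-1) ^+ a * shifted_sum R SeriesReg h a).
Proof.
rewrite Sreg_shift ?leq_addr// addKn.
rewrite /shifted_sum -(shsum_tuple h (zeta_reg R SeriesReg) (leqnn a)) -mulrBr shsumB.
apply: qspanZ; first exact: israt_sgn.
apply: shsum_span => // v iv sv zv.
have v0 : v != [::] by apply: contra_eqN sv => /eqP -> /=; lia.
have [P [hP _]] := Sreg_top R iv v0; rewrite sv zv (@zeta_reg_series R v P)//.
by apply: eq_pasym hP => N _; rewrite /zr revK.
Qed.

End Shifts.

Lemma set_mod (A B : set R) x y z : A y -> B z -> x = y + z ->
  [set y + z | y in A & z in B] x.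
Proof. by move=> Ay Bz ->; exists y => //; exists z. Qed.

Lemma natF_same_parity w : is_index w -> (0 < size w)%N -> odd (sumn w) = odd (size w) ->
  Zspan_prod R (sumn w) (zeta_natF R w).
Proof.
move=> iw w0 pw; have K0 : (0 < sumn w)%N := leq_trans w0 (size_le_sumn iw).
have := qspanD (natF_congr iw K0) (Sneg_congr iw K0); congr (qspan _ _).
by rewrite -signr_odd oddD pw addbb expr0; ring.
Qed.

Lemma natF_rhs w c : is_index w -> (0 < size w)%N -> odd (sumn w) <> odd (size w) ->
  sumn w <> 2%N ->
  [set y + z | y in Zspan_prod R (sumn w)
             & z in Zspan_depth_le R (sumn w) ((size w)%:Z - 2)] (zeta_natF R w - rhs R c w).
Proof.
move=> iw w0 pw w2; have K0 : (0 < sumn w)%N := leq_trans w0 (size_le_sumn iw).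
have nw : ~~ allones w by apply/negP => /allones_sumn e; apply: pw; rewrite e.
have P0 := Psi_prod iw nw (introN eqP w2).
have h1 := natF_congr iw K0.
have h2 := Psi_split iw w0 K0.
have r0 := Psi_rest_depth iw K0.
have sg : (-1) ^+ (sumn w + size w) = -1 :> R.
  by rewrite -signr_odd oddD; case: (odd _) (odd _) pw => [] [].
case: w iw w0 pw w2 K0 nw P0 h1 h2 r0 sg => // a h iw _ pw w2 K0 nw P0 h1 h2 r0 sg.
have [a0 ih] : (0 < a)%N /\ is_index h by case/andP: iw.
have hE : sumn (a :: h) = (sumn h + a)%N by rewrite /= addnC.
have := lastI a h; set g := belast a h; set b := last a h => wE.
have ig : is_index g && (0 < b)%N by move: iw; rewrite wE /is_index all_rcons andbC.
have [{}ig b0] := andP ig.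
have gE : sumn (a :: h) = (sumn g + b)%N by rewrite wE sumn_rcons.
have tE : take (size (a :: h)).-1 (a :: h) = g by rewrite wE size_rcons -cats1 take_size_cat.
have d1 := Sreg_shifted_sum ih a0; rewrite -hE in d1.
have d2 := Sreg_shifted_sum ig b0; rewrite -gE in d2.
have sgE : (size g)%:Z - 1 = (size (a :: h))%:Z - 2 by rewrite wE size_rcons; lia.
have shE : (size h)%:Z - 1 = (size (a :: h))%:Z - 2 by rewrite /=; lia.
rewrite sgE in d2; rewrite shE in d1.
have c1 := shifted_sum_congr ih a0 c; rewrite -hE in c1.
have c2 := shifted_sum_congr ig b0 c; rewrite -gE in c2.
rewrite /rhs /drop_first /drop_last tE /head -/b [behead _]/=.
rewrite tE [behead _]/= sg in h2.
set K := sumn _ in h1 h2 r0 d1 d2 c1 c2 P0 *; set n := (size _)%:Z - 2 in r0 d1 d2 *.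
(* S(w) + S^-(w) is eliminated between [h1] and [h2]: modulo products, zeta^natF(w) is S(k_1, ...,
   k_(n-1)) - S(k_2, ..., k_n) minus [Psi_rest]. *)
have y1 := qspanD (qspanB h1 h2) P0.
have y2 := qspanB (qspanZ (israt_sgn R a) c1) (qspanZ (israt_sgn R b) c2).
apply: (set_mod (qspanB y1 y2) (qspanB (qspanB d2 d1) r0)).
move: (shifted_sum _ _ h a) (shifted_sum _ c h a) (shifted_sum _ _ g b) (shifted_sum _ c g b) => A B C D.
rewrite (_ : last 0%N (a :: h) = b) //.
ring.
Qed.

End Congruences.

Theorem proposition3p1 (R : realType) (k : seq nat)
    (hk : is_index k) (hn : (1 <= depth k)%N) :
  (odd (weight k) = odd (depth k) ->
     Zspan_prod R (weight k) (zeta_natF R k)) /\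
  (odd (weight k) <> odd (depth k) -> weight k <> 2%N ->
     (forall c : regularization,
        [set y + z | y in Zspan_prod R (weight k)
                   & z in Zspan_depth_le R (weight k) ((depth k)%:Z - 2)]
          (zeta_natF R k - rhs R c k)) /\
     (forall b : seq nat, rhs_index k b ->
        ~~ all (fun x => x == 1%N) b /\
        Zspan_prod R (weight k)
          (zeta_reg R SeriesReg b - zeta_reg R IntegralReg b))).
Proof.
split; first exact: natF_same_parity.
move=> pk k2; split; first by move=> c; exact: natF_rhs.
have side h a b : is_index h -> (0 < a)%N -> shifted_index h a b ->
    ~~ allones b /\ Zspan_prod R (sumn h + a) (zeta_reg R SeriesReg b - zeta_reg R IntegralReg b).
  move=> ih a0 [l hl ->]; have nl := shift_index_not_allones ih a0 hl; split=> //.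
  by rewrite -(shift_index_sumn hl); apply: zeta_reg_congr => //; exact: shift_index_index.
move=> b; case: k hk hn {pk k2} => // x h hk _.
have [x0 ih] : (0 < x)%N /\ is_index h by case/andP: hk.
case => [hb|hb].
  by have := side _ _ _ ih x0 hb; rewrite addnC.
have wE := lastI x h.
have /andP[l0 ig] : (0 < last x h)%N && is_index (belast x h).
  by move: hk; rewrite wE /is_index all_rcons.
have tE : drop_last (x :: h) = belast x h.
  by rewrite /drop_last wE size_rcons -cats1 take_size_cat.
rewrite tE in hb; have := side _ _ _ ig l0 hb.
by rewrite /weight wE sumn_rcons.
Qed.
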